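(* Let $G$ be a locally profinite group, $k$ a unital commutative ring and $\mathcal U\subseteq G$ an open compact subgroup. Let $x,y\in G$, and let $\alpha\in H^i(\mathcal U,\mathbf X_{\mathcal U}(x))$ and $\beta\in H^j(\mathcal U,\mathbf X_{\mathcal U}(y))$, viewed as elements of $E^i_{\mathcal U}$ and $E^j_{\mathcal U}$. Then $$\alpha\cdot\beta=\sum_{\substack{z\in \mathcal U\backslash G/\mathcal U\\ \mathcal U z\mathcal U\subseteq \mathcal U x\mathcal U\cdot \mathcal U y\mathcal U}}\gamma_z ,$$ where $\gamma_z\in H^{i+j}(\mathcal U,\mathbf X_{\mathcal U}(z))$ is determined by $$\mathrm{Sh}_z(\gamma_z)=\sum_{h\in \mathcal U_{x^{-1}}\backslash (x^{-1}\mathcal U z\cap \mathcal U y\mathcal U)/\mathcal U_{z^{-1}}}\mathrm{cores}^{\mathcal U_z\cap zh^{-1}\mathcal U hz^{-1}}_{\mathcal U_z}\big(\widetilde\Gamma_{z,h}\big),$$ with $$\widetilde\Gamma_{z,h}:=\mathrm{res}^{\mathcal U\cap zh^{-1}\mathcal Uhz^{-1}}_{\mathcal U_z\cap zh^{-1}\mathcal Uhz^{-1}}\big(a_*\mathrm{Sh}_x(\alpha)\big)\ \cup\ \mathrm{res}^{z\mathcal Uz^{-1}\cap zh^{-1}\mathcal Uhz^{-1}}_{\mathcal U_z\cap zh^{-1}\mathcal Uhz^{-1}}\big((axc)_*\mathrm{Sh}_y(\beta)\big),$$ where $a,c,d\in\mathcal U$ are such that $h=cyd=x^{-1}a^{-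1}z$.
   Context: $\mathrm{Mod}(G)$ is the category of smooth $G$-representations over $k$. For an open compact subgroup $\mathcal U$, $\mathbf X_{\mathcal U}$ is the space of compactly supported functions $G\to k$ constant on left cosets $g\mathcal U$, with $G$ acting by left translation $(gf)(\cdot)=f(g^{-1}\cdot)$; $\mathrm{char}_Y$ denotes a characteristic function. For $g\in G$, $\mathbf X_{\mathcal U}(g)\subseteq\mathbf X_{\mathcal U}$ is the $\mathcal U$-subrepresentation of functions supported on $\mathcal U g\mathcal U$, and $\mathcal U_g:=\mathcal U\cap g\mathcal U g^{-1}$. $E^*_{\mathcal U}:=\mathrm{Ext}^*_{\mathrm{Mod}(G)}(\mathbf X_{\mathcal U},\mathbf X_{\mathcal U})^{\mathrm{op}}$, whose product is the opposite of the Yoneda product in the graded sense: $\alpha\cdot\beta=(-1)^{ij}\beta\circ\alpha$ for $\alpha,\beta$ of degrees $i,j$. By Frobenius reciprocity $E^*_{\mathcal U}\cong H^*(\mathcal U,\mathbf X_{\mathcal U})=\bigoplus_{g\in\mathcal U\backslash G/\mathcal U}H^*(\mathcal U,\mathbf X_{\mathcal U}(g))$. The Shapiro isomorphism $\mathrm{Sh}_g:H^*(\mathcal U,\mathbf X_{\mathcal U}(g))\to H^*(\mathcal U_g,k)$ is restriction to $\mathcal U_g$ followed by the map induced on coefficients by evaluation at $g$, $f\mapsto f(g)$. For a subgroup $\mathcal V$ and $g\in G$, $g_*:H^*(\mathcal V,k)\to H^*(g\mathcal Vg^{-1},k)$ is the conjugation map, given on cocycles by $(g_*c)(v_1,\dots)=c(g^{-1}v_1g,\dots)$.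 $\mathrm{res}$, $\mathrm{cores}$, $\cup$ are the usual restriction, corestriction and cup product in the cohomology of profinite groups. *)

(* Defs.v *)
From HB Require Import structures.
From mathcomp Require Import all_boot all_order all_algebra.
From mathcomp Require Import all_classical topology.

Set Implicit Arguments.
Unset Strict Implicit.
Unset Printing Implicit Defensive.

Import GRing.Theory.

Local Open Scope classical_set_scope.
Local Open Scope ring_scope.

HB.mixin Record isTopologicalGroup G of Group G & Topological G := {
  mulg_continuous : continuous (fun p : G * G => (p.1 * p.2)%g);
  invg_continuous : continuous (fun g : G => g^-1%g) }.

#[short(type="topGroupType")]
HB.structure Definition TopGroup :=
  {G of Group G & Topological G & isTopologicalGroup G}.

Section Subgroups.
Variable G : topGroupType.
Implicit Types (A B L R V W : set G) (g : G).

Definition is_subgroup V : Prop :=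
  [/\ V 1%g, (forall g h, V g -> V h -> V (g * h)%g)
    & (forall g, V g -> V g^-1%g)].

Definition open_compact_subgroup V : Prop :=
  [/\ is_subgroup V, open V & compact V].

Definition prod_set A B : set G := [set (a * b)%g | a in A & b in B].
Definition lcoset_set g A : set G := [set (g * a)%g | a in A].
Definition dcoset L g R : set G := prod_set (prod_set L [set g]) R.

(* the conjugate g V g^-1 *)
Definition conj_set g V : set G := [set v | V (g^-1 * v * g)%g].

Definition dcoset_reps L R A Z : Prop :=
  Z `<=` A /\ forall g, A g -> exists! z, Z z /\ dcoset L z R g.

End Subgroups.

HB.mixin Record isLocallyProfinite G of TopGroup G := {
  locally_profinite_hausdorff : hausdorff_space G;
  locally_profinite_basis : forall A : set G, nbhs (1%g : G) A ->
    exists2 V : set G, open_compact_subgroup V & V `<=` A }.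

#[short(type="locProfiniteGroupType")]
HB.structure Definition LocProfiniteGroup :=
  {G of TopGroup G & isLocallyProfinite G}.

Record ocSubgroup (G : topGroupType) := OCSubgroup {
  ocs_set :> set G;
  ocs_prop : open_compact_subgroup ocs_set }.

Definition Uconj (G : topGroupType) (U : set G) (g : G) : set G :=
  U `&` conj_set g U.

Record smoothRep (G : topGroupType) (k : comPzRingType) := SmoothRep {
  rep_sort :> lmodType k;
  rep_act : G -> rep_sort -> rep_sort;
  rep_linear : forall g, linear (rep_act g);
  rep_act1 : forall v, rep_act 1%g v = v;
  rep_actM : forall g h v, rep_act (g * h)%g v = rep_act g (rep_act h v);
  rep_smooth : forall v, open [set g | rep_act g v = v] }.

Section Triv.
Variables (G : topGroupType) (k : comPzRingType).
Let act (g : G) (v : k^o) : k^o := v.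

Fact triv_linear g : linear (act g). Proof. by []. Qed.
Fact triv_act1 v : act 1%g v = v. Proof. by []. Qed.
Fact triv_actM g h v : act (g * h)%g v = act g (act h v). Proof. by []. Qed.
Fact triv_smooth v : open [set g | act g v = v].
Proof.
rewrite (_ : [set g | _] = setT); first exact: openT.
by apply/seteqP; split.
Qed.

Definition triv_rep : smoothRep G k :=
  SmoothRep triv_linear triv_act1 triv_actM triv_smooth.
End Triv.

Section Mod.
Variables (G : topGroupType) (k : comPzRingType).
Implicit Types (A B M N : smoothRep G k).

Definition is_repHom M N (f : M -> N) : Prop :=
  linear f /\ forall g v, f (rep_act g v) = rep_act g (f v).

Definition injective_rep (J : smoothRep G k) : Prop :=
  forall A B (i : A -> B) (f : A -> J),
    is_repHom i -> injective i -> is_repHom f ->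
    exists2 h : B -> J, is_repHom h & forall v, h (i v) = f v.

Record injResolution M := InjResolution {
  res_obj :> nat -> smoothRep G k;
  res_aug : M -> res_obj 0;
  res_d : forall n, res_obj n -> res_obj n.+1;
  res_aug_hom : is_repHom res_aug;
  res_d_hom : forall n, is_repHom (@res_d n);
  res_aug_inj : injective res_aug;
  res_exact0 : forall v, @res_d 0 v = 0 <-> exists w, v = res_aug w;
  res_exactS : forall n v, @res_d n.+1 v = 0 <-> exists w, v = @res_d n w;
  res_injective : forall n, injective_rep (res_obj n) }.

(* Ext^n_{Mod(G)}(N, M) is the n-th cohomology of the complex Hom_G(N, I) for
   an injective resolution I of M; its classes are represented by: *)
Definition ext_cocycle N M (I : injResolution M) n (f : N -> I n) : Prop :=
  is_repHom f /\ forall v, res_d (f v) = 0.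

(* F is a cocycle of degree j in the complex Hom(I, I), whose differential is
   F |-> d \o F - (-1)^j F \o d, and F extends f : M -> I^j.  The Yoneda product
   of the classes of f : M -> I^j and f' : N -> I^i is that of F \o f'. *)
Definition yoneda_lift M (I : injResolution M) j (f : M -> I j)
    (F : forall n, I n -> I (n + j)%N) : Prop :=
  [/\ forall n, is_repHom (F n),
      forall n v, res_d (F n v) = (-1) ^+ j *: (F n.+1 (res_d v) : I (n + j).+1)
    & forall v, F 0%N (res_aug I v) = f v].

End Mod.

(* A cochain of degree n of a subgroup V of G with values in M is given by a
   function seq G -> M, of which only the values on [tuples V n] = V^n matter. *)
Definition tuples (G : topGroupType) (V : set G) (n : nat) : set (seq G) :=
  [set s | size s = n /\ forall g, g \in s -> V g].

(* continuity on V^n, for the discrete topology on M *)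
Definition continuous_cochain (G : topGroupType) (V : set G) (M : Type)
    (n : nat) (c : seq G -> M) : Prop :=
  forall s, tuples V n s -> exists2 W : set G, nbhs (1%g : G) W &
    forall t, tuples V n t ->
      (forall m, (m < n)%N -> W ((nth 1 s m)^-1 * nth 1 t m)%g) -> c t = c s.

Section Cohomology.
Variables (G : topGroupType) (k : comPzRingType).

(* (s_0, ..., s_i s_{i+1}, ...) *)
Definition contract (i : nat) (s : seq G) : seq G :=
  take i s ++ (nth 1 s i * nth 1 s i.+1)%g :: drop i.+2 s.

Definition cobd (M : smoothRep G k) (n : nat) (c : seq G -> M) : seq G -> M :=
  fun s => rep_act (head 1%g s) (c (behead s))
           + \sum_(i < n) (-1) ^+ i.+1 *: c (contract i s)
           + (-1) ^+ n.+1 *: c (take n s).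

Section Coefficients.
(* H^n(V, N) for a V-subrepresentation N of M: its elements are represented by
   cocycles, equality being [cohomologous]. *)
Variables (V : set G) (M : smoothRep G k) (N : set M).

Definition cochain (n : nat) (c : seq G -> M) : Prop :=
  continuous_cochain V n c /\ forall s, tuples V n s -> N (c s).

Definition cocycle (n : nat) (c : seq G -> M) : Prop :=
  cochain n c /\ forall s, tuples V n.+1 s -> cobd n c s = 0.

Definition cohomologous (n : nat) (c c' : seq G -> M) : Prop :=
  match n with
  | 0 => forall s, tuples V 0 s -> c s = c' s
  | m.+1 => exists2 b, cochain m b &
              forall s, tuples V m.+1 s -> c s - c' s = cobd m b s
  end.
End Coefficients.

(* restriction from V to W; by the convention on cochains it does not change
   the representing function *)
Definition res (V W : set G) (M : Type) (c : seq G -> M) : seq G -> M := c.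

Definition conj_coh (g : G) (c : seq G -> k) : seq G -> k :=
  fun s => c [seq (g^-1 * v * g)%g | v <- s].

Definition cup (i : nat) (c c' : seq G -> k) : seq G -> k :=
  fun s => c (take i s) * c' (drop i s).

(* Corestriction from V to W for trivial coefficients.  Let [rcoset_repr V g]
   represent the coset V g; every V-equivariant homogeneous cochain on V extends
   to W along g |-> g (rcoset_repr V g)^-1, and the sum of its translates over
   the cosets V t of V in W is, in inhomogeneous terms,
   (w_1, ..., w_n) |-> \sum_t c (t_0 w_1 t_1^-1, ..., t_(n-1) w_n t_n^-1)
   where t_0 = t and t_m represents V t_(m-1) w_m. *)
Definition rcoset_repr (V : set G) (g : G) : G :=
  xget 1%g [set h | V (h * g^-1)%g].

Fixpoint transfer (V : set G) (t : G) (s : seq G) : seq G :=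
  if s is w :: s' then
    let t' := rcoset_repr V (t * w)%g in (t * w * t'^-1)%g :: transfer V t' s'
  else [::].

Definition cores (V W : set G) (c : seq G -> k) : seq G -> k :=
  fun s => \sum_(t \in [set rcoset_repr V w | w in W]) c (transfer V t s).

End Cohomology.

Section CompactInduction.
Variables (G : locProfiniteGroupType) (k : comPzRingType) (U : ocSubgroup G).

Definition X_pred : {pred G -> k^o} := fun f =>
  `[< (forall g u, ocs_set U u -> f (g * u)%g = f g)
      /\ compact (closure [set g | f g != 0]) >].

Lemma X_predP (f : G -> k^o) :
  (forall g u, ocs_set U u -> f (g * u)%g = f g) ->
  (exists2 K, compact K & forall g, f g != 0 -> K g) -> f \in X_pred.
Proof.
move=> fU [K cK fK]; apply/asboolP; split=> //.
apply: (subclosed_compact _ cK); first exact: closed_closure.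
have clK : closed K by apply: compact_closed => //; exact: locally_profinite_hausdorff.
by rewrite [K](iffLR (closure_id _) clK); apply: closureS.
Qed.

Lemma X_pred_supp (f : G -> k^o) : f \in X_pred ->
  (forall g u, ocs_set U u -> f (g * u)%g = f g) /\
  exists2 K, compact K & forall g, f g != 0 -> K g.
Proof.
move=> /asboolP[fU cf]; split=> //; exists (closure [set g | f g != 0]) => //.
by move=> g fg; apply: subset_closure.
Qed.

Fact X_submod_closed : submod_closed X_pred.
Proof.
split.
  apply: X_predP => //; exists set0; first exact: compact0.
  by move=> g; rewrite eqxx.
move=> a f f' /X_pred_supp[fU [K cK fK]] /X_pred_supp[fU' [K' cK' fK']].
apply: X_predP => [g u Uu|].
  by rewrite !fctE fU // fU'.
exists (K `|` K'); first exact: compactU.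
move=> g; rewrite !fctE => fg.
have [f0|/fK] := eqVneq (f g) 0; last by left.
have [f'0|/fK'] := eqVneq (f' g) 0; last by right.
by move: fg; rewrite f0 f'0 scaler0 addr0 eqxx.
Qed.

HB.instance Definition _ :=
  GRing.isSubmodClosed.Build k (G -> k^o) X_pred X_submod_closed.

Record X_sort := XSort { X_fun :> G -> k^o; X_funP : X_fun \in X_pred }.

HB.instance Definition _ := [isSub for X_fun].
HB.instance Definition _ := [Choice of X_sort by <:].
HB.instance Definition _ := [SubChoice_isSubLmodule of X_sort by <:].

Lemma mulg_cts (T : topologicalType) (f f' : T -> G) :
  continuous f -> continuous f' -> continuous (fun t => f t * f' t)%g.
Proof.
move=> cf cf' t.
apply: (@continuous_comp _ _ _ (fun t => (f t, f' t))
          (fun p : G * G => p.1 * p.2)%g).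
  by apply: cvg_pair; [exact: cf | exact: cf'].
exact: mulg_continuous.
Qed.

Fact X_act_subproof (g : G) (f : X_sort) :
  (fun t => f (g^-1 * t)%g) \in X_pred.
Proof.
have [fU [K cK fK]] := X_pred_supp (X_funP f).
apply: X_predP => [t u Uu|]; first by rewrite mulgA fU.
exists [set (g * t)%g | t in K].
  apply: continuous_compact => //; apply: continuous_subspaceT.
  by apply: mulg_cts => t; [exact: cst_continuous | exact: cvg_id].
by move=> t /fK Kt; exists (g^-1 * t)%g => //; rewrite mulgA mulgV mul1g.
Qed.

Definition X_act (g : G) (f : X_sort) : X_sort := XSort (X_act_subproof g f).

Fact X_act_linear g : linear (X_act g).
Proof. by move=> a f f'; apply: val_inj; apply/funext => t. Qed.

Fact X_act1 f : X_act 1%g f = f.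
Proof.
by apply: val_inj; apply/funext => t; rewrite /= invg1 mul1g.
Qed.

Fact X_actM g h f : X_act (g * h)%g f = X_act g (X_act h f).
Proof.
by apply: val_inj; apply/funext => t; rewrite /= invgM mulgA.
Qed.

Fact X_act_smooth f : open [set g | X_act g f = f].
Proof.
have [fU [K cK fK]] := X_pred_supp (X_funP f).
have [[U1 UM UV] oU _] := ocs_prop U.
have nearK : \forall g \near (1%g : G), K `<=` [set t | f (g^-1 * t)%g = f t].
  apply: (iffLR (compact_near_coveringP K)) => // t Kt.
  have cont : continuous (fun p : G * G => t^-1 * (p.2^-1 * p.1))%g.
    apply: mulg_cts; first by move=> p; exact: cst_continuous.
    apply: mulg_cts; last by move=> p; exact: cvg_fst.
    move=> p; apply: (@continuous_comp _ _ _ snd (fun g : G => g^-1%g)).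
      exact: cvg_snd.
    exact: invg_continuous.
  have cont' : continuous (fun p : G * G => t^-1 * p.1)%g.
    apply: mulg_cts; first by move=> p; exact: cst_continuous.
    by move=> p; exact: cvg_fst.
  have nU (h : G) : h = 1%g -> nbhs h U by move=> ->; exact: open_nbhs_nbhs.
  have n1 : nbhs ((t, 1%g) : G * G) [set p | ocs_set U (t^-1 * (p.2^-1 * p.1))%g].
    by apply: cont; apply: nU; rewrite /= invg1 mul1g mulVg.
  have n2 : nbhs ((t, 1%g) : G * G) [set p | ocs_set U (t^-1 * p.1)%g].
    by apply: cont'; apply: nU; rewrite /= mulVg.
  apply: filterS2 n1 n2 => -[t' g] /= h1 h2.
  rewrite -[(g^-1 * t')%g](mulVKg t) fU //.
  by rewrite -[t' in RHS](mulVKg t) fU.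
have near1 : \forall g \near (1%g : G), X_act g f = f.
  have nearKV : \forall g \near (1%g : G),
      K `<=` [set t | f (g^-1^-1 * t)%g = f t].
    have nK : nbhs ((1%g : G)^-1%g) [set g : G | K `<=` [set t | f (g^-1 * t)%g = f t]].
      by rewrite invg1; exact: nearK.
    exact: (@invg_continuous G (1%g : G) _ nK).
  apply: filterS2 nearK nearKV => g h1 h2.
  apply: val_inj; apply/funext => t /=.
  have [ft|/fK/h1//] := eqVneq (f t) 0.
  have [-> //|/fK/h2] := eqVneq (f (g^-1 * t)%g) 0.
  by rewrite /= invgK mulgA mulgV mul1g.
rewrite openE => g /= gf.
have cg : continuous (fun h : G => g^-1 * h)%g.
  by apply: mulg_cts => t; [exact: cst_continuous | exact: cvg_id].
have n1 : nbhs (g^-1 * g)%g [set h | X_act h f = f].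
  by rewrite mulVg; exact: near1.
have n2 : nbhs g [set h | X_act (g^-1 * h)%g f = f] by exact: (cg g _ n1).
apply: filterS n2 => h /= hf.
by rewrite -[h](mulVKg g) X_actM hf.
Qed.

Definition XU : smoothRep G k :=
  SmoothRep X_act_linear X_act1 X_actM X_act_smooth.

Definition X_at (g : G) : set XU :=
  [set f : XU | forall t, (f : X_sort) t != 0 -> dcoset U g U t].

Fact charU_subproof : (fun t => if `[< ocs_set U t >] then 1 else 0) \in X_pred.
Proof.
have [[U1 UM UV] _ cU] := ocs_prop U.
apply: X_predP => [g u Uu|].
  suff -> : `[< ocs_set U (g * u)%g >] = `[< ocs_set U g >] by [].
  apply/asbool_equiv_eq; split=> [Ugu|Ug]; last exact: UM.
  by rewrite -[g](mulgK u); apply: UM => //; exact: UV.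
exists (U : set G) => // g; case: asboolP => //.
by rewrite eqxx.
Qed.

Definition charU : XU := XSort charU_subproof.

Definition Sh (g : G) (c : seq G -> XU) : seq G -> k :=
  fun s => (res U (Uconj U g) c s : X_sort) g.

Section Frobenius.
Variables (M : smoothRep G k) (I : injResolution M).

(* The complex C^p(U, I^q); the differential of a family w of cochains is
   \delta + (-1)^p d. *)
Definition tot_diff (w : forall p q, seq G -> I q) (p q : nat) : seq G -> I q :=
  fun s =>
    match p return I q with 0 => 0 | p'.+1 => cobd p' (w p' q) s end +
    (-1) ^+ p *: match q return I q with 0 => 0 | q'.+1 => res_d (w p q' s) end.

(* Frobenius reciprocity Ext^n_{Mod(G)}(X_U, M) = H^n(U, M): a cocycle
   f : X_U -> I^n, seen as the U-invariant f(char_U) of I^n, and a cocycle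
   c of degree n correspond to each other when they are cohomologous in the total
   complex of C^p(U, I^q).  Here a and e are the images of f and c there. *)
Definition frobenius (n : nat) (f : XU -> I n) (c : seq G -> M) : Prop :=
  exists a e w : forall p q, seq G -> I q,
  [/\ (forall s, a 0%N n s = f charU) /\ (forall p q s, a p.+1 q s = 0),
      (forall s, e n 0%N s = res_aug I (c s)) /\ (forall p q s, e p q.+1 s = 0),
      forall p q, (p + q).+1 = n -> continuous_cochain U p (w p q)
    & forall p q s, (p + q)%N = n -> tuples U p s ->
        a p q s - e p q s = tot_diff w p q s].

End Frobenius.

(* [rho] represents the product alpha . beta in E_U = Ext(X_U, X_U)^op, all
   three being cocycles on U with values in X_U.  Up to the graded sign this is
   the class of F \o fa, the Yoneda product of fb and fa. *)
Definition E_product (I : injResolution XU) (i j : nat)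
    (alpha beta rho : seq G -> XU) : Prop :=
  exists (fa : XU -> I i) (fb : XU -> I j) (F : forall n, I n -> I (n + j)%N),
  [/\ ext_cocycle fa /\ frobenius fa alpha,
      ext_cocycle fb /\ frobenius fb beta,
      yoneda_lift fb F
    & frobenius (fun v => (-1) ^+ (i * j) *: F i (fa v)) rho].

End CompactInduction.

(* Main.v *)
Require Import Defs.
From HB Require Import structures.
From mathcomp Require Import all_boot all_order all_algebra.
From mathcomp Require Import all_classical topology.

Set Implicit Arguments.
Unset Strict Implicit.
Unset Printing Implicit Defensive.

Import GRing.Theory.

Local Open Scope classical_set_scope.
Local Open Scope ring_scope.

(** The compact induction [XU k U] is generated by the [U]-invariant [charU], so
    a homomorphism from it to [N] is a [U]-invariant of [N], and its extension
    groups are the cohomology of [U].  This turns the product into a computation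
    with cochains of [U], in two parts: a cochain that represents the product,
    and a comparison of two sums of cup products.

    All computations use homogeneous cochains.  A cochain of a subgroup [V] is
    regarded as a [G]-equivariant function on the lists whose entries lie in one
    left coset of [V] ([homog]); its differential is the alternating sum over the
    faces of a list ([hdiff]), and two ways of moving the vertices of a list
    inside the same cosets are homotopic through the prism operator
    ([prism_homotopy]).

    The product.  For a cochain [m] of [U] with values in [N], let [alpha * m]
    ([star]) be the cup product of [alpha] with the extension of [m] to the
    [G]-set [G / U], under the pairing that sums over [G / U].  If [m] is the
    invariant [f (charU)] of a homomorphism [f], then [alpha * m] is [f] applied
    to the values of [alpha] ([star_inv]).  Let [fa] and [fb] correspond to
    [alpha] and [beta], and let [F] lift [fb] to the resolution.  In the double
    complex of cochains of [U] with values in the resolution,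
<<
    F (fa charU)  ~  F alpha  =  fb alpha  =  alpha * (fb charU)  ~  alpha * beta
>>
    where the first step is [F] applied to the homotopy that relates [fa] to
    [alpha], and the last one is the product of [alpha] with the homotopy that
    relates [fb] to [beta].  Moving [F], of degree [j], past cochains of degree
    [i] produces the sign that cancels the one of the graded opposite product
    ([frobenius_elt_star]).  The rows of the augmented double complex are exact,
    and its columns are exact because injective representations are acyclic for
    [U] ([injective_acyclic]); so the correspondence between invariants of the
    resolution and classes of [U] is well defined in both directions
    ([frobenius_elt_exists], [frobenius_elt_uniq]), and the product of [alpha] and
    [beta] is the class of [star beta] ([E_productP]).

    The components.  The values of [star beta] are supported in
    [U x U . U y U], a finite union of double cosets, and [gamma z] is the
    restriction of [star beta] to [U z U].  It is determined by its image under
    the Shapiro map, which is injective ([shapiro_inj]).  That image is a sum over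
    the cosets [g U] in [U x U] such that [g ^-1 z] lies in [U y U]; the group
    [Uconj U z] permutes them, and its orbits are those of the cosets
    [z h ^-1 U = a x U] for [h] in [H z] ([sum_orbits]).  The stabilizer of this
    coset is the subgroup from which the formula takes the corestriction, and the
    transfer is again a motion of vertices ([transferE]).  Hence the partial sum
    over an orbit and the corestriction of [Gamma z h] are sums of the same cup
    products, for vertices that differ only within the same cosets
    ([cores_pairing]), and the prism between the two choices is a homotopy
    ([cohomologous_orbit]). *)

(** * Homogeneous cochains on lists *)

Section HomogeneousAlgebra.
Variables (T : eqType) (A : zmodType).
Implicit Types (C : seq T -> A) (P : T -> Prop).

(** The alternating sum over the faces of a list, computed as for a cone: the
    faces of [x :: l] are [l] and the cones over the faces of [l].  This makes the
    identities below inductions on the list, free of signs and indices. *)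
Fixpoint hdiff C (l : seq T) : A :=
  if l is x :: l' then C l' - hdiff (fun r => C (x :: r)) l' else 0.

Lemma eq_hdiff P n C C' l :
  (forall r, size r = n -> {in r, forall x, P x} -> C r = C' r) ->
  size l = n.+1 -> {in l, forall x, P x} -> hdiff C l = hdiff C' l.
Proof.
elim: n C C' l => [|n IH] C C' [//|x l] CC [sl] Pl /=.
  by rewrite (size0nil sl) /= CC.
have Px : P x by apply: Pl; rewrite inE eqxx.
have Pl' : {in l, forall y, P y} by move=> y yl; apply: Pl; rewrite inE yl orbT.
rewrite CC //; congr (_ - _); apply: IH => // r sr Pr; apply: CC => //=.
  by rewrite sr.
by move=> y; rewrite inE => /predU1P[->//|/Pr].
Qed.

Lemma eq_hdiffT C C' l : C =1 C' -> hdiff C l = hdiff C' l.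
Proof.
by elim: l C C' => //= x l IH C C' CC; rewrite CC (IH _ (fun r => C' (x :: r))).
Qed.

Lemma hdiff_eq0 C l : (forall r, C r = 0) -> hdiff C l = 0.
Proof.
elim: l C => //= x l IH C C0.
by rewrite C0 IH ?subr0 // => r; rewrite C0.
Qed.

Lemma hdiffD C C' l : hdiff (fun r => C r + C' r) l = hdiff C l + hdiff C' l.
Proof.
elim: l C C' => [|x l IH] C C' /=; first by rewrite addr0.
by rewrite IH opprD addrACA.
Qed.

Lemma hdiffN C l : hdiff (fun r => - C r) l = - hdiff C l.
Proof.
elim: l C => [|x l IH] C /=; first by rewrite oppr0.
by rewrite IH opprB opprK addrC.
Qed.

Lemma hdiffB C C' l : hdiff (fun r => C r - C' r) l = hdiff C l - hdiff C' l.
Proof. by rewrite hdiffD hdiffN. Qed.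

Lemma hdiff_sum (J : Type) (r : seq J) (Q : pred J) (F : J -> seq T -> A) l :
  hdiff (fun s => \sum_(m <- r | Q m) F m s) l = \sum_(m <- r | Q m) hdiff (F m) l.
Proof.
elim: r => [|m r IH].
  by rewrite big_nil hdiff_eq0 // => s; rewrite big_nil.
rewrite big_cons -IH; case: ifP => Qm; last first.
  by apply: eq_hdiffT => s; rewrite big_cons Qm.
by rewrite -hdiffD; apply: eq_hdiffT => s; rewrite big_cons Qm.
Qed.

Lemma hdiff_hdiff C l : hdiff (hdiff C) l = 0.
Proof.
elim: l C => //= x l IH C.
by rewrite hdiffB IH subr0 subrr.
Qed.

End HomogeneousAlgebra.

Lemma hdiff_morph (T : eqType) (A B : zmodType) (f : A -> B) (C : seq T -> A) l :
  {morph f : x y / x - y} -> hdiff (fun r => f (C r)) l = f (hdiff C l).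
Proof.
move=> fB; elim: l C => [|x l IH] C /=.
  by rewrite -[0 in RHS](subrr 0) fB subrr.
by rewrite fB IH.
Qed.

Lemma hdiff_map (S T : eqType) (A : zmodType) (f : S -> T) (C : seq T -> A) l :
  hdiff (fun r => C (map f r)) l = hdiff C (map f l).
Proof.
by elim: l C => //= x l IH C; rewrite (IH (fun r => C (f x :: r))).
Qed.

(** The indexed form, in which [hdiff] is compared with [cobd]. *)
Lemma hdiff_faces (T : eqType) (R : pzRingType) (A : lmodType R) (C : seq T -> A) l :
  hdiff C l = \sum_(m < size l) (-1) ^+ m *: C (take m l ++ drop m.+1 l).
Proof.
elim: l C => [|x l IH] C /=; first by rewrite big_ord0.
rewrite big_ord_recl /= drop0 expr0 scale1r IH; congr (_ + _).
rewrite -sumrN; apply: eq_bigr => m _.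
by rewrite /bump /= exprS mulN1r scaleNr.
Qed.

Section Prism.
Variables (T : eqType) (A : zmodType).
Implicit Types (C : seq T -> A) (l : seq (T * T)).

(** The prism operator: for a list of pairs [(x_m, y_m)] it is the alternating
    sum of [C (x_0, ..., x_m, y_m, ..., y_n)], the chain homotopy between two
    maps of simplices. *)
Fixpoint prism C l : A :=
  if l is (x, y) :: l' then
    C [:: x, y & map snd l'] - prism (fun r => C (x :: r)) l'
  else 0.

Lemma eq_prismT C C' l : C =1 C' -> prism C l = prism C' l.
Proof.
by elim: l C C' => //= -[x y] l IH C C' CC; rewrite CC (IH _ (fun r => C' (x :: r))).
Qed.

Lemma eq_prism (P : T -> Prop) n C C' l :
  (forall r, size r = n.+1 -> {in r, forall x, P x} -> C r = C' r) ->
  size l = n -> {in l, forall p, P p.1 /\ P p.2} -> prism C l = prism C' l.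
Proof.
elim: n C C' l => [|n IH] C C' [//|[x y] l] CC [sl] Pl //=.
have [Px Py] : P x /\ P y by apply: (Pl (x, y)); rewrite inE eqxx.
have Pl' : {in l, forall p, P p.1 /\ P p.2}.
  by move=> p pl; apply: Pl; rewrite inE pl orbT.
have -> : C [:: x, y & map snd l] = C' [:: x, y & map snd l].
  apply: CC => [|z]; first by rewrite /= size_map sl.
  rewrite !inE => /orP[/eqP->//|/orP[/eqP->//|/mapP[p pl ->]]].
  by case: (Pl' p pl).
congr (_ - _); apply: IH => // r sr Pr; apply: CC => /=; first by rewrite sr.
by move=> z; rewrite inE => /predU1P[->//|/Pr].
Qed.

Lemma prismB C C' l : prism (fun r => C r - C' r) l = prism C l - prism C' l.
Proof.
elim: l C C' => [|[x y] l IH] C C' /=; first by rewrite subr0.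
by rewrite IH !opprB addrACA [RHS]addrACA [- _ - _]addrC.
Qed.

(** By induction on the list: the two terms that contain both [x] and [y]
    cancel, and the remaining ones telescope. *)
Lemma prism_homotopy C l :
  hdiff (prism C) l = C (map snd l) - C (map fst l) - prism (hdiff C) l.
Proof.
elim: l C => [|[x y] l IH] C /=; first by rewrite subrr subr0.
rewrite (eq_hdiffT (C' := fun r => C [:: x, y & map snd r]
           - prism (fun s => C (x :: s)) r)) //.
rewrite hdiffB IH.
rewrite (hdiff_map snd (fun r => C [:: x, y & r])).
rewrite prismB.
move: (C (y :: _)) (C (x :: map snd l)) (C (x :: _)) (C (x :: _)) => c1 c2 c3 c4.
move: (prism C l) (prism _ _) (hdiff _ _) => p1 p2 d.
rewrite !opprB !addrA.
by rewrite [RHS](ACl ((1*7)*(3*5*2*4*6))) /= subrr add0r.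
Qed.

End Prism.

Lemma prism_map (S T : eqType) (A : zmodType) (f : S -> T) (C : seq T -> A) l :
  prism (fun r => C (map f r)) l = prism C (map (fun p => (f p.1, f p.2)) l).
Proof.
elim: l C => //= -[x y] l IH C /=; rewrite (IH (fun r => C (f x :: r))).
by rewrite -!map_comp.
Qed.

Section CupProduct.
Variables (T : eqType) (k : comPzRingType) (M : lmodType k).
Implicit Types (C : seq T -> M) (a : seq T -> k).

Definition hcup i a C l := a (take i.+1 l) *: C (drop i l).

(** The Leibniz rule.  Both sides are cones over the first vertex, which is
    removed by induction on [i]. *)
Lemma hdiff_cup i n a C l : size l = (i + n).+2 ->
  hdiff (hcup i (a : seq T -> k^o) C) l
  = hcup i.+1 (hdiff (a : seq T -> k^o)) C l + (-1) ^+ i *: hcup i a (hdiff C) l.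
Proof.
rewrite /hcup; elim: i a l => [|i IH] a [//|x l] [sl].
  case: l sl => [//|y l] sl; rewrite /= take0 /= subr0 expr0 scale1r.
  rewrite (hdiff_morph (f := fun v => a [:: x] *: v)); last first.
    by move=> u v; rewrite scalerBr.
  by rewrite scalerBl !scalerBr addrA subrK.
have := IH (fun r => a (x :: r)) l sl; rewrite /= => ->.
by rewrite scalerBl opprD addrA exprS mulN1r scaleNr.
Qed.

End CupProduct.

(** * Homogeneous and inhomogeneous cochains of a representation *)

Section RepAct.
Variables (G : topGroupType) (k : comPzRingType) (M : smoothRep G k) (g : G).

HB.instance Definition _ :=
  GRing.isLinear.Build k M M *:%R (@rep_act G k M g) (@rep_linear G k M g).

Lemma rep_actD : {morph (@rep_act G k M g) : v w / v + w}. Proof. exact: linearD. Qed.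
Lemma rep_actB : {morph (@rep_act G k M g) : v w / v - w}. Proof. exact: linearB. Qed.
Lemma rep_act0 : rep_act g (0 : M) = 0. Proof. exact: linear0. Qed.
Lemma rep_actZ a : {morph (@rep_act G k M g) : v / a *: v}. Proof. exact: linearZ. Qed.
Lemma rep_act_sum (J : Type) (r : seq J) (Q : pred J) (F : J -> M) :
  rep_act g (\sum_(m <- r | Q m) F m) = \sum_(m <- r | Q m) rep_act g (F m).
Proof. exact: linear_sum. Qed.

End RepAct.

Section RepHom.
Variables (G : topGroupType) (k : comPzRingType) (M N : smoothRep G k) (f : M -> N).
Hypothesis fhom : is_repHom f.

Let fL : {linear M -> N} :=
  HB.pack f (GRing.isLinear.Build k M N *:%R f (proj1 fhom)).

Lemma repHomD : {morph f : v w / v + w}. Proof. exact: (linearD fL). Qed.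
Lemma repHomB : {morph f : v w / v - w}. Proof. exact: (linearB fL). Qed.
Lemma repHom0 : f 0 = 0. Proof. exact: (linear0 fL). Qed.
Lemma repHomZ a : {morph f : v / a *: v}. Proof. exact: (linearZ_LR fL). Qed.
Lemma repHom_sum (J : Type) (r : seq J) (Q : pred J) (F : J -> M) :
  f (\sum_(m <- r | Q m) F m) = \sum_(m <- r | Q m) f (F m).
Proof. exact: (linear_sum fL). Qed.
Lemma repHom_act g v : f (rep_act g v) = rep_act g (f v).
Proof. exact: (proj2 fhom). Qed.

End RepHom.

Section Lists.
Variable G : topGroupType.
Implicit Types (V W : set G) (g h : G) (l s : seq G).

(** The edges of the simplex with the vertices [l], and conversely the simplex
    with the edges [s] that starts at [1]. *)
Definition diffs l : seq G :=
  if l is g :: l' then pairmap (fun g h => g^-1 * h)%g g l' else [::].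

Definition pprods s : seq G := 1%g :: scanl (fun g h => g * h)%g 1%g s.

Lemma size_diffs l : size (diffs l) = (size l).-1.
Proof. by case: l => //= g l; rewrite size_pairmap. Qed.

Lemma size_pprods s : size (pprods s) = (size s).+1.
Proof. by rewrite /= size_scanl. Qed.

Lemma pprodsK s : diffs (pprods s) = s.
Proof. by apply: scanlK => g h; rewrite mulKg. Qed.

Lemma diffs_cons2 g h l : diffs [:: g, h & l] = (g^-1 * h)%g :: diffs (h :: l).
Proof. by []. Qed.

Lemma diffs_mull g l : diffs (map (fun h => g * h)%g l) = diffs l.
Proof.
case: l => //= h l; elim: l h => //= h' l IH h.
by rewrite IH invgM -mulgA mulKg.
Qed.

Lemma pprods_diffs l : l != [::] ->
  map (fun h => head 1 l * h)%g (pprods (diffs l)) = l.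
Proof.
case: l => //= g l _; rewrite mulg1; congr (_ :: _).
have aux x : map (fun h => g * h)%g (scanl (fun g h => g * h)%g x
    (pairmap (fun g h => g^-1 * h)%g (g * x)%g l)) = l.
  elim: l x => //= h l IH x.
  have e : (g * (x * ((g * x)^-1 * h)) = h)%g by rewrite mulgA mulgA mulgV mul1g.
  by rewrite e; congr (_ :: _); rewrite -{2}e; apply: IH.
by rewrite -{2}[g]mulg1 aux.
Qed.

Lemma diffs_take i l : diffs (take i.+1 l) = take i (diffs l).
Proof.
case: l => //= g l; elim: i g l => [|i IH] g l; first by rewrite !take0.
by case: l => //= h l; rewrite IH.
Qed.

Lemma diffs_drop i l : diffs (drop i l) = drop i (diffs l).
Proof.
elim: i l => [|i IH] l; first by rewrite !drop0.
by case: l => //= g l; rewrite IH; case: l.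
Qed.

(** Omitting an inner vertex multiplies the two edges that meet there, whence
    the differential of inhomogeneous cochains. *)
Lemma diffs_face i l : (i.+2 < size l)%N ->
  diffs (take i.+1 l ++ drop i.+2 l) = contract i (diffs l).
Proof.
elim: i l => [|i IH] [//|g0 [//|g1 l]].
  case: l => [//|g2 l] _.
  rewrite /contract /= drop0.
  by congr (_ :: _); rewrite mulgA mulgK.
move=> sl; have e := IH (g1 :: l) sl.
by rewrite diffs_cons2 -[RHS]/(_ :: contract i (diffs (g1 :: l))) -e.
Qed.

Lemma tuples_sub V W n : V `<=` W -> tuples V n `<=` tuples W n.
Proof. by move=> VW s [<- sV]; split=> // g /sV/VW. Qed.

Lemma tuples_cons V n g s : tuples V n.+1 (g :: s) <-> V g /\ tuples V n s.
Proof.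
split=> [[[sn] gsV]|[Vg [<- sV]]].
  split; first by apply: gsV; rewrite inE eqxx.
  by split=> // h hs; apply: gsV; rewrite inE hs orbT.
by split=> // h; rewrite inE => /predU1P[->//|/sV].
Qed.

Lemma tuples0 V s : tuples V 0 s <-> s = [::].
Proof. by split=> [[/size0nil]|->]. Qed.

Lemma tuples_map V W (f : G -> G) n s :
  (forall g, V g -> W (f g)) -> tuples V n s -> tuples W n (map f s).
Proof.
move=> VW [<- sV]; split; first by rewrite size_map.
by move=> _ /mapP[g /sV Vg ->]; exact: VW.
Qed.

Lemma tuples_take V n i s : tuples V (i + n) s -> tuples V i (take i s).
Proof.
move=> [sn sV]; split; first by rewrite size_takel // sn leq_addr.
by move=> g /mem_take/sV.
Qed.

Lemma tuples_drop V n i s : tuples V (i + n) s -> tuples V n (drop i s).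
Proof.
move=> [sn sV]; split; first by rewrite size_drop sn addnC addnK.
by move=> g /mem_drop/sV.
Qed.

Lemma tuples_diffs V n l : is_subgroup V -> tuples V n.+1 l -> tuples V n (diffs l).
Proof.
move=> [_ VM VV] [sl lV]; split; first by rewrite size_diffs sl.
case: l {sl} lV => //= g l; elim: l g => //= h l IH g lV x.
rewrite inE => /predU1P[->|]; last first.
  by apply: IH => y yl; apply: lV; rewrite inE yl orbT.
by apply: VM; [apply: VV|]; apply: lV; rewrite !inE eqxx ?orbT.
Qed.

Lemma tuples_pprods V n s : is_subgroup V -> tuples V n s -> tuples V n.+1 (pprods s).
Proof.
move=> [V1 VM _] sV; apply/tuples_cons; split=> //.
elim: s n 1%g V1 sV => [|h s IH] [|n] g Vg.
- by [].
- by move=> [].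
- by move=> [].
by move=> /tuples_cons[Vh sV] /=; apply/tuples_cons; split; [|apply: IH] => //; exact: VM.
Qed.

End Lists.

Section Homogeneous.
Variables (G : topGroupType) (k : comPzRingType) (M : smoothRep G k).
Implicit Types (c C : seq G -> M) (V : set G) (l s : seq G).

(** The homogeneous cochain of an inhomogeneous one.  It is defined and
    equivariant for all lists of [G], so that a cochain on [V] can be evaluated
    on lists in any left coset of [V]. *)
Definition homog c : seq G -> M := fun l => rep_act (head 1%g l) (c (diffs l)).

Definition inhomog C : seq G -> M := fun s => C (pprods s).

Definition equivariant V n C :=
  forall g l, V g -> tuples V n l -> C (map (fun h => g * h)%g l) = rep_act g (C l).

Lemma homog_mull c g l : l != [::] ->
  homog c (map (fun h => g * h)%g l) = rep_act g (homog c l).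
Proof. by case: l => // h l _; rewrite /homog diffs_mull /= rep_actM. Qed.

Lemma homog_pprods c s : homog c (pprods s) = c s.
Proof. by rewrite /homog pprodsK /= rep_act1. Qed.

Lemma homog_inhomog V n C l : is_subgroup V -> equivariant V n.+1 C ->
  tuples V n.+1 l -> homog (inhomog C) l = C l.
Proof.
move=> sV CV lV; have sV' := sV; case: sV' => V1 VM VV.
have l0 : l != [::] by case: lV => [+ _]; case: l.
rewrite /homog /inhomog -CV ?pprods_diffs //.
  by case: l l0 lV => //= g l _ /tuples_cons[].
exact: tuples_pprods sV (tuples_diffs sV lV).
Qed.

Lemma eq_homog V n c c' : is_subgroup V ->
  (forall s, tuples V n s -> c s = c' s) ->
  forall l, tuples V n.+1 l -> homog c l = homog c' l.
Proof. by move=> sV cc l /(tuples_diffs sV)/cc; rewrite /homog => ->. Qed.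

Lemma homog_cobd n c l : size l = n.+2 -> homog (cobd n c) l = hdiff (homog c) l.
Proof.
move=> sl; rewrite (hdiff_faces (homog c)) sl big_ord_recl big_ord_recr /=.
rewrite /homog /cobd !rep_actD rep_act_sum.
have hd i : head 1%g (take i.+1 l ++ drop i.+2 l) = head 1%g l by case: l {sl}.
rewrite addrA; congr (_ + _ + _).
- case: l sl {hd} => [//|g0 [//|g1 l]] _.
  by rewrite expr0 scale1r /= -rep_actM mulVKg.
- apply: eq_bigr => i _; rewrite rep_actZ /bump /= add1n hd diffs_face //.
  by rewrite sl !ltnS ltn_ord.
- rewrite rep_actZ /bump /= add1n hd; congr (_ *: rep_act _ (c _)).
  by rewrite -diffs_take drop_oversize ?cats0 // sl.
Qed.

Lemma cobdE n c s : size s = n.+1 -> cobd n c s = hdiff (homog c) (pprods s).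
Proof. by move=> sn; rewrite -(homog_cobd (n := n)) ?homog_pprods // size_pprods sn. Qed.

Lemma eq_cobd V n c c' s : is_subgroup V ->
  (forall r, tuples V n r -> c r = c' r) -> tuples V n.+1 s ->
  cobd n c s = cobd n c' s.
Proof.
move=> sV cc sn; have [ss _] := sn; rewrite !cobdE //.
have [sl lV] := tuples_pprods sV sn.
apply: (eq_hdiff (P := V) (n := n.+1)) => // r sr rV.
by apply: (eq_homog sV cc).
Qed.

Lemma cobd_cobd V n c s : is_subgroup V -> tuples V n.+2 s ->
  cobd n.+1 (cobd n c) s = 0.
Proof.
move=> sV sn; have [ss _] := sn; rewrite cobdE //.
have [sl lV] := tuples_pprods sV sn.
rewrite -(hdiff_hdiff (homog c) (pprods s)).
by apply: (eq_hdiff (P := V) (n := n.+2)) => // r sr _; rewrite homog_cobd.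
Qed.

Lemma cobdB n c c' s : cobd n (fun r => c r - c' r) s = cobd n c s - cobd n c' s.
Proof.
rewrite /cobd rep_actB; set S := (X in _ + X + _).
have -> : S = \sum_(i < n) (-1) ^+ i.+1 *: c (contract i s)
   - \sum_(i < n) (-1) ^+ i.+1 *: c' (contract i s).
  by rewrite -sumrB; apply: eq_bigr => m _; rewrite scalerBr.
by rewrite scalerBr !opprD !addrA [LHS](ACl (1*3*5*2*4*6)).
Qed.

Lemma cobdZ n a c s : cobd n (fun r => a *: c r) s = a *: cobd n c s.
Proof.
rewrite /cobd rep_actZ !scalerDr scaler_sumr.
congr (_ + _ + _); last by rewrite !scalerA mulrC.
by apply: eq_bigr => m _; rewrite !scalerA mulrC.
Qed.

Lemma cobdD n c c' s : cobd n (fun r => c r + c' r) s = cobd n c s + cobd n c' s.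
Proof.
have -> : (fun r => c r + c' r) = (fun r => c r - (-1) *: c' r).
  by apply/funext => r; rewrite scaleN1r opprK.
by rewrite cobdB cobdZ scaleN1r opprK.
Qed.

Lemma cobd0 n c s : (forall r, c r = 0) -> cobd n c s = 0.
Proof.
move=> c0; rewrite /cobd !c0 rep_act0 scaler0 addr0 add0r big1 // => m _.
by rewrite c0 scaler0.
Qed.

End Homogeneous.

Lemma cobd_hom (G : topGroupType) (k : comPzRingType) (M N : smoothRep G k)
    (f : M -> N) n c s :
  is_repHom f -> cobd n (fun r => f (c r)) s = f (cobd n c s).
Proof.
move=> fh; rewrite /cobd !(repHomD fh) (repHom_act fh) (repHom_sum fh) (repHomZ fh).
by congr (_ + _ + _); apply: eq_bigr => m _; rewrite (repHomZ fh).
Qed.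

(** * Uniform continuity of cochains on compact subgroups *)

Ltac group_word :=
  rewrite ?(invgM, invgK, invg1, mulg1, mul1g, mulgA, mulgK, mulgVK, mulVg, mulgV) //.

Section TopologicalGroup.
Variable G : topGroupType.
Implicit Types (A V W : set G) (g h : G) (l s t : seq G).

Lemma mulgl_continuous g : continuous (fun h : G => g * h)%g.
Proof.
move=> h; apply: (@continuous_comp _ _ _ (fun h => (g, h))
    (fun p : G * G => p.1 * p.2)%g); last exact: mulg_continuous.
by apply: cvg_pair; [exact: cst_continuous | exact: cvg_id].
Qed.

Lemma mulgr_continuous g : continuous (fun h : G => h * g)%g.
Proof.
move=> h; apply: (@continuous_comp _ _ _ (fun h => (h, g))
    (fun p : G * G => p.1 * p.2)%g); last exact: mulg_continuous.
by apply: cvg_pair; [exact: cvg_id | exact: cst_continuous].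
Qed.

Definition open_subgroup W := is_subgroup W /\ open W.

Lemma open_subgroup_nbhs W : open_subgroup W -> nbhs (1%g : G) W.
Proof. by move=> [[W1 _ _] oW]; exact: open_nbhs_nbhs. Qed.

Lemma lcoset_nbhs g W : nbhs (1%g : G) W -> nbhs g [set h | W (g^-1 * h)%g].
Proof. by move=> W1; apply: mulgl_continuous; rewrite mulVg. Qed.

(** A subgroup that contains a neighbourhood of [1] contains one of each of its
    points, by translation. *)
Lemma subgroup_open W W' : is_subgroup W -> nbhs (1%g : G) W' -> W' `<=` W -> open W.
Proof.
move=> [W1 WM WV] nW' W'W; rewrite openE => g Wg.
apply: filterS (lcoset_nbhs g nW') => h /W'W Wh.
by rewrite -[h](mulVKg g); apply: WM.
Qed.

Lemma open_subgroupI W W' :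
  open_subgroup W -> open_subgroup W' -> open_subgroup (W `&` W').
Proof.
move=> [[W1 WM WV] oW] [[W'1 W'M W'V] oW']; split; last exact: openI.
split=> [//|g h [? ?] [? ?]|g [? ?]]; split;
  by [apply: WM|apply: W'M|apply: WV|apply: W'V].
Qed.

Lemma conj_subgroup g V : is_subgroup V -> is_subgroup (conj_set g V).
Proof.
move=> [V1 VM VV]; split=> [|a b Va Vb|a Va]; rewrite /conj_set /=.
- by rewrite mulg1 mulVg.
- have -> : (g^-1 * (a * b) * g = (g^-1 * a * g) * (g^-1 * b * g))%g.
    by rewrite !mulgA mulgK.
  exact: VM.
- by have := VV _ Va; rewrite /= !invgM invgK mulgA.
Qed.

Lemma conj_open g V : open V -> open (conj_set g V).
Proof.
move=> oV; apply: (open_comp (f := fun v => g^-1 * v * g)%g) => // h _.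
apply: (@continuous_comp _ _ _ (fun v => g^-1 * v)%g (fun v => v * g)%g).
  exact: mulgl_continuous.
exact: mulgr_continuous.
Qed.

Lemma conj_open_subgroup g W : open_subgroup W -> open_subgroup (conj_set g W).
Proof. by move=> [sW oW]; split; [exact: conj_subgroup | exact: conj_open]. Qed.

Definition normalizes V W := forall v w, V v -> W w -> W (v^-1 * w * v)%g.

Lemma normalizes_conj V W v w : is_subgroup V -> normalizes V W ->
  V v -> W w -> W (v * w * v^-1)%g.
Proof.
move=> [_ _ VV] nW Vv Ww.
by have := nW v^-1%g w (VV _ Vv) Ww; rewrite invgK.
Qed.

Definition close W n s t :=
  forall m, (m < n)%N -> W ((nth 1 s m)^-1 * nth 1 t m)%g.

Lemma close_cons W n g h s t :
  close W n.+1 (g :: s) (h :: t) <-> W (g^-1 * h)%g /\ close W n s t.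
Proof.
split=> [c|[Wgh c] [//|m] /c //].
by split=> [|m mn]; [exact: (c 0) | exact: (c m.+1)].
Qed.

Lemma close_sub W W' n s t : W `<=` W' -> close W n s t -> close W' n s t.
Proof. by move=> WW c m /c/WW. Qed.

Lemma close_map V W W' n (f f' : G -> G) s t :
  (forall g h, V g -> V h -> W (g^-1 * h)%g -> W' ((f g)^-1 * f' h)%g) ->
  tuples V n s -> tuples V n t ->
  close W n s t -> close W' n (map f s) (map f' t).
Proof.
move=> ff [ss sV] [st tV] c m mn; rewrite !(nth_map 1%g) ?ss ?st //.
by apply: ff (c m mn); [apply: sV|apply: tV]; rewrite mem_nth ?ss ?st.
Qed.

Lemma close_take W n i s t : close W (i + n) s t -> close W i (take i s) (take i t).
Proof. by move=> c m mi; rewrite !nth_take //; apply: c; rewrite ltn_addr. Qed.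

Lemma close_drop W n i s t : close W (i + n) s t -> close W n (drop i s) (drop i t).
Proof. by move=> c m mi; rewrite !nth_drop; apply: c; rewrite ltn_add2l. Qed.

Lemma close_diffs V W n l l' : is_subgroup W -> is_subgroup V -> normalizes V W ->
  tuples V n.+1 l -> tuples V n.+1 l' -> close W n.+1 l l' ->
  close W n (diffs l) (diffs l').
Proof.
move=> [W1 WM WV] [V1 VM VV] nW.
case: l l' => [|g l] [|g' l']; [by case | by case | by move=> _ [] |].
elim: l l' g g' n => [|h l IH] [|h' l'] g g' [|n] //;
  try by [move=> [] | move=> _ []].
move=> /tuples_cons[Vg lV] /tuples_cons[Vg' lV'] /close_cons[Wg cl].
rewrite !diffs_cons2; apply/close_cons; split; last exact: IH.
have [Wh _] := (close_cons _ _ _ _ _ _).1 cl.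
have [Vh _] := (tuples_cons _ _ _ _).1 lV.
have -> : ((g^-1 * h)^-1 * (g'^-1 * h') =
   ((g^-1 * h)^-1 * (g^-1 * g')^-1 * (g^-1 * h)) * (h^-1 * h'))%g.
  by group_word.
by apply: WM => //; apply: nW; [apply: VM => //; exact: VV | exact: WV].
Qed.

Lemma close_pprods V W n s t : is_subgroup W -> is_subgroup V -> normalizes V W ->
  tuples V n s -> tuples V n t -> close W n s t -> close W n.+1 (pprods s) (pprods t).
Proof.
move=> [W1 WM WV] [V1 VM VV] nW.
have aux : forall x y, W (x^-1 * y)%g -> tuples V n s -> tuples V n t ->
    close W n s t ->
    close W n (scanl (fun g h => g * h)%g x s) (scanl (fun g h => g * h)%g y t).
  elim: s t n => [|g s IH] [|h t] [|n] x y Wxy //;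
    try by [move=> [] | move=> _ []].
  move=> /tuples_cons[Vg sV] /tuples_cons[Vh tV] /close_cons[Wgh c].
  have Wgh' : W ((x * g)^-1 * (y * h))%g.
    have -> : ((x * g)^-1 * (y * h) = (g^-1 * (x^-1 * y) * g) * (g^-1 * h))%g.
      by group_word.
    by apply: WM => //; exact: nW.
  by apply/close_cons; split=> //; exact: IH.
move=> sV tV c; apply/close_cons; split; first by rewrite invg1 mulg1.
by apply: aux => //; rewrite invg1 mulg1.
Qed.

(** By compactness finitely many of the local choices of [W] suffice, and their
    intersection is still open. *)
Lemma compact_small_subgroup V (P : set G -> G -> Prop) : compact V ->
  (forall W W' v, W' `<=` W -> P W v -> P W' v) ->
  (forall v, V v -> exists2 W, open_subgroup W &
     forall v', V v' -> W (v^-1 * v')%g -> P W v') ->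
  exists2 W, open_subgroup W & forall v, V v -> P W v.
Proof.
move=> cV Pmono Ploc.
pose F : set_system (set G) := fun S => exists2 W, open_subgroup W &
  forall W', open_subgroup W' -> W' `<=` W -> S W'.
have FF : Filter F.
  split.
  - exists setT; last by [].
    by split; [split|exact: openT].
  - move=> S S' [W oW SW] [W' oW' SW'].
    exists (W `&` W'); first exact: open_subgroupI.
    move=> W'' oW'' sub; split; first by apply: SW => // w /sub[].
    by apply: SW' => // w /sub[].
  - by move=> S S' SS' [W oW SW]; exists W => // W' oW' /SW - /(_ oW')/SS'.
have := (iffLR (compact_near_coveringP V) cV) _ F (fun W v => V v -> P W v) FF.
case.
  move=> v Vv; have [W oW PW] := Ploc v Vv.
  exists ([set v' | W (v^-1 * v')%g], [set W' | W' `<=` W]) => /=.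
    split; first exact/lcoset_nbhs/open_subgroup_nbhs.
    by exists W.
  by move=> [v' W'] /= [Wv W'W] Vv'; apply: Pmono W'W _; exact: PW.
move=> W oW /(_ W oW (fun x => id)) PW; exists W => // v Vv; exact: PW.
Qed.

(** By induction on the length: for a fixed first entry the other ones are
    uniformly controlled, and the first entry ranges over a compact set. *)
Lemma compact_small_tuples V n (P : set G -> seq G -> Prop) : compact V ->
  (forall W W' s, W' `<=` W -> P W s -> P W' s) ->
  (forall s, tuples V n s -> exists2 W, open_subgroup W &
     forall t, tuples V n t -> close W n s t -> P W t) ->
  exists2 W, open_subgroup W & forall s, tuples V n s -> P W s.
Proof.
move=> cV; elim: n P => [|n IH] P Pmono Ploc.
  have [|W oW PW] := Ploc [::]; first exact/tuples0.
  by exists W => // t tV; apply: PW.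
pose Q W v := forall s, tuples V n s -> P W (v :: s).
have [||W oW QW] := @compact_small_subgroup V Q cV.
- by move=> W W' v WW QW s sV; apply: Pmono WW _; exact: QW.
- move=> v Vv.
  pose R W s := forall v', V v' -> W (v^-1 * v')%g -> P W (v' :: s).
  have [||W oW RW] := IH R.
  - by move=> W W' s WW RW v' Vv' /WW Wv; apply: Pmono WW _; exact: RW.
  - move=> s sV; have [|W oW PW] := Ploc (v :: s); first exact/tuples_cons.
    exists W => // t tV c v' Vv' Wv; apply: PW; first exact/tuples_cons.
    exact/close_cons.
  by exists W => // v' Vv' Wv s sV; apply: RW.
exists W => // -[|v s]; first by case.
by move=> /tuples_cons[Vv sV]; exact: QW.
Qed.

End TopologicalGroup.

Section OpenCompactSubgroup.
Variables (G : topGroupType) (U : ocSubgroup G).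

Lemma ocs_subgroup : is_subgroup U. Proof. by have [] := ocs_prop U. Qed.
Lemma ocs_open : open U. Proof. by have [] := ocs_prop U. Qed.
Lemma ocs_compact : compact U. Proof. by have [] := ocs_prop U. Qed.
Lemma ocs1 : ocs_set U 1%g. Proof. by have [] := ocs_subgroup. Qed.
Lemma ocsM g h : ocs_set U g -> ocs_set U h -> ocs_set U (g * h)%g.
Proof. by have [_ + _] := ocs_subgroup; apply. Qed.
Lemma ocsV g : ocs_set U g -> ocs_set U g^-1%g.
Proof. by have [_ _ +] := ocs_subgroup; apply. Qed.

End OpenCompactSubgroup.

Section SmallSubgroups.
Variable G : locProfiniteGroupType.
Implicit Types (A U V W : set G) (g h : G) (l s t : seq G).

Lemma open_compact_open_subgroup V : open_compact_subgroup V -> open_subgroup V.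
Proof. by case. Qed.

Lemma small_subgroup A : nbhs (1%g : G) A -> exists2 W, open_subgroup W & W `<=` A.
Proof.
move=> /locally_profinite_basis[W oW WA]; exists W => //.
exact: open_compact_open_subgroup.
Qed.

(** The intersection of the conjugates of a small [W0] under the compact group
    [U] is still open: near a given element of [U] the conjugates do not change. *)
Lemma small_normal_subgroup U A : open_compact_subgroup U -> nbhs (1%g : G) A ->
  exists W, [/\ open_subgroup W, normalizes U W, W `<=` A & W `<=` U].
Proof.
move=> ocU nA; have [sU oU cU] := ocU; have [U1 UM UV] := sU.
have [|W0 oW0 W0A] := @small_subgroup (A `&` U).
  by apply: filterI => //; exact: open_nbhs_nbhs.
have [W0sub _] := oW0.
have [||W1 oW1 PW1] := @compact_small_subgroup _ U
  (fun W v => forall w, W w -> W0 (v * w * v^-1)%g) cU.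
- by move=> W W' v WW PW w /WW/PW.
- move=> v Uv; exists (W0 `&` conj_set v^-1%g W0).
    by apply: open_subgroupI => //; exact: conj_open_subgroup.
  have [_ WM WV] := W0sub.
  move=> v' Uv' [W0v Wv] w [W0w Ww].
  have -> : (v' * w * v'^-1 =
    v * ((v^-1 * v') * w * (v^-1 * v')^-1) * v^-1)%g by group_word.
  have conjV x : (conj_set v^-1%g W0) x -> W0 (v * x * v^-1)%g.
    by rewrite /conj_set /= invgK.
  have [c1 cM cV] := conj_subgroup v^-1%g W0sub.
  by apply: conjV; apply: (cM); [apply: (cM)|apply: cV].
pose W := [set w | forall v, U v -> W0 (v * w * v^-1)%g].
have sW : is_subgroup W.
  have [W01 WM WV] := W0sub.
  split=> [v Uv|g h Wg Wh v Uv|g Wg v Uv]; first by rewrite mulg1 mulgV.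
    have -> : (v * (g * h) * v^-1 = (v * g * v^-1) * (v * h * v^-1))%g by group_word.
    by apply: WM; [exact: Wg | exact: Wh].
  by have := WV _ (Wg v Uv); rewrite /= !invgM invgK mulgA.
have WW0 : W `<=` W0 by move=> w /(_ 1%g U1); rewrite invg1 mul1g mulg1.
exists W; split.
- split=> //; apply: (subgroup_open (W' := W1)) => //; first exact: open_subgroup_nbhs.
  by move=> w W1w v Uv; exact: PW1.
- move=> v w Uv Ww v' Uv'.
  have -> : (v' * (v^-1 * w * v) * v'^-1 = (v' * v^-1) * w * (v' * v^-1)^-1)%g.
    by group_word.
  by apply: Ww; apply: UM => //; exact: UV.
- by move=> w /WW0/W0A[].
- by move=> w /WW0/W0A[].
Qed.

Lemma small_normal_open_subgroup U W : open_compact_subgroup U -> open_subgroup W ->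
  exists W', [/\ open_subgroup W', normalizes U W', W' `<=` W & W' `<=` U].
Proof.
by move=> ocU oW; apply: small_normal_subgroup => //; exact: open_subgroup_nbhs.
Qed.

End SmallSubgroups.

Section UniformContinuity.
Variables (G : locProfiniteGroupType) (k : comPzRingType) (U : set G).
Hypothesis ocU : open_compact_subgroup U.
Implicit Types (V W : set G) (l s t : seq G).

(** Uniform continuity on [V ^ n], with a modulus that is normalized by [U]:
    congruence modulo such a [W] survives products and conjugation in [U]. *)
Definition unif_continuous V (A : Type) n (C : seq G -> A) :=
  exists W, [/\ open_subgroup W, normalizes U W, W `<=` U &
    forall s t, tuples V n s -> tuples V n t -> close W n s t -> C s = C t].

Lemma unif_continuous_comp V (A B : Type) n (f : A -> B) (C : seq G -> A) :
  unif_continuous V n C -> unif_continuous V n (fun s => f (C s)).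
Proof. by move=> [W [oW nW WU WC]]; exists W; split=> // s t sV tV /WC -> . Qed.

Lemma unif_continuous2 V (A B D : Type) n (f : A -> B -> D)
    (C : seq G -> A) (C' : seq G -> B) :
  unif_continuous V n C -> unif_continuous V n C' ->
  unif_continuous V n (fun s => f (C s) (C' s)).
Proof.
move=> [W [oW nW WU WC]] [W' [oW' nW' _ WC']].
exists (W `&` W'); split.
- exact: open_subgroupI.
- by move=> v w Uv [Ww W'w]; split; [exact: nW|exact: nW'].
- by move=> w [/WU].
move=> s t sV tV c; rewrite (WC s t) ?(WC' s t) //; apply: close_sub c => w [] //.
Qed.

Lemma unif_continuous_cst V (A : Type) n (a : A) : unif_continuous V n (fun=> a).
Proof.
have [sU oU _] := ocU; exists U; split=> // v w Uv Uw.
by have [_ UM UV] := sU; apply: (UM) => //; apply: (UM) => //; exact: UV.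
Qed.

Lemma unif_continuous_sum V (A : zmodType) n (J : eqType) (r : seq J)
    (F : J -> seq G -> A) :
  (forall m, m \in r -> unif_continuous V n (F m)) ->
  unif_continuous V n (fun s => \sum_(m <- r) F m s).
Proof.
elim: r => [|m r IH] Fr.
  have -> : (fun s => \sum_(m <- [::]) F m s) = fun=> 0.
    by apply/funext => s; rewrite big_nil.
  exact: unif_continuous_cst.
have -> : (fun s => \sum_(m <- m :: r) F m s) = fun s => F m s + \sum_(m <- r) F m s.
  by apply/funext => s; rewrite big_cons.
apply: (@unif_continuous2 _ _ _ _ _ +%R); first by apply: Fr; rewrite inE eqxx.
by apply: IH => m' m'r; apply: Fr; rewrite inE m'r orbT.
Qed.

Lemma unif_continuous_cochain V (A : Type) n (C : seq G -> A) :
  unif_continuous V n C -> continuous_cochain V n C.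
Proof.
move=> [W [oW _ _ WC]] s sV; exists W; first exact: open_subgroup_nbhs.
by move=> t tV c; rewrite (WC s t).
Qed.

(** The values of a continuous cochain on a compact subgroup are finite in
    number, so a small subgroup fixes all of them. *)
Lemma continuous_cochain_unif V (M : smoothRep G k) n (c : seq G -> M) :
  compact V -> continuous_cochain V n c ->
  exists W, [/\ open_subgroup W, normalizes U W, W `<=` U,
    forall s t, tuples V n s -> tuples V n t -> close W n s t -> c s = c t &
    forall s w, tuples V n s -> W w -> rep_act w (c s) = c s].
Proof.
move=> cV cc.
pose P (W : set G) s : Prop :=
  (forall t, tuples V n t -> close W n s t -> c s = c t)
  /\ (forall w, W w -> rep_act w (c s) = c s).
have [||W oW PW] := @compact_small_tuples _ V n P cV.
- by move=> W W' s WW [h1 h2]; split=> [t tV /(close_sub WW)/h1|w /WW/h2]; [apply|].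
- move=> s sV; have [A nA cA] := cc s sV.
  have [|W oW WA] := @small_subgroup G (A `&` [set w | rep_act w (c s) = c s]).
    apply: filterI => //; apply: open_nbhs_nbhs; split; first exact: rep_smooth.
    exact: rep_act1.
  exists W => // t tV st; have cst : c t = c s.
    by apply: cA => // m mn; case: (WA _ (st m mn)).
  have [[_ WM _] _] := oW.
  split=> [t' tV' tt'|w /WA[_]]; last by rewrite /= cst.
  rewrite cst; apply/esym/cA => // m mn.
  suff /WA[] : W ((nth 1 s m)^-1 * nth 1 t' m)%g by [].
  rewrite -[nth 1%g t' m](mulVKg (nth 1%g t m)) mulgA.
  by apply: WM; [exact: st|exact: tt'].
have [W' [oW' nW' WW' WU']] := small_normal_open_subgroup ocU oW.
exists W'; split=> // [s t sV tV st|s w sV /WW' Ww]; last by have [_] := PW s sV; apply.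
by have [+ _] := PW s sV; apply=> //; exact: close_sub st.
Qed.

Lemma unif_continuous_homog V (M : smoothRep G k) n (c : seq G -> M) :
  is_subgroup V -> V `<=` U -> compact V -> continuous_cochain V n c ->
  unif_continuous V n.+1 (homog c).
Proof.
move=> sV VU cV /(continuous_cochain_unif cV)[W [oW nW WU Wc Wfix]].
exists W; split=> // l l' lV l'V cl; have [sW _] := oW.
have dV := tuples_diffs sV lV; have dV' := tuples_diffs sV l'V.
have nVW : normalizes V W by move=> v w /VU; exact: nW.
have := close_diffs sW sV nVW lV l'V cl.
rewrite /homog => /(Wc _ _ dV dV') <-.
case: l l' lV l'V cl dV {dV'} => [|g l] [|g' l']; try by [case|move=> _ []].
move=> lV _ /close_cons[Wg _] dV; rewrite -[head 1%g (g' :: l')](mulVKg g) rep_actM.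
by rewrite (Wfix _ _ dV Wg).
Qed.

Lemma unif_continuous_hdiff V (A : zmodType) n (C : seq G -> A) :
  unif_continuous V n C -> unif_continuous V n.+1 (hdiff C).
Proof.
move=> [W [oW nW WU WC]]; exists W; split=> //.
elim: n C WC => [|n IH] C WC [|g l] [|g' l']; try by [move=> []|move=> _ []].
  by move=> /tuples_cons[_ /tuples0->] /tuples_cons[_ /tuples0->].
move=> /tuples_cons[Vg lV] /tuples_cons[Vg' lV'] /close_cons[Wg cl] /=.
rewrite (WC l l') //; congr (_ - _).
have [sW _] := oW; have [W1 _ _] := sW.
rewrite (IH (fun r => C (g :: r)) _ l l') //; last first.
  move=> r r' rV r'V c; apply: WC; try exact/tuples_cons.
  by apply/close_cons; rewrite mulVg.
apply: (eq_hdiff (P := V) (n := n)); try by case: lV'.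
move=> r sr rV; apply: WC; try exact/tuples_cons.
by apply/close_cons; split=> // m _; rewrite mulVg.
Qed.

Lemma continuous_inhomog V (A : smoothRep G k) n (C : seq G -> A) :
  is_subgroup V -> V `<=` U -> unif_continuous V n.+1 C ->
  continuous_cochain V n (inhomog C).
Proof.
move=> sV VU [W [oW nW WU WC]]; apply: unif_continuous_cochain.
exists W; split=> // s t sV' tV st; have [sW _] := oW.
apply: WC; try exact: tuples_pprods.
by apply: (close_pprods (V := V)) => // v w /VU; exact: nW.
Qed.

Lemma continuous_cobd V (M : smoothRep G k) n (c : seq G -> M) :
  is_subgroup V -> V `<=` U -> compact V -> continuous_cochain V n c ->
  continuous_cochain V n.+1 (cobd n c).
Proof.
move=> sV VU cV cc; have := unif_continuous_hdiff (unif_continuous_homog sV VU cV cc).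
move=> /(continuous_inhomog (A := M) sV VU) ccd s sn.
have [W nW WC] := ccd s sn; exists W => // t tn /(WC t tn).
by rewrite !cobdE //; [case: sn|case: tn].
Qed.

End UniformContinuity.

(** * Injective representations are acyclic *)

Section Cosets.
Variables (G : topGroupType) (V : set G).
Hypothesis sV : is_subgroup V.
Implicit Types (g h t : G).

Lemma rcoset_reprP g : V (rcoset_repr V g * g^-1)%g.
Proof.
have [V1 _ _] := sV.
rewrite /rcoset_repr; case: xgetP => [h -> //|/(_ g)].
by rewrite /= mulgV.
Qed.

Lemma rcoset_repr_eq g h : V (h * g^-1)%g -> rcoset_repr V h = rcoset_repr V g.
Proof.
have [V1 VM VV] := sV; move=> Vhg; congr (xget _ _); apply/seteqP; split=> x /= Vx.
  have -> : (x * g^-1 = (x * h^-1) * (h * g^-1))%g by group_word.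
  exact: VM.
have -> : (x * h^-1 = (x * g^-1) * (h * g^-1)^-1)%g by group_word.
by apply: VM => //; exact: VV.
Qed.

(** Left cosets are represented by the inverses of the representatives of right
    cosets in [cores], so that the two choices match. *)
Definition lrepr g : G := ((rcoset_repr V g^-1)^-1)%g.

Lemma lreprP g : V (g^-1 * lrepr g)%g.
Proof.
have [_ _ VV] := sV.
by have := VV _ (rcoset_reprP g^-1%g); rewrite /lrepr /= invgM !invgK.
Qed.

Lemma lreprP' g : V ((lrepr g)^-1 * g)%g.
Proof.
have [_ _ VV] := sV.
have -> : ((lrepr g)^-1 * g = (g^-1 * lrepr g)^-1)%g by rewrite invgM [g^-1^-1%g]invgK.
exact: VV (lreprP g).
Qed.

Lemma lrepr_eq g h : V (g^-1 * h)%g -> lrepr g = lrepr h.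
Proof. by move=> Vgh; rewrite /lrepr (rcoset_repr_eq (g := h^-1%g)) // invgK. Qed.

Lemma lrepr_mulr g v : V v -> lrepr (g * v)%g = lrepr g.
Proof. by move=> Vv; apply/esym/lrepr_eq; rewrite mulKg. Qed.

Lemma lrepr_id g : lrepr (lrepr g) = lrepr g.
Proof. exact/esym/lrepr_eq/lreprP. Qed.

Lemma rcoset_repr_id g : rcoset_repr V (rcoset_repr V g) = rcoset_repr V g.
Proof. exact/rcoset_repr_eq/rcoset_reprP. Qed.

End Cosets.

Section Coinduction.
Variables (G : locProfiniteGroupType) (k : comPzRingType) (J : smoothRep G k).

Definition coind_pred : {pred G -> J} := fun f =>
  `[< exists2 W, open_subgroup W & forall t w, W w -> f (t * w)%g = f t >].

Fact coind_submod_closed : submod_closed coind_pred.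
Proof.
split=> [|a f f' /asboolP[W oW fW] /asboolP[W' oW' fW']]; apply/asboolP.
  exists setT => //; split; last exact: openT.
  by split.
exists (W `&` W'); first exact: open_subgroupI.
by move=> t w [Ww W'w]; rewrite !fctE fW // fW'.
Qed.

HB.instance Definition _ :=
  GRing.isSubmodClosed.Build k (G -> J) coind_pred coind_submod_closed.

(** The uniformly locally constant functions on [G] with right translations: a
    smooth representation that contains [J] and is acyclic for every compact
    open subgroup. *)
Record coind_sort := Coind { coind_fun :> G -> J; _ : coind_fun \in coind_pred }.

HB.instance Definition _ := [isSub for coind_fun].
HB.instance Definition _ := [Choice of coind_sort by <:].
HB.instance Definition _ := [SubChoice_isSubLmodule of coind_sort by <:].

Fact coind_act_subproof g (f : coind_sort) :
  (fun t => f (t * g)%g) \in coind_pred.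
Proof.
have /asboolP[W oW fW] := valP f; apply/asboolP.
exists (conj_set g W); first exact: conj_open_subgroup.
move=> t w Ww; rewrite /= -[RHS](fW _ _ Ww).
by congr (coind_fun f _); group_word.
Qed.

Definition coind_act g f : coind_sort := Coind (coind_act_subproof g f).

Fact coind_act_linear g : linear (coind_act g).
Proof. by move=> a f f'; apply: val_inj; apply/funext => t. Qed.

Fact coind_act1 f : coind_act 1%g f = f.
Proof. by apply: val_inj; apply/funext => t; rewrite /= mulg1. Qed.

Fact coind_actM g h f : coind_act (g * h)%g f = coind_act g (coind_act h f).
Proof. by apply: val_inj; apply/funext => t; rewrite /= mulgA. Qed.

Fact coind_smooth f : open [set g | coind_act g f = f].
Proof.
have /asboolP[W oW fW] := valP f.
apply: (subgroup_open (W' := W)); last 2 first.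
- exact: open_subgroup_nbhs.
- by move=> w Ww; apply: val_inj; apply/funext => t; exact: fW.
split=> [|g h /= gf hf|g /= gf]; first exact: coind_act1.
  by rewrite coind_actM hf gf.
by rewrite -[in LHS]gf -coind_actM mulVg coind_act1.
Qed.

Definition coind : smoothRep G k :=
  SmoothRep coind_act_linear coind_act1 coind_actM coind_smooth.

Fact orbit_map_subproof (v : J) : (fun t => rep_act t v) \in coind_pred.
Proof.
apply/asboolP.
have [|W oW Wv] := @small_subgroup G [set w | rep_act w v = v].
  by apply: open_nbhs_nbhs; split; [exact: rep_smooth | exact: rep_act1].
by exists W => // t w /Wv e; rewrite rep_actM e.
Qed.

Definition orbit_map (v : J) : coind := Coind (orbit_map_subproof v).

Lemma orbit_map_hom : is_repHom orbit_map.
Proof.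
split=> [a v w|g v]; apply: val_inj; apply/funext => t /=.
  by rewrite rep_actD rep_actZ.
by rewrite rep_actM.
Qed.

Lemma orbit_map_inj : injective orbit_map.
Proof.
move=> v w /(congr1 (fun f : coind_sort => f 1%g)) /=.
by rewrite !rep_act1.
Qed.

End Coinduction.

Section Acyclicity.
Variables (G : locProfiniteGroupType) (k : comPzRingType) (U : ocSubgroup G).
Variable J : smoothRep G k.

Let sU := ocs_subgroup U.

Section Contraction.
Variables (n : nat) (c : seq G -> J).
Hypothesis cc : continuous_cochain U n.+1 c.

Let cU := @ocs_compact G U.

Let C : seq G -> J := homog c.

Let W_C : unif_continuous U U n.+2 C.
Proof. exact: (unif_continuous_homog (ocs_prop U) sU (fun x h => h) cU cc). Qed.

(** With [t = r u] for the chosen representative [r] of [t U], the value at [t]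
    is [t C (u ^-1, l)]: prepending a vertex contracts the cochain complex. *)
Let cone_fun l : G -> J := fun t => rep_act t (C ((t^-1 * lrepr U t)%g :: l)).

Definition cone (l : seq G) : coind J := insubd (0 : coind_sort J) (cone_fun l).

Lemma coneE l t : tuples U n.+1 l -> val (cone l) t = cone_fun l t.
Proof.
move=> lU; rewrite insubdK //; apply/asboolP.
have [W [oW nW WU WC]] := W_C; exists W => // t' w Ww.
have Uw := WU _ Ww.
rewrite /cone_fun (lrepr_mulr sU) //; set x := (t'^-1 * lrepr U t')%g.
have -> : ((t' * w)^-1 * lrepr U t' = w^-1 * x)%g by rewrite /x; group_word.
rewrite rep_actM -homog_mull //= mulVKg; congr (rep_act _ _).
have Ux : ocs_set U x by exact: lreprP.
have [U1 UM UV] := sU.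
apply: WC; try apply/tuples_cons; try by split.
  split=> //; apply: tuples_map lU => h Uh; exact: UM.
have [sW _] := oW; have [W1 WM WV] := sW.
case: lU => sl lU; apply/close_cons; split; first by rewrite mulVg.
move=> m mn; rewrite (nth_map 1%g) ?sl //.
have Ul : ocs_set U (nth 1%g l m) by apply: lU; rewrite mem_nth ?sl.
have -> : ((w * nth 1 l m)^-1 * nth 1 l m =
  (nth 1 l m)^-1 * w^-1 * nth 1 l m)%g by group_word.
by apply: nW => //; exact: WV.
Qed.

Lemma cone_equivariant : equivariant U n.+1 cone.
Proof.
move=> g l Ug lU; apply: val_inj; apply/funext => t.
have [U1 UM UV] := sU.
have glU : tuples U n.+1 (map (fun h => g * h)%g l).
  by apply: tuples_map lU => h; exact: UM.
rewrite [RHS]/= !coneE // /cone_fun (lrepr_mulr sU) // rep_actM; congr (rep_act _ _).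
by rewrite -homog_mull //=; congr (C (_ :: _)); group_word.
Qed.

Lemma cone_unif_continuous : unif_continuous U U n.+1 cone.
Proof.
have [W [oW nW WU WC]] := W_C; exists W; split=> // l l' lU l'U ll'.
apply: val_inj; apply/funext => t; rewrite !coneE // /cone_fun; congr (rep_act _ _).
have Ux := lreprP sU t.
apply: WC; try by apply/tuples_cons.
apply/close_cons; split=> //; rewrite mulVg.
by have [[W1 _ _] _] := oW.
Qed.

Lemma hdiff_cone l : tuples U n.+2 l ->
  (forall s, tuples U n.+2 s -> cobd n.+1 c s = 0) ->
  hdiff cone l = orbit_map (C l).
Proof.
move=> lU c0; apply: val_inj; apply/funext => t.
have <- : hdiff (fun r => val (cone r) t) l = val (hdiff cone l) t.
  by rewrite (hdiff_morph (f := fun v : coind J => val v t)).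
have -> : hdiff (fun r => val (cone r) t) l = hdiff (fun r => cone_fun r t) l.
  case: (lU) => sl l'U.
  apply: (@eq_hdiff _ _ (ocs_set U) n.+1) => // r sr rU.
  by rewrite coneE.
rewrite /cone_fun (hdiff_morph (f := @rep_act G k J t)
  (fun r => C ((t^-1 * lrepr U t)%g :: r))); last exact: rep_actB.
rewrite /=; congr (rep_act _ _).
have xlU : tuples U n.+3 ((t^-1 * lrepr U t)%g :: l).
  by apply/tuples_cons; split=> //; exact: lreprP.
have : homog (cobd n.+1 c) ((t^-1 * lrepr U t)%g :: l) = 0.
  rewrite /homog c0 ?rep_act0 //; exact: tuples_diffs.
rewrite homog_cobd; last by case: xlU.
by move=> /= /eqP; rewrite subr_eq0 => /eqP <-.
Qed.

End Contraction.

(** [J] is a direct factor of its coinduced representation, on which a cocycle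
    is the coboundary of its cone. *)
Lemma injective_acyclic n (c : seq G -> J) : injective_rep J ->
  continuous_cochain U n.+1 c -> (forall s, tuples U n.+2 s -> cobd n.+1 c s = 0) ->
  exists2 b : seq G -> J, continuous_cochain U n b &
    forall s, tuples U n.+1 s -> cobd n b s = c s.
Proof.
move=> injJ cc c0.
have idhom : is_repHom (fun v : J => v) by [].
have [rho rhoh rhoK] := injJ _ _ _ _ (@orbit_map_hom G k J) (@orbit_map_inj G k J) idhom.
pose B l := rho (cone c l).
have BU : unif_continuous U U n.+1 B.
  exact: (unif_continuous_comp rho (cone_unif_continuous cc)).
have BE : equivariant U n.+1 B.
  by move=> g l Ug lU; rewrite /B (cone_equivariant cc) // (repHom_act rhoh).
exists (inhomog B); first exact: (continuous_inhomog sU _ BU).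
move=> s sU'; have [ss _] := sU'; rewrite cobdE //.
have [pn pU] := tuples_pprods sU sU'.
have -> : hdiff (homog (inhomog B)) (pprods s) = hdiff B (pprods s).
  apply: (@eq_hdiff _ _ (ocs_set U) n.+1) => // r sr rU.
  exact: (homog_inhomog sU BE).
rewrite /B (hdiff_morph (f := rho)); last exact: (repHomB rhoh).
by rewrite (hdiff_cone cc) // rhoK homog_pprods.
Qed.

End Acyclicity.

(** * The double complex of cochains with values in an injective resolution *)

Section ContinuousCochains.
Variables (G : topGroupType) (V : set G).

Lemma continuous_cochain2 (A B D : Type) n (f : A -> B -> D)
    (c : seq G -> A) (c' : seq G -> B) :
  continuous_cochain V n c -> continuous_cochain V n c' ->
  continuous_cochain V n (fun s => f (c s) (c' s)).
Proof.
move=> cc cc' s sV; have [W nW Wc] := cc s sV; have [W' nW' Wc'] := cc' s sV.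
exists (W `&` W'); first exact: filterI.
by move=> t tV st; rewrite Wc ?Wc' // => m /st[].
Qed.

Lemma continuous_cochain_comp (A B : Type) n (f : A -> B) (c : seq G -> A) :
  continuous_cochain V n c -> continuous_cochain V n (fun s => f (c s)).
Proof. by move=> cc; exact: (continuous_cochain2 (fun a _ => f a) cc cc). Qed.

Lemma continuous_cochain_cst (A : Type) n (a : A) :
  continuous_cochain V n (fun=> a).
Proof. by move=> s _; exists setT => //; exact: filterT. Qed.

Lemma eq_continuous_cochain (A : Type) n (c c' : seq G -> A) :
  (forall s, tuples V n s -> c s = c' s) ->
  continuous_cochain V n c -> continuous_cochain V n c'.
Proof.
move=> cc' cc s sV; have [W nW Wc] := cc s sV; exists W => // t tV st.
by rewrite -!cc' // Wc.
Qed.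

End ContinuousCochains.

(** The terms of the resolution have different types, so a family that is
    concentrated in one degree requires a transport. *)
Lemma family_at (T : nat -> zmodType) n (v : T n) :
  exists2 u : forall q, T q, u n = v & forall q, q != n -> u q = 0.
Proof.
exists (fun q => if @eqP _ n q is ReflectT e then eq_rect n T v q e else 0).
  by case: eqP => // e; rewrite (eq_axiomK e).
by move=> q qn; case: eqP => // e; rewrite e eqxx in qn.
Qed.

Section TotalComplex.
Variables (G : locProfiniteGroupType) (k : comPzRingType) (U : ocSubgroup G).
Variables (M : smoothRep G k) (I : injResolution M).
Implicit Types (A B E Y w : forall p q : nat, seq G -> I q).

Let ocU := ocs_prop U.
Let sU := ocs_subgroup U.
Let cU := @ocs_compact G U.

Lemma res_dd n (v : I n) : res_d (res_d v) = 0.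
Proof. by apply/res_exactS; exists v. Qed.

Definition tot_continuous n A :=
  forall p q, (p + q)%N = n -> continuous_cochain U p (A p q).

Definition tot_eq n A B :=
  forall p q s, (p + q)%N = n -> tuples U p s -> A p q s = B p q s.

(** As in [frobenius], only the entries of total degree [n] matter. *)
Definition tot_cohom n A B := exists w,
  (forall p q, (p + q).+1 = n -> continuous_cochain U p (w p q))
  /\ tot_eq n (fun p q s => A p q s - B p q s) (tot_diff w).

Lemma tot_diffB A B p q s :
  tot_diff (fun p q s => A p q s - B p q s) p q s = tot_diff A p q s - tot_diff B p q s.
Proof.
rewrite /tot_diff.
have -> : match p return I q with
    | 0 => 0 | p'.+1 => cobd p' (fun s => A p' q s - B p' q s) s end
  = match p return I q with 0 => 0 | p'.+1 => cobd p' (A p' q) s end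
    - match p return I q with 0 => 0 | p'.+1 => cobd p' (B p' q) s end.
  by case: p => [|p]; rewrite ?subrr ?cobdB.
have -> : match q return I q with
    | 0 => 0 | q'.+1 => res_d (A p q' s - B p q' s) end
  = match q return I q with 0 => 0 | q'.+1 => res_d (A p q' s) end
    - match q return I q with 0 => 0 | q'.+1 => res_d (B p q' s) end.
  by case: q => [|q]; rewrite ?subrr ?(repHomB (res_d_hom _ _)).
by rewrite scalerBr opprD addrACA.
Qed.

Lemma tot_diffZ a A p q s :
  tot_diff (fun p q s => a *: A p q s) p q s = a *: tot_diff A p q s.
Proof.
rewrite /tot_diff scalerDr !scalerA mulrC -scalerA.
case: p q => [|p] [|q]; rewrite ?cobdZ ?(repHomZ (res_d_hom _ _)) ?scaler0 //.
Qed.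

Lemma tot_diff_diff A p q s : tuples U p s -> tot_diff (tot_diff A) p q s = 0.
Proof.
move=> sp; rewrite {1}/tot_diff.
have e1 p' : tuples U p'.+1 s -> cobd p' (tot_diff A p' q) s =
    (-1) ^+ p' *: match q return I q with 0 => 0 | q'.+1 =>
                   res_d (cobd p' (A p' q') s) end.
  move=> sp'; rewrite /tot_diff cobdD cobdZ.
  have -> : cobd p' (fun r => match p' return I q with
      | 0 => 0 | p''.+1 => cobd p'' (A p'' q) r end) s = 0.
    case: p' sp' => [|p'] sp'; last exact: (cobd_cobd _ sU).
    exact: cobd0.
  rewrite add0r; congr (_ *: _); case: (q) => [|q']; first exact: cobd0.
  exact: (cobd_hom _ _ _ (res_d_hom I q')).
have e2 q' : res_d (tot_diff A p q' s) =
    match p return I q'.+1 with 0 => 0 | p'.+1 => res_d (cobd p' (A p' q') s) end.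
  rewrite /tot_diff (repHomD (res_d_hom _ _)) (repHomZ (res_d_hom _ _)).
  have -> : res_d (match q' return I q' with 0 => 0 | q''.+1 => res_d (A p q'' s) end) = 0.
    by case: q' => [|q']; rewrite ?res_dd ?(repHom0 (res_d_hom _ _)).
  by rewrite scaler0 addr0; case: (p) => //; rewrite (repHom0 (res_d_hom _ _)).
case: q e1 => [|q] e1.
  rewrite scaler0 addr0; case: p sp {e2} => // p sp.
  by rewrite e1 // scaler0.
rewrite e2; case: p sp {e2} => [|p] sp; first by rewrite scaler0 addr0.
by rewrite e1 // exprS mulN1r scaleNr subrr.
Qed.

Lemma tot_continuous_diff n A :
  (forall p q, (p + q).+1 = n -> continuous_cochain U p (A p q)) ->
  tot_continuous n (tot_diff A).
Proof.
move=> cA p q pqn; apply: (@continuous_cochain2 _ _ _ _ _ _ (fun a b : I q => a + b)).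
  case: p pqn => [|p] pqn; first exact: continuous_cochain_cst.
  apply: (continuous_cobd ocU sU _ cU) => //; apply: cA.
  by rewrite -pqn.
apply: (continuous_cochain_comp (fun b => (-1) ^+ p *: b)).
case: q pqn => [|q] pqn; first exact: continuous_cochain_cst.
apply: (continuous_cochain_comp (@res_d _ _ _ I q)); apply: cA.
by rewrite -pqn addnS.
Qed.

Lemma tot_eq_cohom n A B : tot_eq n A B -> tot_cohom n A B.
Proof.
move=> AB; exists (fun p q s => 0); split=> [p q _|p q s pqn sp].
  exact: continuous_cochain_cst.
rewrite AB // subrr /tot_diff.
case: p {pqn} sp => [|p] sp; rewrite ?cobd0 // add0r; case: q => [|q];
  by rewrite ?(repHom0 (res_d_hom _ _)) scaler0.
Qed.

Lemma tot_cohom_sym n A B : tot_cohom n A B -> tot_cohom n B A.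
Proof.
move=> [w [cw Dw]]; exists (fun p q s => - 1 *: w p q s); split=> [p q /cw cpq|].
  exact: (continuous_cochain_comp (fun b => -1 *: b)).
by move=> p q s pqn sp; rewrite tot_diffZ -Dw // scaleN1r opprB.
Qed.

Lemma tot_cohom_trans n A B E : tot_cohom n A B -> tot_cohom n B E -> tot_cohom n A E.
Proof.
move=> [w [cw Dw]] /tot_cohom_sym[w' [cw' Dw']].
exists (fun p q s => w p q s - w' p q s); split=> [p q pqn|p q s pqn sp].
  by apply: (continuous_cochain2 (fun a b => a - b)); [apply: cw|apply: cw'].
by rewrite tot_diffB -Dw // -Dw' // opprB addrA subrK.
Qed.

Lemma tot_cohomZ n a A B : tot_cohom n A B ->
  tot_cohom n (fun p q s => a *: A p q s) (fun p q s => a *: B p q s).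
Proof.
move=> [w [cw Dw]]; exists (fun p q s => a *: w p q s); split=> [p q /cw cpq|].
  exact: (continuous_cochain_comp (fun b => a *: b)).
by move=> p q s pqn sp; rewrite tot_diffZ -Dw // scalerBr.
Qed.

(** The edges of the double complex: an element of [I^n] in bidegree [(0, n)]
    and a cochain with values in [M] in bidegree [(n, 0)]. *)
Definition inv_edge n (v : I n) A :=
  (forall s, A 0%N n s = v) /\ (forall p q s, A p.+1 q s = 0).

Definition aug_edge n (c : seq G -> M) A :=
  (forall s, A n 0%N s = res_aug I (c s)) /\ (forall p q s, A p q.+1 s = 0).

(** The correspondence [frobenius] depends on the homomorphism from [XU k U]
    only through the image of [charU]; here it is for that invariant alone, and
    for coefficients in any representation. *)
Definition frobenius_elt n (v : I n) (c : seq G -> M) := exists a e w,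
  [/\ inv_edge v a, aug_edge n c e,
      forall p q, (p + q).+1 = n -> continuous_cochain U p (w p q)
    & forall p q s, (p + q)%N = n -> tuples U p s ->
        a p q s - e p q s = tot_diff w p q s].

Lemma inv_edge_exists n (v : I n) : exists A, inv_edge v A.
Proof.
have [u un _] := family_at (T := fun q => I q) v.
by exists (fun p q _ => if p is 0 then u q else 0).
Qed.

Lemma aug_edge_exists n (c : seq G -> M) : exists A, aug_edge n c A.
Proof.
by exists (fun p q s => match q return I q with 0 => res_aug I (c s) | _ => 0 end).
Qed.

Lemma inv_edge_uniq n (v : I n) A B : inv_edge v A -> inv_edge v B -> tot_eq n A B.
Proof.
move=> [A0 AS] [B0 BS] [|p] q s pqn _; last by rewrite AS BS.
by rewrite add0n in pqn; subst q; rewrite A0 B0.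
Qed.

Lemma aug_edge_uniq n (c c' : seq G -> M) A B :
  (forall s, tuples U n s -> c s = c' s) ->
  aug_edge n c A -> aug_edge n c' B -> tot_eq n A B.
Proof.
move=> cc [A0 AS] [B0 BS] p [|q] s pqn sp; last by rewrite AS BS.
by rewrite addn0 in pqn; subst p; rewrite A0 B0 cc.
Qed.

Lemma frobenius_eltP n (v : I n) c A E : inv_edge v A -> aug_edge n c E ->
  frobenius_elt v c <-> tot_cohom n A E.
Proof.
move=> vA cE; split=> [[a [e [w [va ce cw Dw]]]]|[w [cw Dw]]]; last first.
  by exists A, E, w.
apply: tot_cohom_trans (tot_eq_cohom (inv_edge_uniq vA va)) _.
apply: (tot_cohom_trans (B := e)); first by exists w.
exact/tot_eq_cohom/(aug_edge_uniq _ ce cE).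
Qed.

(** The augmentation of a cobounding cochain cobounds in the total complex,
    because the first row starts with the kernel of the differential of [I]. *)
Lemma tot_cohom_aug n c c' E E' : aug_edge n c E -> aug_edge n c' E' ->
  cohomologous U setT n c c' -> tot_cohom n E E'.
Proof.
case: n => [|n] cE cE' cc; first exact/tot_eq_cohom/(aug_edge_uniq cc cE cE').
case: cc => b [bU _] cb; case: cE => E0 ES; case: cE' => E0' ES'.
exists (fun p q s => match q return I q with 0 => res_aug I (b s) | _ => 0 end).
split=> [p [|q]|p [|q] s] pqn.
- by move: pqn; rewrite addn0 => -[->]; exact: continuous_cochain_comp.
- exact: continuous_cochain_cst.
- rewrite addn0 in pqn; subst p => sp; rewrite E0 E0' /tot_diff scaler0 addr0.
  by rewrite -(repHomB (res_aug_hom I)) cb // -(cobd_hom _ _ _ (res_aug_hom I)).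
- move=> sp; rewrite ES ES' subrr /tot_diff.
  have -> : res_d (match q return I q with 0 => res_aug I (b s) | _ => 0 end) = 0.
    case: (q) => [|q']; last exact: (repHom0 (res_d_hom _ _)).
    by apply/res_exact0; exists (b s).
  by rewrite scaler0 addr0; case: p {pqn sp} => // p; rewrite cobd0.
Qed.

Lemma frobenius_elt_cohom n (v : I n) c c' :
  frobenius_elt v c -> cohomologous U setT n c c' -> frobenius_elt v c'.
Proof.
move=> vc cc'; have [A vA] := inv_edge_exists v.
have [E cE] := aug_edge_exists n c; have [E' cE'] := aug_edge_exists n c'.
apply/(frobenius_eltP vA cE'); apply: tot_cohom_trans (tot_cohom_aug cE cE' cc').
exact/(frobenius_eltP vA cE).
Qed.

(** The rows of the augmented double complex are exact, by sections of sets: a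
    total cobounding cochain of an edge cocycle can be pushed to that edge. *)
Lemma tot_coboundary_aug n c E w : aug_edge n c E ->
  (forall p q, (p + q).+1 = n -> continuous_cochain U p (w p q)) ->
  tot_eq n E (tot_diff w) ->
  match n with
  | 0 => forall s, tuples U 0 s -> c s = 0
  | m.+1 => exists2 b, continuous_cochain U m b &
              forall s, tuples U m.+1 s -> c s = cobd m b s
  end.
Proof.
case: n => [|m] [E0 ES] cw Dw.
  move=> s sp; apply: (@res_aug_inj _ _ _ I); rewrite -E0 Dw //.
  by rewrite /tot_diff scaler0 addr0 (repHom0 (res_aug_hom I)).
(* The columns before [j] can be cleared: the next entry is then a cycle of its
   row, hence the differential of a section [Y], and subtracting the total
   coboundary of [Y] clears it without changing the total coboundary of [w]. *)
have push j : (j <= m)%N -> exists w',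
    [/\ tot_continuous m w', tot_eq m.+1 E (tot_diff w')
      & forall p q s, (p + q)%N = m -> (p < j)%N -> tuples U p s -> w' p q s = 0].
  elim: j => [_|j IH jm].
    by exists w; split=> // p q pqm; apply: cw; rewrite pqm.
  have [w1 [cw1 Dw1 w10]] := IH (ltnW jm).
  pose sec q (v : I q.+1) : I q := xget 0 [set y | res_d y = v].
  pose Y p q s : I q := if p == j then sec q (w1 j q.+1 s) else 0.
  have cY p q : (p + q).+1 = m -> continuous_cochain U p (Y p q).
    move=> pqm; rewrite /Y; case: eqP => [e|_]; last exact: continuous_cochain_cst.
    subst p; apply: (continuous_cochain_comp (@sec q)); apply: cw1.
    by rewrite addnS.
  exists (fun p q s => w1 p q s - (-1) ^+ j *: tot_diff Y p q s); split.
  - move=> p q pqm; apply: (continuous_cochain2 (fun a b => a - b)); first exact: cw1.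
    apply: (continuous_cochain_comp (fun b => (-1) ^+ j *: b)).
    exact: (tot_continuous_diff cY).
  - move=> p q s pqm sp; rewrite Dw1 // tot_diffB (tot_diffZ _ (tot_diff Y)).
    by rewrite tot_diff_diff // scaler0 subr0.
  - move=> p q s pqm; rewrite ltnS leq_eqVlt => /orP[/eqP pj|pj] sp.
      subst p; case: q pqm => [|q] pqm; first by rewrite -pqm addn0 ltnn in jm.
      have w1d : res_d (w1 j q.+1 s) = 0.
        have := Dw1 j q.+2 s; rewrite ES addnS pqm => /(_ erefl sp)/esym.
        rewrite /tot_diff.
        have -> : match j return I q.+2 with 0 => 0
            | p'.+1 => cobd p' (w1 p' q.+2) s end = 0.
          case: (j) w10 sp pqm => // j' w10 sp pqm.
          have z r : tuples U j' r -> w1 j' q.+2 r = 0.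
            by move=> rU; apply: w10 => //; rewrite -pqm addnS addSn.
          by rewrite (eq_cobd sU z) // cobd0.
        rewrite add0r => /(congr1 (fun v => (-1) ^+ j *: v)).
        by rewrite scaler0 scalerA -expr2 sqrr_sign scale1r.
      have [y yw] := (iffLR (res_exactS _) w1d).
      rewrite /tot_diff {2}/Y eqxx.
      have -> : res_d (sec q (w1 j q.+1 s)) = w1 j q.+1 s.
        by rewrite /sec; case: xgetP => [z _ //|/(_ y)]; rewrite /= -yw.
      have -> : match j return I q.+1 with 0 => 0 | p'.+1 => cobd p' (Y p' q.+1) s end = 0.
        case ej: {1}j => [//|j']; rewrite cobd0 // => r.
        by rewrite /Y ej ltn_eqF.
      rewrite add0r scalerA -expr2 sqrr_sign scale1r.
      by rewrite subrr.
    rewrite w10 // sub0r /tot_diff.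
    have Yp p' q' r : (p' < j)%N -> Y p' q' r = 0.
      by move=> p'j; rewrite /Y ltn_eqF.
    have -> : match q return I q with 0 => 0 | q'.+1 => res_d (Y p q' s) end = 0.
      by case: (q) => // q'; rewrite Yp // (repHom0 (res_d_hom _ _)).
    have -> : match p return I q with 0 => 0 | p'.+1 => cobd p' (Y p' q) s end = 0.
      case: (p) pj => // p' pj; rewrite cobd0 // => r; rewrite Yp //.
      exact: ltnW.
    by rewrite scaler0 addr0 scaler0 oppr0.
have [w1 [cw1 Dw1 w10]] := push m (leqnn m).
have dw1 s : tuples U m s -> res_d (w1 m 0%N s) = 0.
  move=> sp; have := Dw1 m 1%N s; rewrite ES addn1 => /(_ erefl sp)/esym.
  rewrite /tot_diff.
  have -> : match m return I 1 with 0 => 0 | p'.+1 => cobd p' (w1 p' 1%N) s end = 0.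
    case: (m) w10 sp => // m' w10 sp.
    have z r : tuples U m' r -> w1 m' 1%N r = 0.
      by move=> rU; apply: w10 => //; rewrite addn1.
    by rewrite (eq_cobd sU z) // cobd0.
  rewrite add0r => /(congr1 (fun v => (-1) ^+ m *: v)).
  by rewrite scaler0 scalerA -expr2 sqrr_sign scale1r.
pose b s : M := xget 0 [set y | res_aug I y = w1 m 0%N s].
have bw s : tuples U m s -> res_aug I (b s) = w1 m 0%N s.
  move=> sp; have [y yw] := iffLR (res_exact0 _) (dw1 s sp).
  by rewrite /b; case: xgetP => [z _ //|/(_ y)]; rewrite /= -yw.
exists b.
  apply: (continuous_cochain_comp (fun v : I 0%N => xget 0 [set y | res_aug I y = v])).
  by apply: cw1; rewrite addn0.
move=> s sp; apply: (@res_aug_inj _ _ _ I).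
rewrite -E0 Dw1 ?addn0 // /tot_diff scaler0 addr0 -(cobd_hom _ _ _ (res_aug_hom I)).
by apply: (eq_cobd sU) sp => r /bw.
Qed.

(** The difference of two cocycles that correspond to the same invariant is an
    edge cocycle that bounds in the total complex. *)
Lemma frobenius_elt_uniq n (v : I n) c c' :
  frobenius_elt v c -> frobenius_elt v c' -> cohomologous U setT n c c'.
Proof.
have [A vA] := inv_edge_exists v.
have [E cE] := aug_edge_exists n c; have [E' cE'] := aug_edge_exists n c'.
move=> /(frobenius_eltP vA cE)/tot_cohom_sym cA.
move=> /(frobenius_eltP vA cE')/(tot_cohom_trans cA)[w [cw Dw]].
have cEE' : aug_edge n (fun s => c s - c' s) (fun p q s => E p q s - E' p q s).
  case: cE cE' => [E0 ES] [E0' ES']; split=> [s|p q s].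
    by rewrite E0 E0' (repHomB (res_aug_hom I)).
  by rewrite ES ES' subrr.
have := tot_coboundary_aug cEE' cw Dw.
case: (n) => [|m] /=; first by move=> cc s /cc/eqP; rewrite subr_eq0 => /eqP.
by move=> [b cb bc]; exists b => //; split.
Qed.

(** The columns are exact because the terms of the resolution are acyclic: every
    cocycle is totally cohomologous to an invariant in the other edge. *)
Lemma frobenius_elt_exists n c : continuous_cochain U n c ->
  (forall s, tuples U n.+1 s -> cobd n c s = 0) ->
  exists v : I n,
    [/\ forall u, ocs_set U u -> rep_act u v = v, res_d v = 0 & frobenius_elt v c].
Proof.
move=> cc c0; have [E cE] := aug_edge_exists n c; have [E0 ES] := cE.
(* The rows before [j] can be cleared: the next entry is then a cocycle of its
   column, and subtracting the total coboundary of [B] moves it one row up. *)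
have push j : (j <= n)%N -> exists A,
    [/\ tot_continuous n A, tot_cohom n A E,
        forall p q s, (p + q)%N = n.+1 -> tuples U p s -> tot_diff A p q s = 0
      & forall p q s, (p + q)%N = n -> (q < j)%N -> tuples U p s -> A p q s = 0].
  elim: j => [_|j IH jn].
    exists E; split=> [p [|q] pqn||p [|q] s|//]; last 2 first.
    - rewrite addn0 => -> sp; rewrite /tot_diff scaler0 addr0.
      rewrite -(repHom0 (res_aug_hom I)) -(c0 s sp) -(cobd_hom _ _ _ (res_aug_hom I)).
      by apply: (eq_cobd sU) sp => r _; rewrite E0.
    - rewrite addnS => -[pqn] sp; rewrite /tot_diff.
      have -> : res_d (E p q s) = 0.
        case: q pqn => [|q] pqn; last by rewrite ES (repHom0 (res_d_hom _ _)).
        rewrite addn0 in pqn; subst p; rewrite E0.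
        by apply/res_exact0; exists (c s).
      rewrite scaler0 addr0; case: p {pqn sp} => // p.
      by rewrite cobd0 // => r; rewrite ES.
    - rewrite addn0 in pqn; subst p.
      apply: (eq_continuous_cochain (c := fun s => res_aug I (c s))) => [s _|].
        by rewrite E0.
      exact: continuous_cochain_comp.
    - apply: (eq_continuous_cochain (c := fun s => 0)) => [s _|].
        by rewrite ES.
      exact: continuous_cochain_cst.
    - exact: tot_eq_cohom.
  have [A [cA AE DA A0]] := IH (ltnW jn).
  pose p0 := (n - j.+1)%N.
  have p0j : (p0.+1 + j)%N = n by rewrite addSnnS subnK.
  have [||b cb bA] :=
      @injective_acyclic G k U (I j) p0 (A p0.+1 j) (@res_injective _ _ _ I j).
  - exact: cA.
  - move=> s sp; have := DA p0.+2 j s; rewrite addSn p0j => /(_ erefl sp) <-.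
    rewrite /tot_diff; set X := (X in _ *: X).
    have -> : X = 0; last by rewrite scaler0 addr0.
    rewrite /X; case: (j) A0 p0j => // j' A0 p0j'.
    rewrite A0 ?(repHom0 (res_d_hom _ _)) //.
    by rewrite -p0j' addnS.
  have [u uj u0] := family_at (T := fun q => (seq G -> I q : zmodType)) b.
  pose B (p q : nat) (s : seq G) : I q := u q s.
  have cB p q : (p + q).+1 = n -> continuous_cochain U p (B p q).
    move=> pqn; rewrite /B; case: (eqVneq q j) => [e|qj].
      subst q; rewrite uj; suff -> : p = p0 by [].
      by apply/eqP; rewrite -(eqn_add2r j) -eqSS pqn -p0j addSn.
    by rewrite u0 //; exact: continuous_cochain_cst.
  exists (fun p q s => A p q s - tot_diff B p q s); split.
  - move=> p q pqn; apply: (continuous_cochain2 (fun a b => a - b)); first exact: cA.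
    exact: (tot_continuous_diff cB).
  - apply: tot_cohom_trans AE; apply: tot_cohom_sym; exists B; split=> // p q s _ _.
    by rewrite opprB addrC subrK.
  - by move=> p q s pqn sp; rewrite tot_diffB DA // tot_diff_diff // subr0.
  move=> p q s pqn; rewrite ltnS leq_eqVlt => /orP[/eqP qj|qj] sp.
    subst q; have pe : p = p0.+1 by apply/eqP; rewrite -(eqn_add2r j) pqn p0j.
    subst p; rewrite /tot_diff {1}/B uj bA //.
    have -> : match j return I j with 0 => 0 | q'.+1 => res_d (B p0.+1 q' s) end = 0.
      have Bj q' r : (q' < j)%N -> B p0.+1 q' r = 0.
        by move=> q'j; rewrite /B u0 // ltn_eqF.
      by case: (j) Bj => // j' Bj; rewrite Bj ?(repHom0 (res_d_hom _ _)).
    by rewrite scaler0 addr0 subrr.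
  have B0 p' q' r : (q' < j)%N -> B p' q' r = 0 by move=> q'j; rewrite /B u0 // ltn_eqF.
  rewrite A0 // /tot_diff.
  have -> : match p return I q with 0 => 0 | p'.+1 => cobd p' (B p' q) s end = 0.
    by case: (p) => // p'; rewrite cobd0 // => r; exact: B0.
  have -> : match q return I q with 0 => 0 | q'.+1 => res_d (B p q' s) end = 0.
    case: (q) qj => // q' q'j; rewrite B0 ?(repHom0 (res_d_hom _ _)) //.
    exact: ltnW.
  by rewrite scaler0 addr0 subr0.
have [A [cA AE DA A0]] := push n (leqnn n).
have [V nV] := inv_edge_exists (A 0%N n [::]).
have nil_U : tuples U 0 [::] by apply/tuples0.
exists (A 0%N n [::]); split.
- move=> u Uu; have uU : tuples U 1 [:: u] by apply/tuples_cons.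
  have := DA 1%N n [:: u]; rewrite add1n => /(_ erefl uU).
  rewrite /tot_diff /cobd /= big_ord0 addr0 expr1 !scaleN1r.
  have -> : match n return I n with 0 => 0 | q'.+1 => res_d (A 1%N q' [:: u]) end = 0.
    case: (n) A0 => // n' A0; rewrite A0 ?(repHom0 (res_d_hom _ _)) //.
  by rewrite oppr0 addr0 => /eqP; rewrite subr_eq0 => /eqP.
- have := DA 0%N n.+1 [::] erefl nil_U; rewrite /tot_diff add0r.
  by rewrite expr0 scale1r.
apply/(frobenius_eltP nV cE); apply: tot_cohom_trans AE; apply: tot_eq_cohom.
case: nV => nV0 nVS [|p] q s pqn sp; last first.
  by rewrite nVS A0 //; rewrite -pqn addSn ltnS leq_addl.
by rewrite add0n in pqn; subst q; rewrite nV0 (iffLR (tuples0 _ _) sp).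
Qed.

End TotalComplex.

(** * Extension of homomorphisms and lifts to the resolution *)

Section ImageSubrepresentation.
Variables (G : topGroupType) (k : comPzRingType) (A B : smoothRep G k).
Variable D : {d : A -> B | is_repHom d}.

Local Notation d := (sval D).
Let dhom : is_repHom d := svalP D.

Definition image_pred : {pred B} := fun v => `[< exists w, v = sval D w >].

Fact image_submod_closed : submod_closed image_pred.
Proof.
split=> [|a _ _ /asboolP[v ->] /asboolP[w ->]]; apply/asboolP.
  by exists 0; rewrite (repHom0 dhom).
by exists (a *: v + w); rewrite (repHomD dhom) (repHomZ dhom).
Qed.

HB.instance Definition _ :=
  GRing.isSubmodClosed.Build k B image_pred image_submod_closed.

Record image_sort := Image { image_val :> B; _ : image_val \in image_pred }.

HB.instance Definition _ := [isSub for image_val].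
HB.instance Definition _ := [Choice of image_sort by <:].
HB.instance Definition _ := [SubChoice_isSubLmodule of image_sort by <:].

Fact image_act_subproof g (v : image_sort) : rep_act g (image_val v) \in image_pred.
Proof.
have /asboolP[w vw] := valP v; apply/asboolP; exists (rep_act g w).
by rewrite (repHom_act dhom) -vw.
Qed.

Definition image_act g v : image_sort := Image (image_act_subproof g v).

Fact image_act_linear g : linear (image_act g).
Proof. by move=> a v w; apply: val_inj; rewrite /= rep_actD rep_actZ. Qed.

Fact image_act1 v : image_act 1%g v = v.
Proof. by apply: val_inj; rewrite /= rep_act1. Qed.

Fact image_actM g h v : image_act (g * h)%g v = image_act g (image_act h v).
Proof. by apply: val_inj; rewrite /= rep_actM. Qed.

Fact image_smooth v : open [set g | image_act g v = v].
Proof.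
rewrite (_ : [set g | _] = [set g | rep_act g (val v) = val v]).
  exact: rep_smooth.
by apply/seteqP; split=> g /= => [/(congr1 val)|e] //; apply: val_inj.
Qed.

Definition image_rep : smoothRep G k :=
  SmoothRep image_act_linear image_act1 image_actM image_smooth.

Lemma image_val_hom : is_repHom (image_val : image_rep -> B).
Proof. by split. Qed.

Lemma image_val_inj : injective (image_val : image_rep -> B).
Proof. by move=> v w; exact: val_inj. Qed.

(** [f] factors through the image of [d], a subrepresentation of [B], from which
    injectivity extends it. *)
Lemma extend_from_image (J : smoothRep G k) (f : A -> J) : injective_rep J ->
  is_repHom f -> (forall v, d v = 0 -> f v = 0) ->
  exists2 h : B -> J, is_repHom h & forall v, h (d v) = f v.
Proof.
move=> injJ fh f0.
have fd v w : d v = d w -> f v = f w.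
  move=> /eqP; rewrite -subr_eq0 -(repHomB dhom) => /eqP/f0/eqP.
  by rewrite (repHomB fh) subr_eq0 => /eqP.
pose pre (v : image_rep) : A := xget 0 [set w | image_val v = d w].
have preK v : d (pre v) = image_val v.
  rewrite /pre; case: xgetP => [w _ -> //|no].
  by have /asboolP[w /no] := valP v.
have fpreh : is_repHom (fun v : image_rep => f (pre v)).
  split=> [a v w|g v].
    rewrite -(repHomZ fh) -(repHomD fh); apply: fd.
    by rewrite (repHomD dhom) (repHomZ dhom) !preK.
  by rewrite -(repHom_act fh); apply: fd; rewrite (repHom_act dhom) !preK.
have [h hh hK] := injJ _ _ _ _ image_val_hom image_val_inj fpreh.
exists h => // v.
have dv : d v \in image_pred by apply/asboolP; exists v.
have := hK (Image dv); rewrite /= => ->.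
by apply: fd; rewrite preK.
Qed.

End ImageSubrepresentation.

Section Lift.
Variables (G : topGroupType) (k : comPzRingType) (M : smoothRep G k).
Variable I : injResolution M.

Lemma scale_repHom (A B : smoothRep G k) a (f : A -> B) :
  is_repHom f -> is_repHom (fun v => a *: f v).
Proof.
move=> fh; split=> [b v w|g v].
  by rewrite (repHomD fh) (repHomZ fh) scalerDr !scalerA mulrC.
by rewrite (repHom_act fh) rep_actZ.
Qed.

Lemma comp_repHom (A B D : smoothRep G k) (f : A -> B) (h : B -> D) :
  is_repHom f -> is_repHom h -> is_repHom (fun v => h (f v)).
Proof.
move=> fh hh; split=> [b v w|g v].
  by rewrite (repHomD fh) (repHomZ fh) (repHomD hh) (repHomZ hh).
by rewrite (repHom_act fh) (repHom_act hh).
Qed.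

(** The lift is built degree by degree: [F n] followed by the differential kills
    the kernel of the differential of [I n], so it factors through the image. *)
Lemma yoneda_lift_exists j (f : M -> I j) : is_repHom f ->
  (forall v, res_d (f v) = 0) -> exists F, yoneda_lift f F.
Proof.
move=> fh f0.
pose state n (F : I n -> I (n + j)%N) :=
  is_repHom F /\ forall v, res_d v = 0 -> res_d (F v) = 0.
have [F0 F0h F0f] : exists2 F0 : I 0%N -> I j, is_repHom F0 &
    forall v, F0 (res_aug I v) = f v.
  exact: (@res_injective _ _ _ I j _ _ _ _ (res_aug_hom I) (@res_aug_inj _ _ _ I) fh).
have s0 : state 0%N F0.
  by split=> // v /res_exact0[w ->]; rewrite F0f.
have step n (S : {F | state n F}) : {S' : {F | state n.+1 F} |
    forall v, sval S' (res_d v) = (-1) ^+ j *: (res_d (sval S v) : I (n.+1 + j)%N)}.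
  case: S => F [Fh F0'] /=; apply: cid.
  pose dF v : I (n.+1 + j)%N := (-1) ^+ j *: res_d (F v).
  have dFh : is_repHom dF.
    by apply: scale_repHom; apply: comp_repHom Fh _; exact: res_d_hom.
  have dF0 v : res_d v = 0 -> dF v = 0.
    by move=> /F0'; rewrite /dF => ->; rewrite scaler0.
  have [F' F'h F'd] := @extend_from_image _ _ _ _ (exist _ _ (res_d_hom I n))
    _ dF (@res_injective _ _ _ I _) dFh dF0.
  have s' : state n.+1 F'.
    split=> // v /res_exactS[w ->]; rewrite [F' _]F'd /dF.
    rewrite -[LHS]/(@res_d _ _ _ I (n + j).+1 ((-1) ^+ j *: res_d (F w))).
    by rewrite (repHomZ (res_d_hom _ _)) ((iffRL (res_exactS _)) _) ?scaler0 //; exists (F w).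
  by exists (exist _ _ s').
pose fix S n : {F | state n F} :=
  if n is n'.+1 then sval (step n' (S n')) else exist _ _ s0.
exists (fun n => sval (S n)); split=> [n|n v|v].
- by case: (svalP (S n)).
- have /= -> := svalP (step n (S n)) v.
  by rewrite scalerA -expr2 sqrr_sign scale1r.
- exact: F0f.
Qed.

End Lift.

(** * Homomorphisms from the compactly induced representation *)

Section Transversals.
Variables (G : topGroupType) (V : set G).
Hypothesis sV : is_subgroup V.
Implicit Types (g h t : G) (L : seq G).

Lemma lrepr_eqP g h : lrepr V g = lrepr V h <-> V (g^-1 * h)%g.
Proof.
have [V1 VM VV] := sV; split; last exact: lrepr_eq.
move=> e; have -> : (g^-1 * h = (g^-1 * lrepr V g) * (h^-1 * lrepr V h)^-1)%g.
  by rewrite e; group_word.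
by apply: VM; [|apply: VV]; exact: lreprP.
Qed.

Definition transversal L := uniq (map (lrepr V) L).

Definition covers L t := lrepr V t \in map (lrepr V) L.

Lemma coversP L t : reflect (exists2 g, g \in L & V (g^-1 * t)%g) (covers L t).
Proof.
apply: (iffP mapP) => -[g gL]; last by exists g => //; apply/esym/lrepr_eqP.
by move=> /esym/lrepr_eqP; exists g.
Qed.

Lemma transversal_inj L g h : transversal L -> g \in L -> h \in L ->
  V (g^-1 * h)%g -> g = h.
Proof.
move=> + + + /lrepr_eqP; rewrite /transversal; elim: L => //= x L IH /andP[xL uL].
rewrite !inE => /predU1P[->|gL] /predU1P[->|hL] // e; last exact: IH.
  by rewrite e map_f in xL.
by rewrite -e map_f in xL.
Qed.

(** Sums over cosets do not depend on the representatives, nor on cosets where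
    the summand vanishes; this is how such sums are reindexed below. *)
Lemma eq_sum_transversal (A : nmodType) (F : G -> A) L L' :
  (forall g v, V v -> F (g * v)%g = F g) -> transversal L -> transversal L' ->
  (forall t, F t != 0 -> covers L t = covers L' t) ->
  \sum_(g <- L) F g = \sum_(g <- L') F g.
Proof.
move=> FV uL uL' LL'.
have Fl g : F (lrepr V g) = F g.
  by rewrite -[in LHS](mulVKg g (lrepr V g)) FV //; exact: lreprP.
have canon L0 : transversal L0 ->
    \sum_(g <- L0) F g = \sum_(g <- [seq g <- map (lrepr V) L0 | F g != 0]) F g.
  rewrite big_filter big_map [RHS]big_mkcond => _; apply: eq_bigr => g _.
  by rewrite Fl; case: eqP => // ->.
rewrite (canon L) // (canon L') //; apply: perm_big; apply: uniq_perm.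
- exact: filter_uniq.
- exact: filter_uniq.
have mem L0 t : t \in map (lrepr V) L0 -> covers L0 t /\ lrepr V t = t.
  by move=> /mapP[g gL0 ->]; rewrite /covers lrepr_id // map_f.
move=> t; rewrite !mem_filter; have [//|Ft /=] := eqVneq (F t) 0.
by apply/idP/idP => /mem[]; [rewrite LL'|rewrite -LL'] => // + e; rewrite /covers e.
Qed.

Lemma transversal_mull g L : transversal L -> transversal (map (fun h => g * h)%g L).
Proof.
rewrite /transversal -map_comp; elim: L => //= h L IH /andP[hL /IH->]; rewrite andbT.
apply: contra hL => /mapP[t tL /lrepr_eqP e]; apply/mapP; exists t => //.
by apply/lrepr_eqP; move: e; group_word.
Qed.

Lemma covers_mull g L t : covers (map (fun h => g * h)%g L) t = covers L (g^-1 * t)%g.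
Proof.
apply/coversP/coversP => [[_ /mapP[h hL ->]]|[h hL]] Vh.
  by exists h => //; move: Vh; group_word.
by exists (g * h)%g; [exact: map_f | move: Vh; group_word].
Qed.

Lemma finite_lreprs K : open V -> compact K ->
  exists s : seq G, forall t, K t -> lrepr V t \in s.
Proof.
move=> oV cK; have nV : nbhs (1%g : G) V by exact: open_subgroup_nbhs.
pose F : set_system (seq G) := fun S => exists s0 : seq G,
  forall s, {subset s0 <= s} -> S s.
have FF : Filter F.
  split.
  - by exists [::].
  - move=> S S' [s0 h] [s0' h']; exists (s0 ++ s0') => s ss.
    by split; [apply: h|apply: h'] => g gs; apply: ss; rewrite mem_cat gs ?orbT.
  - by move=> S S' SS' [s0 h]; exists s0 => s /h/SS'.
have := (iffLR (compact_near_coveringP K) cK) _ F (fun s t => lrepr V t \in s) FF.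
case=> [t Kt|s0 h]; last by exists s0 => t; exact: h.
exists ([set t' | V (t^-1 * t')%g], [set s | {subset [:: lrepr V t] <= s}]) => /=.
  by split; [exact: lcoset_nbhs | exists [:: lrepr V t]].
move=> [t' s] /= [Vt ss]; apply: ss; rewrite inE; apply/eqP/esym.
exact: lrepr_eq.
Qed.

Lemma transversal_exists K : open V -> compact K ->
  exists2 L, transversal L & forall t, covers L t <-> exists2 t', K t' & V (t'^-1 * t)%g.
Proof.
move=> oV cK; have [s Ks] := finite_lreprs oV cK.
pose L := undup [seq g <- map (lrepr V) s | `[< exists2 t', K t' & lrepr V t' = g >]].
have Lid : map (lrepr V) L = L.
  rewrite -[RHS]map_id; apply/eq_in_map => g; rewrite mem_undup mem_filter.
  by move=> /andP[_ /mapP[h _ ->]]; rewrite lrepr_id.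
exists L; first by rewrite /transversal Lid undup_uniq.
move=> t; rewrite /covers Lid mem_undup mem_filter; split.
  by move=> /andP[/asboolP[t' Kt' /lrepr_eqP]]; exists t'.
move=> [t' Kt' /lrepr_eqP e]; apply/andP; split; first by apply/asboolP; exists t'.
by apply/mapP; exists (lrepr V t'); rewrite ?Ks // lrepr_id.
Qed.

End Transversals.

Section CompactInductionHom.
Variables (G : locProfiniteGroupType) (k : comPzRingType) (U : ocSubgroup G).
Implicit Types (g h t : G) (L : seq G) (phi : XU k U).

Let sU := ocs_subgroup U.
Let oU := @ocs_open G U.

Lemma XU_mulr phi g u : ocs_set U u -> X_fun phi (g * u)%g = X_fun phi g.
Proof. by have [+ _] := X_pred_supp (X_funP phi); apply. Qed.

Lemma XU_eval phi g h : ocs_set U (g^-1 * h)%g -> X_fun phi g = X_fun phi h.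
Proof. by move=> Ugh; rewrite -(XU_mulr phi g Ugh) mulVKg. Qed.

Definition covers_supp L phi := forall t, X_fun phi t != 0 -> covers U L t.

Lemma supp_transversal phi : exists L, transversal U L /\ covers_supp L phi.
Proof.
have [_ [K cK fK]] := X_pred_supp (X_funP phi).
have [L tL LK] := transversal_exists sU oU cK; exists L; split=> // t /fK Kt.
by apply/LK; exists t => //; rewrite mulVg; have [] := sU.
Qed.

Lemma supp_transversal2 phi psi :
  exists L, [/\ transversal U L, covers_supp L phi & covers_supp L psi].
Proof.
have [_ [K cK fK]] := X_pred_supp (X_funP phi).
have [_ [K' cK' fK']] := X_pred_supp (X_funP psi).
have [L tL LK] := transversal_exists sU oU (compactU cK cK').
have U1 : ocs_set U 1%g by have [] := sU.
by exists L; split=> // t; [move=> /fK Kt|move=> /fK' Kt]; apply/LK; exists t;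
  rewrite ?mulVg //; [left|right].
Qed.

(** A function in the compact induction is the sum of its restrictions to left
    cosets, and [charU] translated by [g] is the characteristic function of
    [g U]. *)
Lemma XU_decomposition phi L : transversal U L -> covers_supp L phi ->
  phi = \sum_(g <- L) X_fun phi g *: rep_act g (charU k U).
Proof.
move=> tL Lphi; apply: val_inj; apply/funext => t.
have -> : val (\sum_(g <- L) X_fun phi g *: rep_act g (charU k U)) t =
   \sum_(g <- L) X_fun phi g * (if `[< ocs_set U (g^-1 * t)%g >] then 1 else 0).
  rewrite (raddf_sum (val : XU k U -> G -> k^o)) /=.
  by elim: L {tL Lphi} => [|g L IH]; rewrite ?big_nil // !big_cons fctE IH.
have [phi0|phit] := eqVneq (X_fun phi t) 0.
  rewrite big1 //= => g _; case: asboolP => [Ug|]; rewrite ?mulr0 //.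
  by rewrite (XU_eval phi Ug) phi0 mul0r.
have /coversP - /(_ sU)[g gL Ug] := Lphi t phit.
rewrite (bigD1_seq g) //=; last by apply: map_uniq tL.
rewrite asboolT // mulr1 (XU_eval phi Ug) big_seq_cond big1 ?addr0 // => h.
move=> /andP[hL hg]; case: asboolP => [Uh|]; rewrite ?mulr0 //.
suff e : h = g by rewrite e eqxx in hg.
apply: (transversal_inj sU tL) => //; apply/(lrepr_eqP sU).
by rewrite (lrepr_eq sU Uh) (lrepr_eq sU Ug).
Qed.

Lemma hom_XU (N : smoothRep G k) (f : XU k U -> N) phi L : is_repHom f ->
  transversal U L -> covers_supp L phi ->
  f phi = \sum_(g <- L) X_fun phi g *: rep_act g (f (charU k U)).
Proof.
move=> fh tL Lphi; rewrite {1}(XU_decomposition tL Lphi) (repHom_sum fh).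
by apply: eq_bigr => g _; rewrite (repHomZ fh) (repHom_act fh).
Qed.

Lemma charU_inv u : ocs_set U u -> rep_act u (charU k U) = charU k U.
Proof.
have [U1 UM UV] := sU; move=> Uu; apply: val_inj; apply/funext => t /=.
congr (if _ then _ else _); apply/asbool_equiv_eq; split=> [Ut|Ut].
  by rewrite -[t](mulVKg u); exact: UM.
by apply: UM => //; exact: UV.
Qed.

(** Frobenius reciprocity in degree zero. *)
Lemma hom_XU_exists (N : smoothRep G k) (v : N) :
  (forall u, ocs_set U u -> rep_act u v = v) ->
  exists2 f : XU k U -> N, is_repHom f & f (charU k U) = v.
Proof.
move=> vU; have [U1 UM UV] := sU.
pose S phi : set (seq G) := [set L | transversal U L /\ covers_supp L phi].
pose T phi := xget [::] (S phi).
have TP phi : S phi (T phi).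
  by rewrite /T; case: xgetP => // no; have [L /no] := supp_transversal phi.
pose F phi g := X_fun phi g *: rep_act g v.
have FU phi g u : ocs_set U u -> F phi (g * u)%g = F phi g.
  by move=> Uu; rewrite /F XU_mulr // rep_actM vU.
have sumE phi L : transversal U L -> covers_supp L phi ->
    \sum_(g <- T phi) F phi g = \sum_(g <- L) F phi g.
  move=> tL Lphi; have [tT Tphi] := TP phi.
  apply: (eq_sum_transversal sU (FU phi)) => // t Ft.
  have phit : X_fun phi t != 0.
    by apply: contraNneq Ft => phit; rewrite /F phit scale0r.
  by rewrite Tphi // Lphi.
exists (fun phi => \sum_(g <- T phi) F phi g).
  split=> [a phi psi|g phi].
    have [L [tL Lphi Lpsi]] := supp_transversal2 phi psi.
    rewrite (sumE phi L) // (sumE psi L) // (sumE _ L) //; last first.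
      move=> t; have -> : X_fun (a *: phi + psi) t = a * X_fun phi t + X_fun psi t by [].
      by have [->|/Lphi//] := eqVneq (X_fun phi t) 0; rewrite mulr0 add0r => /Lpsi.
    rewrite scaler_sumr -big_split; apply: eq_bigr => g _.
    by rewrite /F scalerDl scalerA.
  have [tT Tphi] := TP phi.
  rewrite (sumE _ (map (fun h => g * h)%g (T phi))); last 2 first.
  - exact: transversal_mull.
  - by move=> t /= /Tphi; rewrite covers_mull.
  rewrite big_map rep_act_sum; apply: eq_bigr => h _.
  by rewrite /F /= mulKg rep_actZ rep_actM.
rewrite (sumE _ [:: 1%g]) //; last first.
  move=> t /=; case: asboolP => [Ut _|]; last by rewrite eqxx.
  by apply/coversP => //; exists 1%g; rewrite ?inE // invg1 mul1g.
by rewrite big_seq1 /F /= asboolT // scale1r rep_act1.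
Qed.

End CompactInductionHom.

(** * The product of a cocycle of the compact induction with a cochain *)

Lemma dcosetP (G : topGroupType) (A B : set G) g t :
  dcoset A g B t <-> exists a b, [/\ A a, B b & t = (a * g * b)%g].
Proof.
split=> [[_ [a Aa [_ -> <-]] [b Bb <-]]|[a [b [Aa Bb ->]]]]; first by exists a, b.
by exists (a * g)%g; [exists a => //; exists g | exists b].
Qed.

Section DoubleCosetMembership.
Variables (G : topGroupType) (U : ocSubgroup G).
Implicit Types (z u y : G).

Let U1 := ocs1 U.
Let UM g h := @ocsM G U g h.
Let UV g := @ocsV G U g.

Lemma dcosetMl z u y : ocs_set U u -> dcoset U z U (u * y)%g <-> dcoset U z U y.
Proof.
move=> Uu; split=> /dcosetP[a [b [Ua Ub e]]]; apply/dcosetP.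
  exists (u^-1 * a)%g, b; split=> //; first by apply: UM => //; exact: UV.
  by rewrite -[y](mulKg u) e !mulgA.
by exists (u * a)%g, b; split=> //; [exact: UM | rewrite e !mulgA].
Qed.

Lemma dcosetMr z u y : ocs_set U u -> dcoset U z U (y * u)%g <-> dcoset U z U y.
Proof.
move=> Uu; split=> /dcosetP[a [b [Ua Ub e]]]; apply/dcosetP.
  exists a, (b * u^-1)%g; split=> //; first by apply: UM => //; exact: UV.
  by rewrite -[y](mulgK u) e !mulgA.
by exists a, (b * u)%g; split=> //; [exact: UM | rewrite e !mulgA].
Qed.

Lemma dcoset_id z : dcoset U z U z.
Proof. by apply/dcosetP; exists 1%g, 1%g; rewrite mul1g mulg1. Qed.

End DoubleCosetMembership.

Section CosetLift.
Variables (G : topGroupType) (V : set G).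
Implicit Types (g h u : G).

(** Moves the points of [G] into the coset [g V], equivariantly if the coset is
    moved as well: along it a cochain of [V] extends to the [G]-set [G / V]. *)
Definition coset_lift g h : G := (h * lrepr V (h^-1 * g))%g.

Lemma coset_lift_mull u g h :
  coset_lift g (u * h)%g = (u * coset_lift (u^-1 * g) h)%g.
Proof. by rewrite /coset_lift invgM !mulgA. Qed.

Hypothesis sV : is_subgroup V.

Lemma coset_liftP g h : V (g^-1 * coset_lift g h)%g.
Proof. by have := lreprP sV (h^-1 * g)%g; rewrite /coset_lift; group_word. Qed.

Lemma coset_lift_mulr g h u : V u -> coset_lift (g * u)%g h = coset_lift g h.
Proof. by move=> Vu; rewrite /coset_lift mulgA (lrepr_mulr sV). Qed.

End CosetLift.

Section ClosePairs.
Variable G : topGroupType.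
Implicit Types (V W : set G) (l s : seq G).

(** Two congruent tuples become one list, so that their congruence is a property
    of its entries, which is the form that [eq_prism] requires. *)
Lemma close_zip V W n l l' : tuples V n l -> tuples V n l' -> close W n l l' ->
  exists s : seq (G * G), [/\ size s = n, map fst s = l, map snd s = l' &
    {in s, forall p, [/\ V p.1, V p.2 & W (p.1^-1 * p.2)%g]}].
Proof.
elim: n l l' => [|n IH] [|g l] [|g' l']; try by [move=> []|move=> _ []].
  by move=> *; exists [::].
move=> /tuples_cons[Vg lV] /tuples_cons[Vg' lV'] /close_cons[Wg c].
have [s [ss sl sl' sP]] := IH l l' lV lV' c.
exists ((g, g') :: s); rewrite /= ss sl sl'; split=> // p.
by rewrite inE => /predU1P[->//|/sP].
Qed.

Lemma zip_close V W n (s : seq (G * G)) : size s = n ->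
  {in s, forall p, [/\ V p.1, V p.2 & W (p.1^-1 * p.2)%g]} ->
  [/\ tuples V n (map fst s), tuples V n (map snd s)
    & close W n (map fst s) (map snd s)].
Proof.
elim: s n => [|[g g'] s IH] [|n] //= [sn] sP.
have [|lV lV' c] := IH n sn; first by move=> p ps; apply: sP; rewrite inE ps orbT.
have [Vg Vg' Wg] := sP (g, g') (mem_head _ _).
by split; [apply/tuples_cons|apply/tuples_cons|apply/close_cons].
Qed.

End ClosePairs.

(** Continuity of homotopies: the two prisms are the images under the two
    projections of one prism over the list of pairs of corresponding vertices. *)
Lemma eq_prism_close (G : topGroupType) (T : eqType) (A : zmodType) (V W : set G)
    (R : T -> T -> Prop) n (F : G -> T * T) (C : seq T -> A) l l' :
  (forall s : seq (T * T), size s = n.+1 -> {in s, forall p, R p.1 p.2} ->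
     C (map fst s) = C (map snd s)) ->
  (forall g h, V g -> V h -> W (g^-1 * h)%g ->
     R (F g).1 (F h).1 /\ R (F g).2 (F h).2) ->
  tuples V n l -> tuples V n l' -> close W n l l' ->
  prism C (map F l) = prism C (map F l').
Proof.
move=> CR FR lV l'V /(close_zip lV l'V)[s [sn <- <- sP]].
pose H (p : G * G) := (((F p.1).1, (F p.2).1), ((F p.1).2, (F p.2).2)).
have -> : map F (map fst s) = map (fun p => (p.1.1, p.2.1)) (map H s).
  by rewrite -!map_comp; apply: eq_map => p /=; case: (F p.1).
have -> : map F (map snd s) = map (fun p => (p.1.2, p.2.2)) (map H s).
  by rewrite -!map_comp; apply: eq_map => p /=; case: (F p.2).
rewrite -(prism_map fst) -(prism_map snd).
apply: (@eq_prism _ _ (fun p => R p.1 p.2) n); last 2 first.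
- by rewrite size_map.
- by move=> _ /mapP[p /sP[Vg Vh Wgh] ->] /=; exact: FR.
by move=> r rn rP; exact: CR.
Qed.

Section Transport.
Variables (G : locProfiniteGroupType) (k : comPzRingType) (U : ocSubgroup G).
Variables (N : smoothRep G k).

Let ocU := ocs_prop U.
Let sU := ocs_subgroup U.
Let cU := @ocs_compact G U.

(** Translation by [x ^-1], which does not affect the congruence of entries,
    reduces the claim to lists in [U]. *)
Lemma homog_close n (m : seq G -> N) : continuous_cochain U n m ->
  exists W, [/\ open_subgroup W, normalizes U W, W `<=` U &
    forall x (s : seq (G * G)), size s = n.+1 ->
      {in s, forall p, [/\ ocs_set U (x^-1 * p.1)%g, ocs_set U (x^-1 * p.2)%g
                         & W (p.1^-1 * p.2)%g]} ->
      homog m (map fst s) = homog m (map snd s)].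
Proof.
move=> cm; have [W [oW nW WU WC]] := unif_continuous_homog ocU sU (fun x h => h) cU cm.
exists W; split=> // x s sn sP.
pose s' := map (fun p => (x^-1 * p.1, x^-1 * p.2)%g) s.
have e1 : map fst s = map (fun h => x * h)%g (map fst s').
  by rewrite -!map_comp; apply: eq_map => p /=; rewrite mulVKg.
have e2 : map snd s = map (fun h => x * h)%g (map snd s').
  by rewrite -!map_comp; apply: eq_map => p /=; rewrite mulVKg.
have s0 : s' != [::] by rewrite -size_eq0 size_map sn.
rewrite e1 e2 !homog_mull -?size_eq0 ?size_map ?sn //; congr (rep_act _ _).
have [||lU l'U c] := @zip_close G U W n.+1 s'; first by rewrite size_map.
  move=> _ /mapP[p /sP[U1 U2 W12] ->]; split=> //=.
  by move: W12; group_word.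
exact: WC.
Qed.

Lemma homog_eq_coset n (m m' : seq G -> N) x l :
  (forall s, tuples U n s -> m s = m' s) -> size l = n.+1 ->
  {in l, forall h, ocs_set U (x^-1 * h)%g} -> homog m l = homog m' l.
Proof.
move=> mm' sl lU; rewrite /homog mm' // -(diffs_mull x^-1%g).
apply: tuples_diffs => //; split; first by rewrite size_map.
by move=> _ /mapP[h /lU Uh ->].
Qed.

End Transport.

Section Star.
Variables (G : locProfiniteGroupType) (k : comPzRingType) (U : ocSubgroup G).
Implicit Types (g h t : G) (l s : seq G).

Let ocU := ocs_prop U.
Let sU := ocs_subgroup U.
Let UM g h := @ocsM G U g h.
Let UV g := @ocsV G U g.

Local Notation kappa := (coset_lift U).

(** Conjugating [W] by [x] makes the modulus independent of the coset [g U] in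
    [U x U]: [W] is normalized by [U] on both sides of [x]. *)
Lemma coset_lift_close W x : open_subgroup W -> normalizes U W -> W `<=` U ->
  exists W', [/\ open_subgroup W', normalizes U W', W' `<=` W & forall g h h',
    dcoset U x U g -> ocs_set U h -> ocs_set U h' -> W' (h^-1 * h')%g ->
    W ((kappa g h)^-1 * kappa g h')%g].
Proof.
move=> oW nW WU.
have [W' [oW' nW' W'W _]] := small_normal_open_subgroup ocU
  (open_subgroupI oW (conj_open_subgroup x oW)).
exists W'; split=> // [w /W'W[]//|].
move=> g h h' /dcosetP[a [b [Ua Ub ->]]] Uh Uh' Wh.
set w := (h^-1 * h')%g in Wh; have -> : h' = (h * w)%g by rewrite /w mulVKg.
have Wx : W (x^-1 * (a^-1 * h * w * (a^-1 * h)^-1) * x)%g.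
  have [] : (W `&` conj_set x W) (a^-1 * h * w * (a^-1 * h)^-1)%g => //.
  apply: W'W; apply: (normalizes_conj sU nW') => //.
  by apply: UM => //; exact: UV.
rewrite /coset_lift; set y := (h^-1 * (a * x * b))%g.
have -> : lrepr U ((h * w)^-1 * (a * x * b))%g = lrepr U y.
  apply: (lrepr_eq sU).
  have -> : (((h * w)^-1 * (a * x * b))^-1 * y =
    b^-1 * (x^-1 * (a^-1 * h * w * (a^-1 * h)^-1) * x) * b)%g by rewrite /y; group_word.
  by apply: WU; exact: nW.
have -> : ((h * lrepr U y)^-1 * (h * w * lrepr U y) =
  (b * (y^-1 * lrepr U y))^-1 * (x^-1 * (a^-1 * h * w * (a^-1 * h)^-1) * x)
   * (b * (y^-1 * lrepr U y)))%g by rewrite /y; group_word.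
by apply: nW => //; apply: UM => //; exact: lreprP.
Qed.

Variables (x : G) (i : nat) (alpha : seq G -> XU k U).
Hypothesis halpha : cocycle U (@X_at G k U x) i alpha.
Variables (R : seq G).
Hypothesis tR : transversal U R.
Hypothesis RP : forall t, covers U R t <-> dcoset U x U t.

Let A : seq G -> XU k U := homog alpha.

Lemma mem_R g : g \in R -> dcoset U x U g.
Proof. by move=> gR; apply/RP; exact: map_f. Qed.

Lemma homog_supp l t : tuples U i.+1 l -> X_fun (A l) t != 0 -> dcoset U x U t.
Proof.
move=> lU; rewrite /A /homog /= => At.
have [[_ aX] _] := halpha; have := aX _ (tuples_diffs sU lU) _ At.
have Uh : ocs_set U (head 1%g l) by case: l lU {At} => [[]|g l /tuples_cons[]].
by move=> /(iffRL (dcosetMl _ _ Uh)); rewrite mulVKg.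
Qed.

Lemma homog_covers l : tuples U i.+1 l -> covers_supp R (A l).
Proof. by move=> lU t /(homog_supp lU)/RP. Qed.

Lemma hdiff_alpha l : tuples U i.+2 l -> hdiff A l = 0.
Proof.
move=> lU; rewrite -(homog_cobd (n := i)); last by case: lU.
by rewrite /homog; have [_ ->] := halpha; rewrite ?rep_act0 //; exact: tuples_diffs.
Qed.

Section Coefficients.
Variable N : smoothRep G k.
Implicit Types (m : seq G -> N) (C : seq G -> N).

Definition hstar C l : N :=
  \sum_(g <- R) X_fun (A (take i.+1 l)) g *: C (map (kappa g) (drop i l)).

(** The cup product of [alpha] with the cochain [m], extended to the [G]-set
    [G / U], under the pairing of functions on [G / U]. *)
Definition star m : seq G -> N := inhomog (hstar (homog m)).

Let takeU n l : tuples U (i + n).+1 l -> tuples U i.+1 (take i.+1 l).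
Proof. by rewrite -addSn; exact: tuples_take. Qed.

Let dropU n l : tuples U (i + n).+1 l -> tuples U n.+1 (drop i l).
Proof. by rewrite -addnS; exact: tuples_drop. Qed.

(** The Leibniz rule, where [alpha] is a cocycle. *)
Lemma hdiff_hstar n m l : tuples U (i + n).+2 l ->
  hdiff (hstar (homog m)) l = (-1) ^+ i *: hstar (homog (cobd n m)) l.
Proof.
move=> lU; rewrite hdiff_sum scaler_sumr; apply: eq_bigr => g _.
have := @hdiff_cup _ k N i n (fun r => X_fun (A r) g)
  (fun r => homog m (map (kappa g) r)) l (proj1 lU).
rewrite /hcup /= => ->; rewrite (hdiff_map (kappa g) (homog m)) -(homog_cobd (n := n)); last first.
  by have := dropU (n := n.+1); rewrite addnS => /(_ _ lU) [+ _]; rewrite size_map.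
have -> : hdiff (fun r => X_fun (A r) g : k^o) (take i.+2 l) = 0.
  rewrite (hdiff_morph (f := fun phi : XU k U => X_fun phi g : k^o)) //.
  by rewrite hdiff_alpha //; have := @tuples_take _ U n i.+2 l; apply.
by rewrite scale0r add0r.
Qed.

(** An element [u] of [U] permutes the cosets over which the product sums. *)
Lemma hstar_equivariant n m : equivariant U (i + n).+1 (hstar (homog m)).
Proof.
move=> u l Uu lU; rewrite /hstar rep_act_sum.
have dl0 : drop i l != [::] by rewrite -size_eq0; have [-> _] := dropU lU.
have tl0 : take i.+1 l != [::] by rewrite -size_eq0; have [-> _] := takeU lU.
pose F g := X_fun (A (map (fun h => u * h)%g (take i.+1 l))) g
  *: homog m (map (kappa g) (map (fun h => u * h)%g (drop i l))).
rewrite -map_take -map_drop -/(F _) (eq_bigr F) //.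
rewrite (eq_sum_transversal sU (L' := map (fun h => u * h)%g R)) //; last 3 first.
- move=> g v Uv; rewrite /F XU_mulr //; congr (_ *: homog m _).
  by apply: eq_map => h; rewrite (coset_lift_mulr sU).
- exact: transversal_mull.
- move=> t Ft; rewrite covers_mull //.
  have At : X_fun (A (map (fun h => u * h)%g (take i.+1 l))) t != 0.
    by apply: contraNneq Ft; rewrite /F => ->; rewrite scale0r.
  have ulU : tuples U i.+1 (map (fun h => u * h)%g (take i.+1 l)).
    by apply: tuples_map (takeU lU) => h Uh; exact: UM.
  have dt := homog_supp ulU At.
  have -> : covers U R t by apply/RP.
  by apply/esym/RP/dcosetMl => //; exact: UV.
rewrite big_map; apply: eq_bigr => g _; rewrite /F /A homog_mull // rep_actZ.
rewrite /= mulKg; congr (_ *: _); rewrite -homog_mull; last first.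
  by rewrite -size_eq0 size_map size_eq0.
congr (homog m _); rewrite -!map_comp; apply: eq_map => h /=.
by rewrite coset_lift_mull mulKg.
Qed.

Lemma hstar_unif_continuous n m : continuous_cochain U n m ->
  unif_continuous U U (i + n).+1 (hstar (homog m)).
Proof.
move=> cm; have [[ca _] _] := halpha.
have [Wa [oWa nWa WaU WaC]] := homog_close ca.
have [Wm [oWm nWm WmU WmC]] := homog_close cm.
have [W' [oW' nW' _ W'C]] := coset_lift_close x oWm nWm WmU.
exists (W' `&` Wa); split.
- exact: open_subgroupI.
- by move=> v w Uv [? ?]; split; [exact: nW'|exact: nWa].
- by move=> w [_ /WaU].
move=> l l' lU l'U cl; rewrite /hstar big_seq [RHS]big_seq.
apply: eq_bigr => g gR; congr (X_fun _ _ *: _).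
  have c := close_take (i := i.+1) cl.
  have [s [sn e e' sP]] := close_zip (takeU lU) (takeU l'U) c.
  rewrite -e -e'; apply: (WaC 1%g) => // p /sP[Up Up' [_ Wp]].
  by rewrite invg1 !mul1g.
have c : close (W' `&` Wa) n.+1 (drop i l) (drop i l').
  by apply: close_drop; rewrite addnS.
have [s [sn e e' sP]] := close_zip (dropU lU) (dropU l'U) c.
pose s' := map (fun p => (kappa g p.1, kappa g p.2)) s.
have -> : map (kappa g) (drop i l) = map fst s' by rewrite -e -!map_comp.
have -> : map (kappa g) (drop i l') = map snd s' by rewrite -e' -!map_comp.
apply: (WmC g); first by rewrite size_map.
move=> _ /mapP[p /sP[Up Up' [Wp _]] ->] /=; split; try exact: (coset_liftP sU).
by apply: W'C => //; exact: mem_R.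
Qed.

Lemma star_continuous n m : continuous_cochain U n m ->
  continuous_cochain U (i + n) (star m).
Proof. by move=> /hstar_unif_continuous; exact: (continuous_inhomog sU). Qed.

Lemma homog_star n m l : tuples U (i + n).+1 l -> homog (star m) l = hstar (homog m) l.
Proof. exact: (homog_inhomog sU (hstar_equivariant (n := n) m)). Qed.

Lemma eq_hstar n m m' l : (forall r, tuples U n r -> m r = m' r) ->
  tuples U (i + n).+1 l -> hstar (homog m) l = hstar (homog m') l.
Proof.
move=> mm' lU; apply: eq_bigr => g _; congr (_ *: _).
have [sl _] := dropU lU.
apply: (homog_eq_coset (x := g) mm'); first by rewrite size_map.
by move=> _ /mapP[h _ ->]; exact: (coset_liftP sU).
Qed.

Lemma eq_star n m m' s : (forall r, tuples U n r -> m r = m' r) ->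
  tuples U (i + n) s -> star m s = star m' s.
Proof. by move=> mm' sU'; apply: (eq_hstar mm'); exact: tuples_pprods. Qed.

Lemma cobd_star n m s : tuples U (i + n).+1 s ->
  cobd (i + n) (star m) s = (-1) ^+ i *: star (cobd n m) s.
Proof.
move=> sU'; have [ss _] := sU'; rewrite cobdE //.
have pU := tuples_pprods sU sU'.
rewrite -hdiff_hstar //; apply: (@eq_hdiff _ _ (ocs_set U) (i + n).+1) => //; try by case: pU.
by move=> r sr rU; apply: (homog_star (n := n)).
Qed.

Lemma starD m m' s : star (fun r => m r + m' r) s = star m s + star m' s.
Proof.
rewrite /star /inhomog /hstar -big_split; apply: eq_bigr => g _ /=.
by rewrite /homog rep_actD scalerDr.
Qed.

Lemma starZ a m s : star (fun r => a *: m r) s = a *: star m s.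
Proof.
rewrite /star /inhomog /hstar scaler_sumr; apply: eq_bigr => g _ /=.
by rewrite /homog rep_actZ !scalerA mulrC.
Qed.

Lemma starB m m' s : star (fun r => m r - m' r) s = star m s - star m' s.
Proof.
rewrite -scaleN1r -starZ -starD; congr (star _ _).
by apply/funext => r; rewrite scaleN1r.
Qed.

Lemma star0 m s : (forall r, m r = 0) -> star m s = 0.
Proof.
move=> m0; rewrite /star /inhomog /hstar big1 // => g _.
by rewrite /homog m0 rep_act0 scaler0.
Qed.

(** For an invariant [v] the product with [alpha] is the effect on [alpha] of
    the homomorphism that corresponds to [v] by Frobenius reciprocity. *)
Lemma star_inv (f : XU k U -> N) s : is_repHom f -> tuples U i s ->
  star (fun=> f (charU k U)) s = f (alpha s).
Proof.
move=> fh sU'; rewrite /star /inhomog.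
have pU := tuples_pprods sU sU'.
rewrite /hstar take_oversize; last by case: pU => ->.
have -> : f (alpha s) = f (A (pprods s)) by rewrite /A homog_pprods.
rewrite (hom_XU fh tR (homog_covers pU)); apply: eq_bigr => g _; congr (_ *: _).
have : size (drop i (pprods s)) = 1%N.
  by rewrite size_drop; have [-> _] := pU; rewrite subSnn.
case: (drop i _) => // h r _; rewrite /homog /=.
rewrite -[kappa g h](mulVKg g) rep_actM; congr (rep_act _ _).
by rewrite -(repHom_act fh) charU_inv //; exact: (coset_liftP sU).
Qed.

End Coefficients.

Lemma star_hom (N N' : smoothRep G k) (f : N -> N') (m : seq G -> N) s :
  is_repHom f -> star (fun r => f (m r)) s = f (star m s).
Proof.
move=> fh; rewrite /star /inhomog /hstar (repHom_sum fh); apply: eq_bigr => g _.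
by rewrite (repHomZ fh) /homog (repHom_act fh).
Qed.

Section TotalStar.
Variables (M : smoothRep G k) (I : injResolution M).

Definition tot_star (B : forall p q : nat, seq G -> I q) p q : seq G -> I q :=
  if (i <= p)%N then star (B (p - i)%N q) else fun=> 0.

Lemma tot_diff_star B p q s : tuples U p s ->
  tot_diff (tot_star B) p q s = (-1) ^+ i *: tot_star (tot_diff B) p q s.
Proof.
move=> sp; rewrite {1}/tot_diff.
have low p' q' r : (p' < i)%N -> tot_star B p' q' r = 0.
  by move=> pi; rewrite /tot_star leqNgt pi.
have [ip|pi] := leqP i p; last first.
  have -> : match p return I q with 0 => 0 | p'.+1 => cobd p' (tot_star B p' q) s end = 0.
    case: (p) pi => // p' pi; rewrite cobd0 // => r; apply: low; exact: ltnW.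
  have -> : match q return I q with 0 => 0 | q'.+1 => res_d (tot_star B p q' s) end = 0.
    by case: (q) => // q'; rewrite low ?(repHom0 (res_d_hom _ _)).
  by rewrite /tot_star leqNgt pi !scaler0 addr0.
rewrite -(subnKC ip) in sp *; move: (p - i)%N sp => r sp {ip p}.
rewrite {3}/tot_star leq_addr addKn.
rewrite {1}/tot_diff starD starZ scalerDr; congr (_ + _).
  case: r sp => [|r] sp.
    rewrite star0 // scaler0 addn0.
    case ei : {1}i => [//|i']; rewrite cobd0 // => r; apply: low.
    by rewrite ei.
  rewrite addnS in sp *; rewrite /= -cobd_star //.
  by rewrite /tot_star leq_addr addKn.
rewrite exprD -scalerA; congr (_ *: (_ *: _)).
case: q => [|q]; first by rewrite star0.
by rewrite /tot_star leq_addr addKn (star_hom _ _ (res_d_hom I q)).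
Qed.

(** Up to the sign [(-1) ^ i] the product with [alpha] is a morphism of total
    complexes, which shifts the degree of cochains by [i]. *)
Lemma tot_cohom_star n B B' : tot_cohom U n B B' ->
  tot_cohom U (i + n) (tot_star B) (tot_star B').
Proof.
move=> [w [cw Dw]]; exists (fun p q s => (-1) ^+ i *: tot_star w p q s); split.
  move=> p q pqn; apply: (continuous_cochain_comp (fun b => (-1) ^+ i *: b)).
  rewrite /tot_star; case: leqP => ip; last exact: continuous_cochain_cst.
  rewrite -[in X in continuous_cochain U X](subnKC ip).
  apply: star_continuous; apply: cw.
  by apply/eqP; rewrite -(eqn_add2l i) addnS addnA subnKC // pqn.
move=> p q s pqn sp; rewrite tot_diffZ tot_diff_star // scalerA -expr2 sqrr_sign scale1r.
rewrite /tot_star; case: leqP => ip; last by rewrite subrr.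
rewrite -starB; apply: (eq_star (n := (p - i)%N)); last by rewrite subnKC.
move=> r rU; apply: Dw => //.
by apply/eqP; rewrite -(eqn_add2l i) addnA subnKC // pqn.
Qed.

End TotalStar.
End Star.

(** * The Yoneda product in terms of cochains *)

Section Shift.
Variables (T : nat -> zmodType) (j : nat).

(** Moves a family up by [j] degrees.  The transport along [q - j + j = q] occurs
    only here. *)
Definition shift (v : forall q, T (q + j)%N) q : T q :=
  if pselect (j <= q)%N is left jq then eq_rect _ T (v (q - j)%N) q (subnK jq) else 0.

Lemma shiftE v q : shift v (q + j)%N = v q.
Proof.
rewrite /shift; case: pselect => [jq|]; last by rewrite leq_addl.
move: (subnK jq); move: (addnK j q); move: (q + j - j)%N => r e; subst r => e.
by rewrite (eq_axiomK e).
Qed.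

Lemma shift_low v q : (q < j)%N -> shift v q = 0.
Proof. by move=> qj; rewrite /shift; case: pselect => // jq; have := jq; rewrite leqNgt qj. Qed.

End Shift.

Section LiftedFamilies.
Variables (G : locProfiniteGroupType) (k : comPzRingType) (U : ocSubgroup G).
Variables (M : smoothRep G k) (I : injResolution M) (j : nat).
Variables (f : M -> I j) (F : forall n, I n -> I (n + j)%N).
Hypothesis fF : yoneda_lift f F.

Let Fhom n : is_repHom (F (n := n)). Proof. by have [+ _ _] := fF; apply. Qed.

Let F_d n (v : I n) : res_d (F v) = (-1) ^+ j *: (F (res_d v) : I (n + j).+1).
Proof. by have [_ + _] := fF; apply. Qed.

(** [F] anticommutes with the differentials when [j] is odd; the sign
    [(-1) ^ (j p)] in the column [p] makes it a morphism of total complexes up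
    to the global sign [(-1) ^ j]. *)
Definition tot_lift (A : forall p q : nat, seq G -> I q) p q : seq G -> I q :=
  shift (T := fun q => (seq G -> I q : zmodType))
    (fun q0 s => (-1) ^+ (j * p) *: F (A p q0 s)) q.

Lemma tot_liftE A p q s :
  tot_lift A p (q + j)%N s = (-1) ^+ (j * p) *: F (A p q s).
Proof. by rewrite /tot_lift shiftE. Qed.

Lemma tot_lift_low A p q s : (q < j)%N -> tot_lift A p q s = 0.
Proof. by move=> qj; rewrite /tot_lift shift_low. Qed.

Lemma tot_diff_lift A p q s :
  tot_diff (tot_lift A) p q s = (-1) ^+ j *: tot_lift (tot_diff A) p q s.
Proof.
have [jq|qj] := leqP j q; last first.
  rewrite tot_lift_low // scaler0 /tot_diff.
  have -> : match p return I q with 0 => 0 | p'.+1 => cobd p' (tot_lift A p' q) s end = 0.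
    by case: p => // p; rewrite cobd0 // => r; exact: tot_lift_low.
  have -> : match q return I q with 0 => 0 | q'.+1 => res_d (tot_lift A p q' s) end = 0.
    case: q qj => // q qj; rewrite tot_lift_low ?(repHom0 (res_d_hom _ _)) //.
    exact: ltnW.
  by rewrite scaler0 addr0.
have [q0 e] : exists q0, q = (q0 + j)%N by exists (q - j)%N; rewrite subnK.
subst q => {jq}; rewrite tot_liftE /tot_diff (repHomD (Fhom _)) !scalerDr; congr (_ + _).
  case: p => [|p]; first by rewrite (repHom0 (Fhom _)) !scaler0.
  have -> : tot_lift A p (q0 + j)%N = fun s => (-1) ^+ (j * p) *: F (A p q0 s).
    by apply/funext => r; rewrite tot_liftE.
  rewrite cobdZ (cobd_hom _ _ _ (Fhom _)) scalerA mulnS exprD mulrA.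
  by rewrite -expr2 sqrr_sign mul1r.
rewrite (repHomZ (Fhom _)) !scalerA.
case: q0 => [|q0].
  rewrite (repHom0 (Fhom _)) scaler0.
  have low n : (n <= j)%N ->
      match n return I n with 0 => 0 | q'.+1 => res_d (tot_lift A p q' s) end = 0.
    by case: n => // n nj; rewrite tot_lift_low ?(repHom0 (res_d_hom _ _)).
  by rewrite (low (0 + j)%N (leqnn j)) scaler0.
transitivity ((-1) ^+ p *: (res_d (tot_lift A p (q0 + j)%N s) : I (q0.+1 + j)%N)) => //.
rewrite tot_liftE (repHomZ (res_d_hom _ _)) F_d.
rewrite -[LHS]/((-1) ^+ p *: ((-1) ^+ (j * p) *:
  ((-1) ^+ j *: (F (res_d (A p q0 s)) : I (q0.+1 + j)%N)))) !scalerA.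
by congr (_ *: _); rewrite [LHS]mulrC [_ * (-1) ^+ (j * p)]mulrC mulrA.
Qed.

Lemma tot_liftB A B p q s : tot_lift (fun p q s => A p q s - B p q s) p q s =
  tot_lift A p q s - tot_lift B p q s.
Proof.
have [jq|qj] := leqP j q; last by rewrite !tot_lift_low // subr0.
have [q0 e] : exists q0, q = (q0 + j)%N by exists (q - j)%N; rewrite subnK.
by subst q; rewrite !tot_liftE (repHomB (Fhom _)) scalerBr.
Qed.

Lemma tot_cohom_lift n A B : tot_cohom U n A B ->
  tot_cohom U (n + j) (tot_lift A) (tot_lift B).
Proof.
move=> [w [cw Dw]]; exists (fun p q s => (-1) ^+ j *: tot_lift w p q s); split.
  move=> p q pqn; apply: (continuous_cochain_comp (fun b => (-1) ^+ j *: b)).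
  have [jq|qj] := leqP j q; last first.
    apply: (eq_continuous_cochain (c := fun=> 0)) => [s _|].
      by rewrite tot_lift_low.
    exact: continuous_cochain_cst.
  have [q0 e] : exists q0, q = (q0 + j)%N by exists (q - j)%N; rewrite subnK.
  subst q; apply: (eq_continuous_cochain
    (c := fun s => (-1) ^+ (j * p) *: F (w p q0 s))) => [s _|].
    by rewrite tot_liftE.
  apply: (continuous_cochain_comp (fun b => (-1) ^+ (j * p) *: F b)); apply: cw.
  by apply/eqP; rewrite -(eqn_add2r j) addSn -addnA pqn.
move=> p q s pqn sp; rewrite -tot_liftB tot_diffZ tot_diff_lift scalerA -expr2.
rewrite sqrr_sign scale1r.
have [jq|qj] := leqP j q; last by rewrite !tot_lift_low.
have [q0 e] : exists q0, q = (q0 + j)%N by exists (q - j)%N; rewrite subnK.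
subst q; rewrite !tot_liftE; congr (_ *: F _); apply: Dw => //.
by apply/eqP; rewrite -(eqn_add2r j) -addnA pqn.
Qed.

End LiftedFamilies.

Section Product.
Variables (G : locProfiniteGroupType) (k : comPzRingType) (U : ocSubgroup G).
Variables (I : injResolution (XU k U)).
Variables (x : G) (i j : nat) (alpha beta : seq G -> XU k U).
Hypothesis halpha : cocycle U (@X_at G k U x) i alpha.
Variables (R : seq G).
Hypothesis tR : transversal U R.
Hypothesis RP : forall t, covers U R t <-> dcoset U x U t.


Local Notation star := (star i alpha R).

(** The chain of homotopies [F fa ~ F alpha = fb alpha = alpha * fb ~ alpha * beta]
    in the total complex.  Its middle term sits in bidegree [(i, j)], where
    [tot_lift] has the sign [(-1) ^ (j i)]. *)
Lemma frobenius_elt_star (fa : XU k U -> I i) (fb : XU k U -> I j)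
    (F : forall n, I n -> I (n + j)%N) :
  is_repHom fa -> is_repHom fb -> frobenius_elt U (fa (charU k U)) alpha ->
  frobenius_elt U (fb (charU k U)) beta -> yoneda_lift fb F ->
  frobenius_elt U ((-1) ^+ (i * j) *: F i (fa (charU k U))) (star beta).
Proof.
move=> fah fbh ha hb fF; have [Fh Fd F0] := fF.
have [Aa va] := inv_edge_exists (fa (charU k U)).
have [Ea ea] := aug_edge_exists I i alpha.
have [Ab vb] := inv_edge_exists (fb (charU k U)).
have [Eb eb] := aug_edge_exists I j beta.
have [V nV] := inv_edge_exists ((-1) ^+ (i * j) *: F i (fa (charU k U))).
have eE : aug_edge (I := I) (i + j) (star beta) (tot_star i alpha R Eb).
  have [E0 ES] := eb; split=> [s|p q s]; rewrite /tot_star.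
    rewrite leq_addr addKn -(star_hom _ _ _ _ _ (res_aug_hom I)); congr (star _ _).
    exact/funext.
  by case: leqP => // ip; rewrite star0.
apply/(frobenius_eltP U nV eE).
have := tot_cohom_lift fF (iffLR (frobenius_eltP U va ea) ha).
move=> /(tot_cohomZ ((-1) ^+ (i * j))) hA.
have hB := tot_cohom_star halpha tR RP (iffLR (frobenius_eltP U vb eb) hb).
apply: tot_cohom_trans (tot_eq_cohom _) (tot_cohom_trans hA
  (tot_cohom_trans (tot_eq_cohom _) hB)).
  move: nV va => [V0 VS] [a0 aS] [|p] q s pqn sp; last first.
    rewrite VS.
    have [jq|qj] := leqP j q; last by rewrite tot_lift_low // scaler0.
    have [q0 e] : exists q0, q = (q0 + j)%N by exists (q - j)%N; rewrite subnK.
    by subst q; rewrite tot_liftE aS (repHom0 (Fh _)) !scaler0.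
  rewrite add0n in pqn; subst q.
  by rewrite V0 tot_liftE muln0 expr0 scale1r a0.
move=> p q s pqn sp; move: vb ea => [b0 bS] [e0 eS].
have [jq|qj] := leqP j q; last first.
  rewrite tot_lift_low // scaler0 /tot_star.
  have ip : (i < p)%N by rewrite -(ltn_add2r j) -pqn ltn_add2l.
  rewrite ltnW // star0 // => r; case e : (p - i)%N => [|p'] //.
  by move: ip; rewrite -subn_gt0 e.
have [q0 e] : exists q0, q = (q0 + j)%N by exists (q - j)%N; rewrite subnK.
subst q; rewrite tot_liftE; case: q0 pqn {jq} => [|q0] pqn.
  have pi : p = i by apply/eqP; rewrite -(eqn_add2r j) pqn.
  subst p; rewrite e0 F0 /tot_star leqnn subnn.
  rewrite mulnC scalerA -expr2 sqrr_sign scale1r.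
  have -> : Ab 0%N j = fun=> fb (charU k U) by exact/funext.
  by rewrite (star_inv halpha tR RP).
rewrite eS (repHom0 (Fh _)) !scaler0 /tot_star leqNgt.
suff -> : (p < i)%N by [].
by rewrite -(ltn_add2r j) -pqn ltn_add2l ltnS leq_addl.
Qed.

Lemma ext_cocycle_exists (M : smoothRep G k) (J : injResolution M) n
    (c : seq G -> M) : cocycle U setT n c ->
  exists f : XU k U -> J n, ext_cocycle f /\ frobenius f c.
Proof.
move=> [[cc _] c0]; have [v [vU dv vc]] := @frobenius_elt_exists _ _ U _ J n c cc c0.
have [f fh fv] := hom_XU_exists vU; exists f; split; last by rewrite -fv in vc.
split=> // phi; have [L [tL Lphi]] := supp_transversal phi.
have dfh := comp_repHom fh (res_d_hom J n).
rewrite (hom_XU dfh tL Lphi) big1 // => g _.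
by rewrite fv dv rep_act0 scaler0.
Qed.

Lemma cohomologous_sym (V : set G) (M : smoothRep G k) n (c c' : seq G -> M) :
  cohomologous V setT n c c' -> cohomologous V setT n c' c.
Proof.
case: n => [|n] /=; first by move=> cc s /cc.
move=> [b [cb _] bc]; exists (fun s => (-1) *: b s).
  by split=> //; exact: (continuous_cochain_comp (fun v => (-1) *: v)).
by move=> s sV; rewrite cobdZ -bc // scaleN1r opprB.
Qed.

(** The invariants that correspond to [alpha] and [beta] exist and the class of
    the product does not depend on them, so that the choices which [E_product]
    quantifies over do not matter. *)
Lemma E_productP (hbeta : cocycle U setT j beta) rho :
  E_product I i j alpha beta rho <-> cohomologous U setT (i + j) rho (star beta).
Proof.
split=> [[fa [fb [F [[[fah _] ha] [[fbh fbd] hb] fF hrho]]]]|hrho].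
  exact: (frobenius_elt_uniq hrho (frobenius_elt_star fah fbh ha hb fF)).
have ha : cocycle U setT i alpha by have [[ca _] a0] := halpha.
have [fa [[fah fad] ha']] := ext_cocycle_exists I ha.
have [fb [[fbh fbd] hb']] := ext_cocycle_exists I hbeta.
have [F fF] := yoneda_lift_exists fbh fbd.
exists fa, fb, F; split=> //.
have := frobenius_elt_star fah fbh ha' hb' fF.
by move=> /frobenius_elt_cohom; apply; exact: cohomologous_sym.
Qed.

End Product.

(** * Injectivity of the Shapiro map *)

Lemma eq_cohomologous (G : topGroupType) (k : comPzRingType) (M : smoothRep G k)
    (V : set G) (N : set M) n (c c' e e' : seq G -> M) :
  (forall s, tuples V n s -> c s = e s) -> (forall s, tuples V n s -> c' s = e' s) ->
  cohomologous V N n c c' -> cohomologous V N n e e'.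
Proof.
case: n => [|n] ce ce' /=; first by move=> cc s sV; rewrite -ce // -ce' // cc.
by move=> [b bV bc]; exists b => // s sV; rewrite -ce // -ce' // bc.
Qed.

Lemma cohomologous_trans (G : topGroupType) (k : comPzRingType) (M : smoothRep G k)
    (V : set G) n (c c' e : seq G -> M) :
  cohomologous V setT n c c' -> cohomologous V setT n c' e -> cohomologous V setT n c e.
Proof.
case: n => [|n] /=; first by move=> cc ce s sV; rewrite cc // ce.
move=> [b [cb _] bc] [b' [cb' _] bc']; exists (fun s => b s + b' s).
  by split=> //; exact: (continuous_cochain2 +%R).
by move=> s sV; rewrite cobdD -bc // -bc' // addrA subrK.
Qed.

(** Homogeneous form of being cohomologous, for all degrees at once: a cochain
    on lists of length [n] has degree [n - 1], and in degree [-1] it is zero. *)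
Lemma cohomologous_homog (G : locProfiniteGroupType) (k : comPzRingType)
    (U V : set G) (M : smoothRep G k) (N : set M) n (c c' B : seq G -> M) :
  is_subgroup V -> V `<=` U ->
  (n = 0%N -> B [::] = 0) -> equivariant V n B -> unif_continuous U V n B ->
  (forall l, tuples V n l -> N (B l)) ->
  (forall s, tuples V n s -> c s - c' s = hdiff B (pprods s)) ->
  cohomologous V N n c c'.
Proof.
move=> sV VU; case: n => [|n] B0 BV BU BN cB.
  move=> s s0; apply/eqP; rewrite -subr_eq0 cB // (iffLR (tuples0 _ _) s0) /=.
  by rewrite subr0 B0.
exists (inhomog B).
  by split=> [|s sV']; [exact: (continuous_inhomog sV VU BU) | apply: BN; exact: tuples_pprods].
move=> s sV'; rewrite cB // cobdE; last by case: sV'.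
have [pn pV] := tuples_pprods sV sV'.
apply: (@eq_hdiff _ _ V n.+1) => // r sr rV; apply/esym.
exact: (homog_inhomog sV BV).
Qed.

Section Shapiro.
Variables (G : locProfiniteGroupType) (k : comPzRingType) (U : ocSubgroup G).
Implicit Types (g h t y : G) (l s : seq G).

Let ocU := ocs_prop U.
Let sU := ocs_subgroup U.
Let cU := @ocs_compact G U.
Let oU := @ocs_open G U.
Let U1 := ocs1 U.
Let UM g h := @ocsM G U g h.
Let UV g := @ocsV G U g.

Lemma Uconj_subgroup z : is_subgroup (Uconj U z).
Proof.
have [c1 cM cV] := conj_subgroup z sU.
by split=> [//|g h [Ug cg] [Uh ch]|g [Ug cg]]; split;
  [exact: UM | exact: cM | exact: UV | exact: cV].
Qed.

Lemma conj_compact z : compact (conj_set z U).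
Proof.
have -> : conj_set z U = [set (z * u * z^-1)%g | u in (U : set G)].
  apply/seteqP; split=> [v Uv|_ [u Uu <-]].
    by exists (z^-1 * v * z)%g => //; group_word.
  have -> : u = (z^-1 * (z * u * z^-1) * z)%g by group_word.
  by rewrite /conj_set /=; group_word.
apply: continuous_compact => //; apply: continuous_subspaceT => h.
apply: (@continuous_comp _ _ _ (fun v => z * v)%g (fun v => v * z^-1)%g).
  exact: mulgl_continuous.
exact: mulgr_continuous.
Qed.

Lemma Uconj_compact z : compact (Uconj U z).
Proof.
apply: compact_closedI => //; apply: compact_closed; last exact: conj_compact.
exact: locally_profinite_hausdorff.
Qed.

Lemma Uconj_open z : open (Uconj U z).
Proof. by apply: openI => //; exact: conj_open. Qed.

Lemma dcoset_compact z : compact (dcoset U z U).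
Proof.
have -> : dcoset U z U = [set (p.1 * (z * p.2))%g | p in (U : set G) `*` (U : set G)].
  apply/seteqP; split=> [y /dcosetP[a [b [Ua Ub ->]]]|_ [[a b] [Ua Ub] <-]].
    by exists (a, b) => //=; rewrite mulgA.
  by apply/dcosetP; exists a, b; split=> //; rewrite mulgA.
apply: continuous_compact; last exact: compact_setX.
apply: continuous_subspaceT; apply: mulg_cts; first by move=> p; exact: cvg_fst.
move=> p; apply: (@continuous_comp _ _ _ snd (fun v => z * v)%g).
  exact: cvg_snd.
exact: mulgl_continuous.
Qed.

Lemma homog_XU_head (c : seq G -> XU k U) l y :
  X_fun (homog c l) (head 1%g l * y)%g = X_fun (c (diffs l)) y.
Proof. by rewrite /homog /= mulKg. Qed.

Section Injectivity.
Variables (z : G) (n : nat) (e : seq G -> XU k U).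
Hypothesis he : cocycle U (@X_at G k U z) n e.

(** A section of the action of [U] on the cosets in [U z U].  It is defined with
    [lrepr U y] in place of [y] to depend on the coset [y U] only. *)
Definition carrier y : G :=
  xget 1%g [set u | ocs_set U u /\ ocs_set U ((u * z)^-1 * lrepr U y)%g].

Lemma carrierP y : dcoset U z U y ->
  ocs_set U (carrier y) /\ ocs_set U ((carrier y * z)^-1 * y)%g.
Proof.
move=> /dcosetP[a [b [Ua Ub yE]]].
rewrite /carrier; case: xgetP => [u _ [Uu Uz]|/(_ a)].
  split=> //; have -> : ((u * z)^-1 * y = (u * z)^-1 * lrepr U y * ((lrepr U y)^-1 * y))%g.
    by group_word.
  by apply: UM => //; exact: lreprP'.
case; split=> //; have -> : ((a * z)^-1 * lrepr U y = b * (y^-1 * lrepr U y))%g.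
  by rewrite yE; group_word.
by apply: UM => //; exact: lreprP.
Qed.

Lemma carrier_eq y y' : ocs_set U (y^-1 * y')%g -> carrier y = carrier y'.
Proof. by move=> Uyy; rewrite /carrier (lrepr_eq sU Uyy). Qed.

(** A [U]-equivariant family of maps from [U] to the fibres of [U -> U z U / U],
    which are the cosets of the stabilizer [Uconj U z]. *)
Definition fibre_map y g : G := (g * carrier (g^-1 * y))%g.

Lemma fibre_mapP y g : dcoset U z U y -> ocs_set U g ->
  ocs_set U (fibre_map y g) /\ ocs_set U ((fibre_map y g * z)^-1 * y)%g.
Proof.
move=> yz Ug; have [|Uc Ucz] := @carrierP (g^-1 * y)%g; first by apply/dcosetMl => //; exact: UV.
split; first exact: UM.
by move: Ucz; rewrite /fibre_map; group_word.
Qed.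

Lemma fibre_map_mull u y g : fibre_map y (u * g)%g = (u * fibre_map (u^-1 * y) g)%g.
Proof. by rewrite /fibre_map invgM !mulgA. Qed.

Lemma fibre_map_stab y g : dcoset U z U y -> ocs_set U g ->
  Uconj U z ((carrier y)^-1 * fibre_map y g)%g.
Proof.
move=> yz Ug; have [Uf Ufz] := fibre_mapP yz Ug; have [Uc Ucz] := carrierP yz.
split; first by apply: UM => //; exact: UV.
rewrite /conj_set /=.
have -> : (z^-1 * ((carrier y)^-1 * fibre_map y g) * z =
  ((carrier y * z)^-1 * y) * ((fibre_map y g * z)^-1 * y)^-1)%g by group_word.
by apply: UM => //; exact: UV.
Qed.

Lemma fibre_map_close W : open_subgroup W -> normalizes U W -> W `<=` U ->
  exists W', [/\ open_subgroup W', normalizes U W', W' `<=` W & forall y h h',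
    dcoset U z U y -> ocs_set U h -> ocs_set U h' -> W' (h^-1 * h')%g ->
    W ((fibre_map y h)^-1 * fibre_map y h')%g].
Proof.
move=> oW nW WU.
have [W' [oW' nW' W'W _]] := small_normal_open_subgroup ocU
  (open_subgroupI oW (conj_open_subgroup z oW)).
exists W'; split=> // [w /W'W[]//|].
move=> y h h' yz Uh Uh' Wh.
set w := (h^-1 * h')%g in Wh; have -> : h' = (h * w)%g by rewrite /w mulVKg.
have [|Uc Ucz] := @carrierP (h^-1 * y)%g; first by apply/dcosetMl => //; exact: UV.
set u := carrier (h^-1 * y)%g in Uc Ucz.
have [W1 W2] : (W `&` conj_set z W) (u^-1 * w * u)%g by apply: W'W; exact: nW'.
have -> : fibre_map y (h * w)%g = (h * w * u)%g.
  rewrite /fibre_map; congr (_ * _)%g; apply: carrier_eq.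
  have -> : (((h * w)^-1 * y)^-1 * (h^-1 * y) =
     ((u * z)^-1 * (h^-1 * y))^-1 * (z^-1 * (u^-1 * w * u) * z)
      * ((u * z)^-1 * (h^-1 * y)))%g by group_word.
  by apply: WU; exact: nW.
have -> : ((fibre_map y h)^-1 * (h * w * u) = u^-1 * w * u)%g.
  by rewrite /fibre_map -/u; group_word.
exact: W1.
Qed.

Variable b : seq G -> triv_rep G k.
Hypothesis cb : forall m, n = m.+1 -> continuous_cochain (Uconj U z) m b.
Hypothesis b0 : n = 0%N -> forall s, b s = 0.
Hypothesis be : forall s, tuples (Uconj U z) n s ->
  X_fun (e s) z = hdiff (homog b) (pprods s).

Let E : seq G -> XU k U := homog e.

Let E_cocycle l : tuples U n.+2 l -> hdiff E l = 0.
Proof.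
move=> lU; rewrite -(homog_cobd (n := n)); last by case: lU.
by rewrite /homog; have [_ ->] := he; rewrite ?rep_act0 //; exact: tuples_diffs.
Qed.

Let homotopy_fun l y : k :=
  if `[< dcoset U z U y >] then
    homog b (map (fibre_map y) l)
    - prism (fun r => X_fun (E r) y : k^o) (map (fun g => (g, fibre_map y g)) l)
  else 0.

Fact homotopy_subproof l : (homotopy_fun l : G -> k^o) \in X_pred U.
Proof.
apply: X_predP => [y u Uu|].
  rewrite /homotopy_fun.
  have -> : `[< dcoset U z U (y * u)%g >] = `[< dcoset U z U y >].
    exact/asbool_equiv_eq/dcosetMr.
  have fE g : fibre_map (y * u)%g g = fibre_map y g.
    rewrite /fibre_map; congr (_ * _)%g; apply/esym/carrier_eq.
    by have -> : ((g^-1 * y)^-1 * (g^-1 * (y * u)) = u)%g by group_word.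
  case: asboolP => // _; congr (homog b _ - _); first exact: eq_map.
  rewrite (eq_map (g := fun g => (g, fibre_map y g))) => [|g]; last by rewrite fE.
  by apply: eq_prismT => r; rewrite XU_mulr.
exists (dcoset U z U); first exact: dcoset_compact.
by move=> y; rewrite /homotopy_fun; case: asboolP => //; rewrite eqxx.
Qed.

(** The value at [y] cobounds in two steps: the prism moves the vertices to the
    coset of [Uconj U z] over [y U], and there [b] cobounds. *)
Definition shapiro_homotopy l : XU k U := XSort (homotopy_subproof l).

Lemma hdiff_shapiro_homotopy l : tuples U n.+1 l ->
  hdiff shapiro_homotopy l = E l.
Proof.
move=> lU; apply: val_inj; apply/funext => y.
rewrite -[LHS](hdiff_morph (f := fun phi : XU k U => X_fun phi y : k^o)) //=.
rewrite /homotopy_fun; case: asboolP => yz; last first.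
  rewrite hdiff_eq0 //; apply/esym/eqP; apply: contra_notT yz => Ey.
  have := Ey; rewrite /E /homog /= => Ey'.
  have [[_ eX] _] := he; have := eX _ (tuples_diffs sU lU) _ Ey'.
  move=> /dcosetMl; apply; apply: UV.
  by case: l lU {Ey Ey'} => [[]|g l /tuples_cons[]].
rewrite (hdiffB (A := k^o)) hdiff_map.
set m := fun g => (g, fibre_map y g).
rewrite (hdiff_map m (prism (fun r => X_fun (E r) y : k^o))) prism_homotopy.
have -> : prism (hdiff (fun r => X_fun (E r) y : k^o)) (map m l) = 0.
  have [sl lU'] := lU.
  rewrite (@eq_prism _ _ (ocs_set U) n.+1 _ (fun=> 0)) ?size_map //.
  - by elim: (map m l) => //= -[? ?] r ->; rewrite subr0.
  - move=> r sr rU; rewrite (hdiff_morph (f := fun phi : XU k U => X_fun phi y : k^o)) //.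
    by rewrite E_cocycle.
  - move=> _ /mapP[g /lU' Ug ->] /=; split=> //.
    by have [] := fibre_mapP yz Ug.
rewrite subr0 -!map_comp (eq_map (g := fibre_map y)) // (eq_map (f := fst \o m) (g := id)) //.
rewrite map_id opprB.
have fl : tuples (Uconj U z) n.+1 (map (fun g => (carrier y)^-1 * fibre_map y g)%g l).
  by apply: tuples_map lU => g Ug; exact: fibre_map_stab.
have dfl : tuples (Uconj U z) n (diffs (map (fibre_map y) l)).
  have := tuples_diffs (Uconj_subgroup z) fl.
  by rewrite (map_comp (fun g => (carrier y)^-1 * g)%g) diffs_mull.
suff -> : hdiff (homog b) (map (fibre_map y) l) = X_fun (E (map (fibre_map y) l)) y.
  by rewrite addrCA subrr addr0.
have l0 : map (fibre_map y) l != [::] by rewrite -size_eq0 size_map; case: lU => ->.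
have -> : hdiff (homog b) (map (fibre_map y) l) = X_fun (e (diffs (map (fibre_map y) l))) z.
  rewrite be // -{1}(pprods_diffs l0) -hdiff_map; apply: eq_hdiffT => r.
  by rewrite /homog diffs_mull.
rewrite -homog_XU_head /E; apply: XU_eval.
have : ocs_set U (head 1%g l) by case: l lU {fl dfl l0} => [[]|g l /tuples_cons[]].
case: l {lU fl dfl} l0 => //= g l _ Ug.
by have [] := fibre_mapP yz Ug.
Qed.

Lemma shapiro_homotopy_equivariant : equivariant U n shapiro_homotopy.
Proof.
move=> u l Uu lU; apply: val_inj; apply/funext => y /=; rewrite /homotopy_fun.
have -> : `[< dcoset U z U (u^-1 * y)%g >] = `[< dcoset U z U y >].
  by apply/asbool_equiv_eq/dcosetMl; exact: UV.
case: asboolP => // yz; congr (_ - _).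
  rewrite -map_comp (eq_map (g := (fun h => u * h)%g \o fibre_map (u^-1 * y)%g)).
    by rewrite map_comp /homog diffs_mull.
  by move=> g /=; rewrite fibre_map_mull.
have -> : map (fun g => (g, fibre_map y g)) (map (fun h => u * h)%g l) =
  map (fun p => (u * p.1, u * p.2)%g)
      (map (fun g => (g, fibre_map (u^-1 * y)%g g)) l).
  by rewrite -!map_comp; apply: eq_map => g /=; rewrite fibre_map_mull.
rewrite -(prism_map (fun h => u * h)%g).
case: l {lU} => [//|g l].
apply: (@eq_prism _ _ (fun=> True) (size (g :: l))) => //; last by rewrite size_map.
move=> r sr _; rewrite /E homog_mull //.
by rewrite -size_eq0 sr.
Qed.

Lemma shapiro_homotopy_unif_continuous : unif_continuous U U n shapiro_homotopy.
Proof.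
have [[ce _] _] := he; have [We [oWe nWe WeU WeC]] := homog_close ce.
have [Wb [oWb nWb WbU WbC]] : exists W, [/\ open_subgroup W, normalizes U W, W `<=` U
    & forall l l', tuples (Uconj U z) n l -> tuples (Uconj U z) n l' ->
        close W n l l' -> homog b l = homog b l'].
  case: (posnP n) => [n0|n0].
    exists (U : set G); split=> // [v w Uv Uw|l l' _ _ _].
    - by apply: UM => //; apply: UM => //; exact: UV.
    - by rewrite /homog /= !b0.
  have e1 : n = n.-1.+1 by rewrite prednK.
  rewrite e1; apply: (unif_continuous_homog ocU (Uconj_subgroup z)) => //.
  - by move=> g [].
  - exact: Uconj_compact.
  - exact: cb.
have oW := open_subgroupI oWe oWb.
have nW : normalizes U (We `&` Wb).
  by move=> v w Uv [? ?]; split; [exact: nWe | exact: nWb].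
have WU : We `&` Wb `<=` U by move=> w [/WeU].
have [W' [oW' nW' W'W W'C]] := fibre_map_close oW nW WU.
exists W'; split=> // [w /W'W[/WeU]//|l l' lU l'U cl].
apply: val_inj; apply/funext => y /=; rewrite /homotopy_fun.
case: asboolP => // yz; congr (_ - _).
  have inv m : homog b m = homog b (map (fun g => (carrier y)^-1 * g)%g m).
    by rewrite /homog diffs_mull.
  rewrite inv [RHS]inv -!map_comp; apply: WbC.
  - by apply: tuples_map lU => g Ug; exact: fibre_map_stab.
  - by apply: tuples_map l'U => g Ug; exact: fibre_map_stab.
  apply: (close_map (V := U) _ lU l'U cl) => g h Ug Uh gh /=.
  have -> : (((carrier y)^-1 * fibre_map y g)^-1 * ((carrier y)^-1 * fibre_map y h) =
    (fibre_map y g)^-1 * fibre_map y h)%g by group_word.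
  by have [] := W'C y g h yz Ug Uh gh.
apply: (@eq_prism_close _ _ _ U W'
  (fun g h => [/\ ocs_set U g, ocs_set U h & We (g^-1 * h)%g]) n) => //.
  move=> s sn sP; congr (X_fun _ y); apply: (WeC 1%g) => // p /sP[].
  by rewrite invg1 !mul1g.
move=> g h Ug Uh gh /=; have [Wgh _] := W'W _ gh.
have [Wf _] := W'C y g h yz Ug Uh gh.
by have [Ufg _] := fibre_mapP yz Ug; have [Ufh _] := fibre_mapP yz Uh.
Qed.

Lemma shapiro_homotopy_supp l : (@X_at G k U z) (shapiro_homotopy l).
Proof. by move=> y /=; rewrite /homotopy_fun; case: asboolP => //; rewrite eqxx. Qed.

Lemma shapiro_homotopy_nil : n = 0%N -> shapiro_homotopy [::] = 0.
Proof.
move=> n0; apply: val_inj; apply/funext => y /=; rewrite /homotopy_fun /=.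
by case: asboolP => // _; rewrite /homog /= b0 // subr0.
Qed.

End Injectivity.

(** On [U z U] the group [U] acts transitively on cosets with the stabilizer
    [Uconj U z].  Moving the vertices into the fibres of [fibre_map] compares the
    value of a cocycle at any [y] with values at [z] on [Uconj U z], where it
    bounds by hypothesis. *)
Lemma shapiro_inj z n (c c' : seq G -> XU k U) :
  cocycle U (@X_at G k U z) n c -> cocycle U (@X_at G k U z) n c' ->
  cohomologous (Uconj U z) (M := triv_rep G k) setT n (Sh z c) (Sh z c') ->
  cohomologous U (@X_at G k U z) n c c'.
Proof.
move=> [[cc cX] c0] [[cc' cX'] c0'] cc'S.
pose e s := c s - c' s.
have he : cocycle U (@X_at G k U z) n e.
  split; last by move=> s sU'; rewrite cobdB c0 // c0' // subrr.
  split; first exact: (continuous_cochain2 (fun a b => a - b)).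
  move=> s sU' t.
  suff : X_fun (c s) t - X_fun (c' s) t != 0 -> dcoset U z U t by [].
  have [->|/cX - /(_ sU')//] := eqVneq (X_fun (c s) t) 0.
  have [->|/cX' - /(_ sU')//] := eqVneq (X_fun (c' s) t) 0.
  by rewrite subrr eqxx.
have [b [cb b0 be]] : exists b : seq G -> triv_rep G k,
   [/\ forall m, n = m.+1 -> continuous_cochain (Uconj U z) m b,
       n = 0%N -> forall s, b s = 0
     & forall s, tuples (Uconj U z) n s -> X_fun (e s) z = hdiff (homog b) (pprods s)].
  move: cc'S; rewrite /Sh /res; case: n {cc cX c0 cc' cX' c0' he} => [|n] /=.
    move=> cc'; exists (fun=> 0); split=> // s s0.
    transitivity (X_fun (c s) z - X_fun (c' s) z : k^o) => //.
    by rewrite cc' // subrr (iffLR (tuples0 _ _) s0) /= subr0.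
  move=> [b [cb _] bc]; exists b; split=> // [m [<-]//|s sV].
  transitivity (X_fun (c s) z - X_fun (c' s) z : k^o) => //.
  by rewrite bc // cobdE //; case: sV.
apply: (cohomologous_homog (U := U) (B := shapiro_homotopy z e b)) => //.
- exact: shapiro_homotopy_nil.
- exact: (shapiro_homotopy_equivariant).
- exact: (shapiro_homotopy_unif_continuous he).
- by move=> l _; exact: shapiro_homotopy_supp.
- move=> s sU'; rewrite (hdiff_shapiro_homotopy he be) ?homog_pprods //.
  exact: tuples_pprods.
Qed.

End Shapiro.

(** * Double cosets and corestriction *)

Section FiniteSets.

Lemma finite_set_inj (T : choiceType) (S : eqType) (H : set T) (f : T -> S) (s : seq S) :
  (forall h, H h -> f h \in s) -> (forall h h', H h -> H h' -> f h = f h' -> h = h') ->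
  finite_set H.
Proof.
move=> fs finj.
have [[h0 Hh0]|H0] := pselect (exists h, H h); last first.
  rewrite (_ : H = set0); first exact: finite_set0.
  by apply/seteqP; split=> // h Hh; case: H0; exists h.
pose pick r := xget h0 [set h | H h /\ f h = r].
apply: (@sub_finite_set _ _ [set pick r | r in [set` s]]); last first.
  exact/finite_image/finite_seq.
move=> h Hh; exists (f h); first exact: fs.
by rewrite /pick; case: xgetP => [h' _ [Hh' e]|/(_ h)[]//]; exact: finj.
Qed.

Lemma finite_set_list (T : choiceType) (H : set T) : finite_set H ->
  exists r : seq T, [/\ uniq r, forall h, (h \in r) <-> H h &
    forall (A : nmodType) (F : T -> A), \sum_(h \in H) F h = \sum_(h <- r) F h].
Proof.
move=> /finite_seqP[r Hr]; exists (undup r); split=> [|h|A F].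
- exact: undup_uniq.
- by rewrite mem_undup Hr.
rewrite [RHS]fsbig_seq ?undup_uniq //; apply: eq_fsbigl.
by rewrite Hr; apply/seteqP; split=> h /=; rewrite mem_undup.
Qed.

End FiniteSets.

Section Transfer.
Variables (G : topGroupType) (V : set G).
Hypothesis sV : is_subgroup V.
Implicit Types (g h m t : G) (l s : seq G).

Lemma coset_liftE g m : coset_lift V g m = (m * (rcoset_repr V (g^-1 * m))^-1)%g.
Proof. by rewrite /coset_lift /lrepr invgM invgK. Qed.

(** The transfer map is the one on homogeneous tuples that is induced by the
    equivariant map [coset_lift V g] from [G] to the coset [g V]. *)
Lemma transferE g s : lrepr V g = g ->
  transfer V g^-1%g s = diffs (map (coset_lift V g) (pprods s)).
Proof.
move=> gg; have <- : rcoset_repr V (g^-1 * 1)%g = g^-1%g.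
  by rewrite mulg1 -[in RHS]gg /lrepr invgK.
rewrite /pprods; move: 1%g => m; elim: s m => [//|w s IH] m.
rewrite [scanl _ _ _]/= ![map _ (_ :: _)]/= diffs_cons2.
have e : rcoset_repr V (rcoset_repr V (g^-1 * m) * w)%g = rcoset_repr V (g^-1 * (m * w))%g.
  apply: rcoset_repr_eq => //.
  have -> : (rcoset_repr V (g^-1 * m) * w * (g^-1 * (m * w))^-1 =
    rcoset_repr V (g^-1 * m) * (g^-1 * m)^-1)%g by group_word.
  exact: rcoset_reprP.
rewrite [LHS]/= e IH; congr (_ :: _).
by rewrite !coset_liftE; group_word.
Qed.

Lemma diffs_mulr a l :
  diffs (map (fun m => m * a)%g l) = map (fun v => a^-1 * v * a)%g (diffs l).
Proof.
case: l => //= g l; elim: l g => //= h l IH g; rewrite IH; congr (_ :: _).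
by group_word.
Qed.

End Transfer.

(** Inversion turns the right cosets of the definition of corestriction into
    left cosets, which are the points of the homogeneous space [W / V]. *)
Lemma sum_rcosets (G : locProfiniteGroupType) (V W : set G) :
  is_subgroup V -> open V -> is_subgroup W -> compact W -> V `<=` W ->
  exists L : seq G, [/\ transversal V L, {in L, forall g, lrepr V g = g /\ W g},
    forall t, covers V L t <-> W t
    & forall (A : nmodType) (F : G -> A),
      \sum_(t \in [set rcoset_repr V w | w in W]) F t = \sum_(g <- L) F g^-1%g].
Proof.
move=> sV oV [W1 WM WV] cW VW.
pose T : set G := [set rcoset_repr V w | w in W].
have Tl t : T t -> lrepr V t^-1%g = t^-1%g.
  by move=> [w Ww <-]; rewrite /lrepr invgK rcoset_repr_id.
have TW t : T t -> W t.
  move=> [w Ww <-]; rewrite -[rcoset_repr V w](mulgVK w); apply: WM => //.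
  exact: VW (rcoset_reprP sV w).
have [s sW] := finite_lreprs sV oV cW.
have [|r [ur rT rsum]] := @finite_set_list _ T.
  apply: (@finite_set_inj _ _ _ (fun t => t^-1%g) s) => [t Tt|t t' _ _ /invg_inj//].
  by rewrite -(Tl _ Tt); apply: sW; apply: WV; exact: TW.
have lid : map (lrepr V) (map (fun t => t^-1%g) r) = map (fun t => t^-1%g) r.
  rewrite -map_comp; apply/eq_in_map => t /rT Tt /=; exact: Tl.
exists (map (fun t => t^-1%g) r); split.
- by rewrite /transversal lid map_inj_uniq //; exact: invg_inj.
- move=> _ /mapP[t /rT Tt ->]; split; first exact: Tl.
  by apply: WV; exact: TW.
- move=> t; rewrite /covers lid; split=> [/mapP[t' /rT Tt' tt']|Wt].
    have := VW _ (lreprP sV t); rewrite tt' => Wt.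
    have -> : t = (t'^-1 * (t^-1 * t'^-1)^-1)%g by group_word.
    by apply: (WM); apply: WV => //; exact: TW.
  apply/mapP; exists (rcoset_repr V t^-1%g) => //.
  by apply/rT; exists t^-1%g => //; exact: WV.
- by move=> A F; rewrite rsum big_map; apply: eq_bigr => t _; rewrite invgK.
Qed.

Section DoubleCosets.
Variables (G : locProfiniteGroupType) (k : comPzRingType) (U : ocSubgroup G).
Variables (x y z : G).
Implicit Types (g h t : G) (l s : seq G).

Let sU := ocs_subgroup U.
Let cU := @ocs_compact G U.
Let UM g h := @ocsM G U g h.
Let UV g := @ocsV G U g.

Variable H : set G.
Hypothesis hH : dcoset_reps (Uconj U x^-1%g) (Uconj U z^-1%g)
  (lcoset_set x^-1%g (prod_set U [set z]) `&` dcoset U y U) H.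

Let H_lcoset h : H h -> exists2 u, ocs_set U u & h = (x^-1 * (u * z))%g.
Proof.
have [HA _] := hH; move=> /HA[[_ [u Uu [_ -> <-]] <-] _].
by exists u.
Qed.

Let H_uniq h h' : H h -> H h' ->
  dcoset (Uconj U x^-1%g) h (Uconj U z^-1%g) h' -> h = h'.
Proof.
have [HA Hr] := hH; move=> Hh Hh' d.
have [h0 [_ h0u]] := Hr h' (HA _ Hh').
rewrite -(h0u h) // -(h0u h') //; split=> //.
apply/dcosetP; exists 1%g, 1%g; rewrite mul1g mulg1.
have [X1 _ _] := Uconj_subgroup U x^-1%g.
by have [Z1 _ _] := Uconj_subgroup U z^-1%g.
Qed.

Lemma double_cosets_finite : finite_set H.
Proof.
pose K := [set (x^-1 * (u * z))%g | u in (U : set G)].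
have cK : compact K.
  apply: continuous_compact => //; apply: continuous_subspaceT => u.
  apply: (@continuous_comp _ _ _ (fun v => v * z)%g (fun v => x^-1 * v)%g).
    exact: mulgr_continuous.
  exact: mulgl_continuous.
have sZ := Uconj_subgroup U z^-1%g.
have [s Ks] := finite_lreprs sZ (Uconj_open U z^-1%g) cK.
apply: (@finite_set_inj _ _ _ (lrepr (Uconj U z^-1%g)) s) => [h Hh|h h' Hh Hh'].
  by apply: Ks; have [u Uu ->] := H_lcoset Hh; exists u.
move=> /(lrepr_eqP sZ) hh'; apply: H_uniq => //; apply/dcosetP.
exists 1%g, (h^-1 * h')%g; split=> //; last by rewrite mul1g mulVKg.
by have [] := Uconj_subgroup U x^-1%g.
Qed.

(** The stabilizer in [Uconj U z] of the coset [z h ^-1 U]. *)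
Local Notation stab h := (Uconj U z `&` conj_set (z * h^-1)%g U).

(** The cosets [g U] in [U x U] with [g ^-1 z] in [U y U] are permuted by
    [Uconj U z]; the orbits are those of the cosets [z h ^-1 U]. *)
Lemma sum_orbits (A : nmodType) (F : G -> A) (R r : seq G) (L : G -> seq G) :
  transversal U R -> (forall t, covers U R t <-> dcoset U x U t) ->
  uniq r -> (forall h, h \in r <-> H h) ->
  (forall h, H h -> transversal (stab h) (L h)) ->
  (forall h, H h -> forall t, covers (stab h) (L h) t <-> Uconj U z t) ->
  (forall h, H h -> {in L h, forall g, Uconj U z g}) ->
  (forall g u, ocs_set U u -> F (g * u)%g = F g) ->
  (forall g, F g != 0 -> dcoset U x U g /\ dcoset U y U (g^-1 * z)%g) ->
  \sum_(g <- R) F g = \sum_(h <- r) \sum_(g <- L h) F (g * (z * h^-1))%g.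
Proof.
move=> tR RP ur rH tL LP LU FU Fsupp.
have [zU1 zUM zUV] := Uconj_subgroup U z.
have sS h : is_subgroup (stab h).
  have [c1 cM cV] := conj_subgroup (z * h^-1)%g sU.
  by split=> [|a b [? ?] [? ?]|a [? ?]]; split=> //;
    [exact: zUM | exact: cM | exact: zUV | exact: cV].
transitivity (\sum_(g <- [seq (g * (z * h^-1))%g | h <- r, g <- L h]) F g);
  last by rewrite big_allpairs_dep.
apply: (eq_sum_transversal sU) => //.
  rewrite /transversal map_allpairs; apply: allpairs_uniq_dep => //.
    by move=> h /rH Hh; apply: map_uniq (tL h Hh).
  move=> _ _ /allpairsPdep[h [g [/rH Hh gL ->]]] /allpairsPdep[h' [g' [/rH Hh' g'L ->]]].
  move=> /= /(lrepr_eqP sU) e.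
  have [u Uu hu] := H_lcoset Hh; have [u' Uu' hu'] := H_lcoset Hh'.
  have [Ug cg] := LU h Hh g gL; have [Ug' cg'] := LU h' Hh' g' g'L.
  (* If the cosets [g z h ^-1 U] and [g' z h' ^-1 U] coincide, then [h w = p h']
     with [p] in [U], and both [p] and [w] lie in the groups of the double cosets
     of which [H] is a set of representatives. *)
  pose v := (g^-1 * g')%g; have [Uv cv] : Uconj U z v by apply: zUM => //; exact: zUV.
  pose w := (z^-1 * v * z)%g.
  pose p := (h * w * h'^-1)%g.
  have Up : ocs_set U p.
    by move: e; rewrite /p /w /v; group_word.
  have hh' : h = h'.
    apply: H_uniq => //; apply/dcosetP; exists p^-1%g, w; split.
    - split; first exact: UV.
      rewrite /conj_set /= invgK.
      have -> : (x * p^-1 * x^-1 = u' * v^-1 * u^-1)%g.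
        by rewrite /p /w hu hu'; group_word.
      by apply: UM; [apply: UM|]; try apply: UV.
    - split=> //; rewrite /conj_set /= invgK /w.
      by have -> : (z * (z^-1 * v * z) * z^-1 = v)%g by group_word.
    - by rewrite /p; group_word.
  clear hu hu'; subst h'; suff -> : g = g' by [].
  apply: (transversal_inj (sS h) (tL h Hh)) => //; split; first exact: zUM (zUV _ _) _.
  move: Up; rewrite /p /w /conj_set /= /v invgM invgK.
  by group_word.
move=> t Ft; have [xt yt] := Fsupp t Ft.
have -> : covers U R t by apply/RP.
apply/esym/(coversP sU).
have [a [b [Ua Ub tE]]] := iffLR (dcosetP _ _ _ _) xt.
pose h0 := (x^-1 * (a^-1 * z))%g.
have h0y : dcoset U y U h0.
  have -> : h0 = (b * (t^-1 * z))%g by rewrite /h0 tE; group_word.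
  exact/dcosetMl.
have h0x : lcoset_set x^-1%g (prod_set U [set z]) h0.
  exists (a^-1 * z)%g => //; exists a^-1%g; first exact: UV.
  by exists z.
have [_ Hr] := hH; have [h [[Hh /dcosetP[p [w [[Up cp] [Uw cw] hE]]]] _]] := Hr h0 (conj h0x h0y).
(* Conversely [t U] contains [v z h ^-1] when [h0 = p h w]. *)
pose v := (z * w^-1 * z^-1)%g.
have Uzv : Uconj U z v.
  split; last by rewrite /v /conj_set /=; have := UV Uw; group_word.
  by have := UV cw; rewrite /conj_set /= /v; group_word.
have /(coversP (sS h))[g gL [Vg cgv]] := iffRL (LP h Hh v) Uzv.
exists (g * (z * h^-1))%g.
  by apply/allpairsPdep; exists h, g; split=> //; apply/rH.
have -> : ((g * (z * h^-1))^-1 * t =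
   ((z * h^-1)^-1 * (g^-1 * v) * (z * h^-1)) * p^-1 * b)%g.
  have ax : (a * x = z * h0^-1)%g by rewrite /h0; group_word.
  by rewrite tE ax hE /v; group_word.
by apply: UM => //; apply: UM => //; exact: UV.
Qed.

End DoubleCosets.

(** * The component of the product at a double coset *)

Lemma X_fun_sum (G : locProfiniteGroupType) (k : comPzRingType) (U : ocSubgroup G)
    (J : Type) (r : seq J) (phi : J -> XU k U) t :
  X_fun (\sum_(g <- r) phi g) t = \sum_(g <- r) X_fun (phi g) t.
Proof. by elim: r => [|g r IH]; rewrite ?big_nil // !big_cons -IH. Qed.

Lemma cohomologousD (G : topGroupType) (k : comPzRingType) (M : smoothRep G k)
    (V : set G) n (c c' e e' : seq G -> M) :
  cohomologous V setT n c c' -> cohomologous V setT n e e' ->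
  cohomologous V setT n (fun s => c s + e s) (fun s => c' s + e' s).
Proof.
case: n => [|n] /=; first by move=> cc ee s sV; rewrite cc // ee.
move=> [b [cb _] bc] [b' [cb' _] be]; exists (fun s => b s + b' s).
  by split=> //; exact: (continuous_cochain2 +%R).
by move=> s sV; rewrite cobdD -bc // -be // opprD addrACA.
Qed.

Lemma cohomologous_sum (G : topGroupType) (k : comPzRingType) (M : smoothRep G k)
    (V : set G) n (J : eqType) (r : seq J) (c c' : J -> seq G -> M) :
  (forall h, h \in r -> cohomologous V setT n (c h) (c' h)) ->
  cohomologous V setT n (fun s => \sum_(h <- r) c h s) (fun s => \sum_(h <- r) c' h s).
Proof.
elim: r => [|h r IH] cc.
  case: n {cc} => [|n] /=; first by move=> s _; rewrite !big_nil.
  exists (fun=> 0); first by split=> //; exact: continuous_cochain_cst.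
  by move=> s _; rewrite !big_nil subrr cobd0.
have := cohomologousD (cc h (mem_head _ _))
  (IH (fun h' h'r => cc h' (mem_behead (s := h :: r) h'r))).
by apply: eq_cohomologous => s _; rewrite big_cons.
Qed.

Section Pairing.
Variables (G : locProfiniteGroupType) (k : comPzRingType) (U : ocSubgroup G).
Variables (x y : G) (i j : nat) (alpha beta : seq G -> XU k U).
Hypothesis halpha : cocycle U (@X_at G k U x) i alpha.
Hypothesis hbeta : cocycle U (@X_at G k U y) j beta.
Variable z : G.
Implicit Types (g h t : G) (l s : seq G).

Let ocU := ocs_prop U.
Let sU := ocs_subgroup U.
Let oU := @ocs_open G U.
Let U1 := ocs1 U.
Let UM g h := @ocsM G U g h.
Let UV g := @ocsV G U g.

Local Notation kappa := (coset_lift U).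

(** The cup product of the values of [alpha] at [g] and of [beta] at [z], on
    lists of pairs so that the two factors can be moved independently: the first
    entries lie in [U] and the second ones in [g U]. *)
Definition pairing g (L : seq (G * G)) : k^o :=
  hcup i (fun r => X_fun (homog alpha (map fst r)) g)
    (fun r => X_fun (homog beta (map snd r)) z : k^o) L.

Lemma pairingE g (f f' : G -> G) l : pairing g (map (fun m => (f m, f' m)) l) =
  X_fun (homog alpha (map f (take i.+1 l))) g
  * X_fun (homog beta (map f' (drop i l))) z.
Proof. by rewrite /pairing /hcup -map_take -map_drop -!map_comp. Qed.

Lemma pairing_mulr g u L : ocs_set U u -> pairing (g * u)%g L = pairing g L.
Proof. by move=> Uu; rewrite /pairing /hcup XU_mulr. Qed.

(** Both factors are cocycles as long as the vertices stay in [U] and in [g U]: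
    hence the vertices may be moved there without changing the class. *)
Lemma pairing_cocycle g (L : seq (G * G)) : size L = (i + j).+2 ->
  {in L, forall p, ocs_set U p.1 /\ ocs_set U (g^-1 * p.2)%g} ->
  hdiff (pairing g) L = 0.
Proof.
move=> sL LU; pose A (r : seq (G * G)) : k^o := X_fun (homog alpha (map fst r)) g.
pose B (r : seq (G * G)) : k^o := X_fun (homog beta (map snd r)) z.
have A0 : hdiff A (take i.+2 L) = 0.
  rewrite (hdiff_map fst (fun r => X_fun (homog alpha r) g : k^o)).
  rewrite (hdiff_morph (f := fun phi : XU k U => X_fun phi g : k^o)) //.
  rewrite (hdiff_alpha halpha) //; split.
    by rewrite size_map size_takel // sL !ltnS leq_addr.
  by move=> _ /mapP[p /mem_take/LU[Up _] ->].
suff B0 : hdiff B (drop i L) = 0.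
  by rewrite (@hdiff_cup _ k k^o i j A B L sL) /hcup A0 B0 scale0r !scaler0 addr0.
rewrite (hdiff_map snd (fun r => X_fun (homog beta r) z : k^o)).
rewrite (hdiff_morph (f := fun phi : XU k U => X_fun phi z : k^o)) //.
have sd : size (map snd (drop i L)) = j.+2.
  by rewrite size_map size_drop sL -!addnS addnC addnK.
rewrite -(homog_cobd (n := j)) // (homog_eq_coset (U := U) (m' := fun=> 0) (x := g) _ sd).
- by rewrite /homog rep_act0.
- by have [_ b0] := hbeta.
- by move=> _ /mapP[p /mem_drop/LU[_ Up] ->].
Qed.

Lemma pairing_close : exists Wa Wb, [/\ open_subgroup Wa /\ open_subgroup Wb,
  normalizes U Wa /\ normalizes U Wb, Wa `<=` U /\ Wb `<=` U
  & forall g (s : seq ((G * G) * (G * G))), size s = (i + j).+1 ->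
    {in s, forall p,
      [/\ ocs_set U p.1.1, ocs_set U p.2.1 & Wa (p.1.1^-1 * p.2.1)%g] /\
      [/\ ocs_set U (g^-1 * p.1.2)%g, ocs_set U (g^-1 * p.2.2)%g
        & Wb (p.1.2^-1 * p.2.2)%g]} ->
    pairing g (map fst s) = pairing g (map snd s)].
Proof.
have [[ca _] _] := halpha; have [[cb _] _] := hbeta.
have [Wa [oWa nWa WaU WaC]] := homog_close ca.
have [Wb [oWb nWb WbU WbC]] := homog_close cb.
exists Wa, Wb; split=> // g s sn sP; rewrite /pairing /hcup.
have -> : homog alpha (map fst (take i.+1 (map fst s))) =
    homog alpha (map fst (take i.+1 (map snd s))).
  have := WaC 1%g (map (fun p => (p.1.1, p.2.1)) (take i.+1 s)).
  rewrite -!map_take -!map_comp; apply.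
    by rewrite size_map size_takel // sn !ltnS leq_addr.
  by move=> _ /mapP[p /mem_take/sP[? _] ->]; rewrite invg1 !mul1g.
suff -> : homog beta (map snd (drop i (map fst s))) =
    homog beta (map snd (drop i (map snd s))) by [].
have := WbC g (map (fun p => (p.1.2, p.2.2)) (drop i s)).
rewrite -!map_drop -!map_comp; apply.
  by rewrite size_map size_drop sn -addnS addnC addnK.
by move=> _ /mapP[p /mem_drop/sP[_ ?] ->].
Qed.

Lemma pairing_mull u g (L : seq (G * G)) : Uconj U z u -> size L = (i + j).+1 ->
  pairing g (map (fun p => (u * p.1, u * p.2)%g) L) = pairing (u^-1 * g)%g L.
Proof.
move=> [Uu cu] sL; rewrite /pairing /hcup -map_take -map_drop -!map_comp.
rewrite [map _ (take _ _)](map_comp (fun m => u * m)%g fst).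
rewrite [map _ (drop _ _)](map_comp (fun m => u * m)%g snd).
rewrite !homog_mull /=; last 2 first.
- by rewrite -size_eq0 size_map size_drop sL -addnS addnC addnK.
- by rewrite -size_eq0 size_map size_takel // sL !ltnS leq_addr.
congr (_ *: _); apply: XU_eval; move: (head _ _) => m.
have -> : ((m^-1 * (u^-1 * z))^-1 * (m^-1 * z) = z^-1 * u * z)%g by group_word.
exact: cu.
Qed.

(** The second factor is the translate by a point of [g U] of a function on
    [U y U]. *)
Lemma pairing_supp g l : tuples U (i + j).+1 l ->
  pairing g (map (fun m => (m, kappa g m)) l) != 0 ->
  dcoset U x U g /\ dcoset U y U (g^-1 * z)%g.
Proof.
move=> lU; rewrite (pairingE g id) map_id => nz.
have tU : tuples U i.+1 (take i.+1 l).
  by apply: (tuples_take (n := j)); rewrite addSn.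
split; first by apply: (homog_supp halpha tU); apply: contraNneq nz => ->; rewrite mul0r.
have bz : X_fun (homog beta (map (kappa g) (drop i l))) z != 0.
  by apply: contraNneq nz => ->; rewrite mulr0.
have [sd dU] : tuples U j.+1 (drop i l) by apply: (tuples_drop (i := i)); rewrite addnS.
have [[_ bX] _] := hbeta.
move: bz; rewrite /homog => /(bX (diffs _)); set K := map _ _.
have KU : tuples U j.+1 (map (fun m => g^-1 * m)%g K).
  split; first by rewrite !size_map.
  by move=> _ /mapP[_ /mapP[m _ ->] ->]; exact: coset_liftP.
have := tuples_diffs sU KU; rewrite diffs_mull => dK /(_ dK).
have : ocs_set U (g^-1 * head 1%g K)%g.
  by rewrite /K; case: (drop i l) sd => // m r _; exact: coset_liftP.
move: (head _ _) => m Um.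
have -> : (m^-1 * z = (g^-1 * m)^-1 * (g^-1 * z))%g by group_word.
by move=> /dcosetMl; apply; exact: UV.
Qed.

Lemma star_pairing (R : seq G) s :
  X_fun (star i alpha R beta s) z =
  \sum_(g <- R) pairing g (map (fun m => (m, kappa g m)) (pprods s)).
Proof.
rewrite /star /inhomog /hstar X_fun_sum; apply: eq_bigr => g _.
by rewrite (pairingE g id) map_id.
Qed.

Section Orbit.
Variables (h a c d : G).
Hypotheses (Ua : ocs_set U a) (Uc : ocs_set U c) (Ud : ocs_set U d).
Hypotheses (hE : h = (c * y * d)%g) (hE' : h = (x^-1 * a^-1 * z)%g).

Let V : set G := Uconj U z `&` conj_set (z * h^-1)%g U.

Let axE : (a * x = z * h^-1)%g. Proof. by rewrite hE'; group_word. Qed.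

Lemma stab_subgroup : is_subgroup V.
Proof.
have [z1 zM zV] := Uconj_subgroup U z.
have [c1 cM cV] := conj_subgroup (z * h^-1)%g sU.
by split=> [|g g' [? ?] [? ?]|g [? ?]]; split=> //;
  [exact: zM | exact: cM | exact: zV | exact: cV].
Qed.

Lemma stab_open : open V.
Proof. by apply: openI; [exact: Uconj_open | exact: conj_open]. Qed.

Local Notation lift := (coset_lift V).

Let lift_U g m : Uconj U z g -> ocs_set U (lift g m).
Proof.
move=> [Ug _]; rewrite -[lift g m](mulVKg g); apply: UM => //.
by have [[]] := coset_liftP stab_subgroup g m.
Qed.

Let lift_U2 g m : ocs_set U ((g * (z * h^-1))^-1 * (lift g m * (a * x * c)))%g.
Proof.
have [_ cl] := coset_liftP stab_subgroup g m.
rewrite axE; have -> : ((g * (z * h^-1))^-1 * (lift g m * (z * h^-1 * c)) =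
  ((z * h^-1)^-1 * (g^-1 * lift g m) * (z * h^-1)) * c)%g by group_word.
exact: UM.
Qed.

Lemma lift_close W g m m' : normalizes U W -> W `<=` V -> Uconj U z g ->
  ocs_set U m -> ocs_set U m' -> W (m^-1 * m')%g -> W ((lift g m)^-1 * lift g m')%g.
Proof.
move=> nW WV [Ug _] Um Um' Wm; set w := (m^-1 * m')%g in Wm.
have -> : m' = (m * w)%g by rewrite /w mulVKg.
rewrite /coset_lift; set t := (m^-1 * g)%g.
have Ut : ocs_set U t by apply: UM => //; exact: UV.
have -> : lrepr V ((m * w)^-1 * g)%g = lrepr V t.
  apply: (lrepr_eq stab_subgroup); apply: WV.
  have -> : (((m * w)^-1 * g)^-1 * t = t^-1 * w * t)%g by rewrite /t; group_word.
  exact: nW.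
have -> : ((m * lrepr V t)^-1 * (m * w * lrepr V t) =
  (t^-1 * lrepr V t)^-1 * (t^-1 * w * t) * (t^-1 * lrepr V t))%g by group_word.
apply: (nW); last exact: nW.
by have [[]] := lreprP stab_subgroup t.
Qed.

(** The two families of vertices that the homotopy joins: those of the product
    at the coset [g z h ^-1 U], and those of the corestriction. *)
Let vertices g m : (G * G) * (G * G) :=
  ((m, kappa (g * (z * h^-1))%g m), (lift g m * a, lift g m * (a * x * c))%g).

Let verticesU g m : Uconj U z g -> ocs_set U m ->
  let P p := ocs_set U p.1 /\ ocs_set U ((g * (z * h^-1))^-1 * p.2)%g in
  P (vertices g m).1 /\ P (vertices g m).2.
Proof.
move=> Ug Um; split; split=> //=; first exact: coset_liftP.
by apply: UM => //; exact: lift_U.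
Qed.

Variable L : seq G.
Hypothesis tL : transversal V L.
Hypothesis LU : {in L, forall g, lrepr V g = g /\ Uconj U z g}.
Hypothesis LP : forall t, covers V L t <-> Uconj U z t.

Definition orbit_homotopy l : k^o :=
  \sum_(g <- L) prism (pairing (g * (z * h^-1))%g) (map (vertices g) l).

Lemma hdiff_orbit_homotopy l : tuples (Uconj U z) (i + j).+1 l ->
  hdiff orbit_homotopy l =
  \sum_(g <- L) pairing (g * (z * h^-1))%g
                  (map (fun m => (lift g m * a, lift g m * (a * x * c))%g) l)
  - \sum_(g <- L) pairing (g * (z * h^-1))%g
                  (map (fun m => (m, kappa (g * (z * h^-1))%g m)) l).
Proof.
move=> [sl lU]; rewrite hdiff_sum -sumrB; apply: eq_big_seq => g gL.
have [_ Ug] := LU gL.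
rewrite (hdiff_map (vertices g) (prism (pairing (g * (z * h^-1))%g))) prism_homotopy.
rewrite -!map_comp; set X := prism _ _; suff -> : X = 0 by rewrite subr0.
pose P p := ocs_set U p.1 /\ ocs_set U ((g * (z * h^-1))^-1 * p.2)%g.
rewrite /X (@eq_prism _ _ P (i + j).+1 _ (fun=> 0)) ?size_map //.
- by elim: (map _ l) => //= -[? ?] r ->; rewrite subr0.
- by move=> r sr rP; exact: pairing_cocycle.
- by move=> _ /mapP[m /lU[Um _] ->]; exact: verticesU.
Qed.

Lemma orbit_homotopy_equivariant u l : Uconj U z u ->
  tuples (Uconj U z) (i + j) l ->
  orbit_homotopy (map (fun m => u * m)%g l) = orbit_homotopy l.
Proof.
move=> Uu [sl lU]; have sV := stab_subgroup.
have [_ zM zV] := Uconj_subgroup U z.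
rewrite /orbit_homotopy (eq_sum_transversal sV (L' := map (fun g => u * g)%g L)) //.
- rewrite big_map; apply: eq_bigr => g _.
  have -> : map (vertices (u * g)%g) (map (fun m => u * m)%g l) =
     map (fun p => ((u * p.1.1, u * p.1.2), (u * p.2.1, u * p.2.2))%g)
         (map (vertices g) l).
    rewrite -!map_comp; apply: eq_map => m /=; rewrite /vertices /=.
    have -> : lift (u * g)%g (u * m)%g = (u * lift g m)%g.
      by rewrite coset_lift_mull mulKg.
    have -> : kappa (u * g * (z * h^-1))%g (u * m)%g = (u * kappa (g * (z * h^-1)) m)%g.
      by rewrite coset_lift_mull -mulgA mulKg.
    by rewrite -!mulgA.
  rewrite -(prism_map (fun p : G * G => (u * p.1, u * p.2)%g)).
  apply: (@eq_prism _ _ (fun=> True) (i + j)) => //; last by rewrite size_map.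
  move=> r sr _; rewrite pairing_mull //; congr pairing.
  by group_word.
- move=> g v Vv; have [_ cv] := Vv; have cv' : ocs_set U ((z * h^-1)^-1 * v * (z * h^-1))%g by [].
  have e : (g * v * (z * h^-1) =
      g * (z * h^-1) * ((z * h^-1)^-1 * v * (z * h^-1)))%g by group_word.
  have ev : vertices (g * v)%g =1 vertices g.
    by move=> m; rewrite /vertices e (coset_lift_mulr sU) // (coset_lift_mulr sV).
  by rewrite (eq_map ev); apply: eq_prismT => r; rewrite e (pairing_mulr _ _ cv').
- exact: transversal_mull.
- move=> t _; rewrite covers_mull //; apply/idP/idP => /LP Ut; apply/LP.
    by apply: zM => //; exact: zV.
  by rewrite -[t](mulVKg u); exact: zM.
Qed.

Lemma orbit_homotopy_unif_continuous :
  unif_continuous U (Uconj U z) (i + j) orbit_homotopy.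
Proof.
apply: (unif_continuous_sum ocU (F := fun g l => prism _ (map (vertices g) l))) => g gL.
have [_ Ug] := LU gL.
have [Wa [Wb [[oWa oWb] [nWa nWb] [WaU WbU] WC]]] := pairing_close.
have [W1 [oW1 nW1 _ W1C]] := coset_lift_close x oWb nWb WbU.
have oV : open_subgroup V by split; [exact: stab_subgroup | exact: stab_open].
have [W [oW nW WW WU]] := small_normal_open_subgroup ocU
  (open_subgroupI (open_subgroupI oW1 oWa)
                  (open_subgroupI oV (conj_open_subgroup x oWb))).
exists W; split=> // l l' lU l'U.
pose Rg p p' :=
  [/\ ocs_set U p.1, ocs_set U p'.1 & Wa (p.1^-1 * p'.1)%g] /\
  [/\ ocs_set U ((g * (z * h^-1))^-1 * p.2)%g,
      ocs_set U ((g * (z * h^-1))^-1 * p'.2)%g & Wb (p.2^-1 * p'.2)%g].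
apply: (@eq_prism_close _ _ _ (Uconj U z) W Rg) lU l'U => [s sn sP|m m' [Um _] [Um' _] Wm].
  exact: WC.
have [[W1m Wam] _] := WW _ Wm.
have [[U11 U12] [U21 U22]] := verticesU Ug Um.
have [[U11' U12'] [U21' U22']] := verticesU Ug Um'.
have Wq : W ((lift g m)^-1 * lift g m')%g.
  by apply: lift_close => // w /WW[_ []].
have Wqa : W (a^-1 * ((lift g m)^-1 * lift g m') * a)%g by exact: nW.
have [[_ Waqa] [_ Wbqa]] := WW _ Wqa.
split; split; split=> //=.
- apply: W1C => //; rewrite -axE; apply/dcosetP; exists (g * a)%g, 1%g.
  by split=> //; [apply: UM => //; case: Ug | rewrite mulg1 mulgA].
- move: Waqa; group_word.
- have -> : ((lift g m * (a * x * c))^-1 * (lift g m' * (a * x * c)) =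
    c^-1 * (x^-1 * (a^-1 * ((lift g m)^-1 * lift g m') * a) * x) * c)%g by group_word.
  exact: nWb.
Qed.

(** Conjugation by [a] and by [a x c] multiplies the vertices from the right by
    these elements, and the transfer first moves them to a coset of the
    stabilizer: the second family of [vertices] results. *)
Lemma cores_pairing s :
  let Gamma := cup i (conj_coh a (Sh x alpha)) (conj_coh (a * x * c)%g (Sh y beta)) in
  tuples (Uconj U z) (i + j) s ->
  \sum_(g <- L) Gamma (transfer V g^-1%g s) =
  \sum_(g <- L) pairing (g * (z * h^-1))%g
     (map (fun m => (lift g m * a, lift g m * (a * x * c))%g) (pprods s)).
Proof.
move=> Gamma sU'; apply: eq_big_seq => g gL.
have [gg Ug] := LU gL; have sV := stab_subgroup.
rewrite (transferE sV s gg) pairingE /Gamma /cup /conj_coh /Sh /res.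
set l := pprods s; set K := map (lift g) l.
have sl : size l = (i + j).+1 by rewrite size_pprods; case: sU' => ->.
have [[Ug0 cg0] _] : Uconj U z g /\ True by [].
rewrite -diffs_take -diffs_drop -!diffs_mulr -[in LHS]map_take -[in LHS]map_drop.
rewrite -!map_comp -!homog_XU_head.
congr (_ * _).
  have : size (take i.+1 l) = i.+1 by rewrite size_takel // sl ltnS leq_addr.
  case: (take i.+1 l) => // m r _; apply: XU_eval => /=.
  have [_ cl] := coset_liftP sV g m.
  have -> : ((lift g m * a * x)^-1 * (g * (z * h^-1)) =
     ((z * h^-1)^-1 * (g^-1 * lift g m) * (z * h^-1))^-1)%g.
    have -> : (lift g m * a * x = lift g m * (z * h^-1))%g by rewrite -axE; group_word.
    by group_word.
  exact: UV.
have : size (drop i l) = j.+1 by rewrite size_drop sl -addnS addnC addnK.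
case: (drop i l) => // m r _; apply: XU_eval => /=.
have [[Ul cl] _] := coset_liftP sV g m.
have clz : ocs_set U (z^-1 * lift g m * z)%g.
  have -> : (z^-1 * lift g m * z =
    (z^-1 * g * z) * (z^-1 * (g^-1 * lift g m) * z))%g by group_word.
  exact: UM.
have -> : ((lift g m * (a * x * c) * y)^-1 * z = d * (z^-1 * lift g m * z)^-1)%g.
  rewrite axE; have -> : (lift g m * (z * h^-1 * c) * y = lift g m * z * d^-1)%g.
    by rewrite hE; group_word.
  by group_word.
by apply: UM => //; exact: UV.
Qed.

(** The homotopy has no boundary term because [pairing] is a cocycle; it is
    invariant under [Uconj U z], since the sum runs over a whole orbit. *)
Lemma cohomologous_orbit :
  let Gamma := cup i (conj_coh a (Sh x alpha)) (conj_coh (a * x * c)%g (Sh y beta)) in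
  cohomologous (Uconj U z) (M := triv_rep G k) setT (i + j)
    (fun s => \sum_(g <- L) Gamma (transfer V g^-1%g s))
    (fun s => \sum_(g <- L) pairing (g * (z * h^-1))%g
       (map (fun m => (m, kappa (g * (z * h^-1))%g m)) (pprods s))).
Proof.
move=> Gamma; have sz := Uconj_subgroup U z.
apply: (@cohomologous_homog _ _ U (Uconj U z) (triv_rep G k) setT (i + j) _ _
  orbit_homotopy) => //.
- by move=> g [].
- by move=> _; rewrite /orbit_homotopy big1.
- by move=> u l Uu lU; exact: orbit_homotopy_equivariant.
- exact: orbit_homotopy_unif_continuous.
- move=> s sU'; rewrite hdiff_orbit_homotopy; last exact: tuples_pprods.
  by rewrite /Gamma cores_pairing.
Qed.

End Orbit.
End Pairing.

(** * The product formula *)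

Section Components.
Variables (G : locProfiniteGroupType) (k : comPzRingType) (U : ocSubgroup G).
Implicit Types (z t u : G) (phi : XU k U).

Let sU := ocs_subgroup U.
Let cU := @ocs_compact G U.
Let oU := @ocs_open G U.
Let UV g := @ocsV G U g.

Lemma dcoset_transversal x :
  exists2 R, transversal U R & forall t, covers U R t <-> dcoset U x U t.
Proof.
have cK : compact [set (u * x)%g | u in (U : set G)].
  apply: continuous_compact => //; apply: continuous_subspaceT; exact: mulgr_continuous.
have [R tR RP] := transversal_exists sU oU cK; exists R => // t.
rewrite RP; split=> [[_ [u Uu <-] Ut]|/dcosetP[a [b [Ua Ub ->]]]].
  by apply/dcosetP; exists u, ((u * x)^-1 * t)%g; rewrite mulVKg.
by exists (a * x)%g; [exists a | rewrite mulKg].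
Qed.

Fact restrict_subproof z phi :
  (fun t => if `[< dcoset U z U t >] then X_fun phi t else 0) \in X_pred U.
Proof.
have [fU [K cK fK]] := X_pred_supp (X_funP phi); apply: X_predP => [t u Uu|].
  by rewrite fU //; have -> : `[< dcoset U z U (t * u)%g >] = `[< dcoset U z U t >]
    by exact/asbool_equiv_eq/dcosetMr.
by exists K => // t; case: asboolP => [_ /fK|_ /eqP].
Qed.

Definition restrict z phi : XU k U := XSort (restrict_subproof z phi).

Lemma restrictE z phi t :
  X_fun (restrict z phi) t = if `[< dcoset U z U t >] then X_fun phi t else 0.
Proof. by []. Qed.

Lemma restrict_linear z : linear (restrict z).
Proof.
move=> a phi psi; apply: val_inj; apply/funext => t.
rewrite [LHS]restrictE.
rewrite -[RHS]/(a * X_fun (restrict z phi) t + X_fun (restrict z psi) t) !restrictE.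
by case: asboolP => // _; rewrite mulr0 addr0.
Qed.

HB.instance Definition _ z :=
  GRing.isLinear.Build k (XU k U) (XU k U) *:%R (restrict z) (restrict_linear z).

Lemma restrict_act z u phi : ocs_set U u ->
  restrict z (rep_act u phi) = rep_act u (restrict z phi).
Proof.
move=> Uu; apply: val_inj; apply/funext => t /=.
have -> // : `[< dcoset U z U (u^-1 * t)%g >] = `[< dcoset U z U t >].
by apply/asbool_equiv_eq/dcosetMl; exact: UV.
Qed.

Lemma restrict_cobd z n (c : seq G -> XU k U) s : tuples U n.+1 s ->
  cobd n (fun r => restrict z (c r)) s = restrict z (cobd n c s).
Proof.
move=> sU'; rewrite /cobd !linearD linear_sum linearZ /= restrict_act; last first.
  by case: s sU' => [[]|g s /tuples_cons[]].
by congr (_ + _ + _); apply: eq_bigr => m _; rewrite linearZ.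
Qed.

Lemma restrict_cocycle z n (c : seq G -> XU k U) :
  cocycle U setT n c -> cocycle U (@X_at G k U z) n (fun s => restrict z (c s)).
Proof.
move=> [[cc _] c0]; split; last first.
  by move=> s sU'; rewrite restrict_cobd // c0 // linear0.
split=> [|s _ t]; first exact: continuous_cochain_comp.
by rewrite [X_fun _ _]restrictE; case: asboolP => // _; rewrite eqxx.
Qed.

End Components.

Section Representatives.
Variables (G : locProfiniteGroupType) (k : comPzRingType) (U : ocSubgroup G).
Variables (x y : G) (Z : set G).

Let sU := ocs_subgroup U.
Let cU := @ocs_compact G U.
Let oU := @ocs_open G U.
Let UM g h := @ocsM G U g h.
Let UV g := @ocsV G U g.

Let P : set G := prod_set (dcoset U x U) (dcoset U y U).

Hypothesis hZ : dcoset_reps U U [set z | dcoset U z U `<=` P] Z.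

Lemma dcoset_uniq t : P t -> exists! z, Z z /\ dcoset U z U t.
Proof.
move=> [p xp [q yq pq]]; have [_ Zr] := hZ; apply: Zr => /=.
move=> _ /dcosetP[a [b [Ua Ub ->]]]; exists (a * p)%g; first exact/dcosetMl.
by exists (q * b)%g; [exact/dcosetMr | rewrite -pq !mulgA].
Qed.

(** [U y U] is a finite union of cosets [r U], so that [U x U . U y U] is a finite
    union of double cosets [U x r U]. *)
Lemma dcosets_finite : finite_set Z.
Proof.
have cK : compact [set (u * y)%g | u in (U : set G)].
  apply: continuous_compact => //; apply: continuous_subspaceT; exact: mulgr_continuous.
have [s Ks] := finite_lreprs sU oU cK.
pose f z := xget 1%g [set r | r \in s /\ dcoset U (x * r)%g U z].
have fP z : Z z -> f z \in s /\ dcoset U (x * f z)%g U z.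
  have [ZP _] := hZ; move=> /ZP /= zP.
  have [p /dcosetP[a [b [Ua Ub pE]]] [q /dcosetP[c [d [Uc Ud qE]]] pq]] := zP z (dcoset_id U z).
  rewrite /f; case: xgetP => [r _ //|/(_ (lrepr U (b * c * y)%g))[]]; split.
    by apply: Ks; exists (b * c)%g => //; exact: UM.
  apply/dcosetP; exists a, ((lrepr U (b * c * y))^-1 * (b * c * y) * d)%g; split=> //.
    by apply: UM => //; exact: lreprP'.
  by rewrite -pq pE qE; group_word.
apply: (@finite_set_inj _ _ _ f s) => [z /fP[]//|z z' Zz Zz' e].
have [_ /dcosetP[a [b [Ua Ub zE]]]] := fP z Zz.
have [_ /dcosetP[a' [b' [Ua' Ub' zE']]]] := fP z' Zz'.
have zz' : dcoset U z U z'.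
  apply/dcosetP; exists (a' * a^-1)%g, (b^-1 * b')%g; split.
  - by apply: UM => //; exact: UV.
  - by apply: UM => //; exact: UV.
  - rewrite zE' -e; set w := f z in zE *; have -> : (x * w = a^-1 * z * b^-1)%g.
      by rewrite zE; group_word.
    by group_word.
have [ZP _] := hZ; have /= z'P := ZP _ Zz'.
have [z0 [_ z0u]] := dcoset_uniq (z'P z' (dcoset_id U z')).
rewrite -(z0u z) // -(z0u z') //; split=> //; exact: dcoset_id.
Qed.

Lemma sum_restrict (phi : XU k U) : (forall t, X_fun phi t != 0 -> P t) ->
  \sum_(z \in Z) restrict z phi = phi.
Proof.
move=> phiP; have [r [ur rZ ->]] := finite_set_list dcosets_finite.
apply: val_inj; apply/funext => t.
rewrite -[LHS]/(X_fun (\sum_(z <- r) restrict z phi) t) X_fun_sum.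
have [phit|/phiP Pt] := eqVneq (X_fun phi t) 0.
  by rewrite big1 // => z _; rewrite restrictE phit; case: asboolP.
have [z [[Zz zt] zu]] := dcoset_uniq Pt.
rewrite (bigD1_seq z) //=; last by apply/rZ.
rewrite asboolT // big_seq_cond big1 ?addr0 // => z' /andP[/rZ Zz' /eqP zz'].
by case: asboolP => // z't; case: zz'; apply/esym/zu.
Qed.

End Representatives.

Theorem proposition2p10 (G : locProfiniteGroupType) (k : comPzRingType)
  (U : ocSubgroup G) (I : injResolution (XU k U))
  (x y : G) (i j : nat) (alpha beta : seq G -> XU k U)
  (halpha : cocycle U (@X_at G k U x) i alpha)
  (hbeta : cocycle U (@X_at G k U y) j beta)
  (Z : set G)
  (hZ : dcoset_reps U U
          [set z | dcoset U z U `<=` prod_set (dcoset U x U) (dcoset U y U)] Z)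
  (H : G -> set G)
  (hH : forall z, Z z ->
     dcoset_reps (Uconj U x^-1%g) (Uconj U z^-1%g)
       (lcoset_set x^-1%g (prod_set U [set z]) `&` dcoset U y U) (H z))
  (a c d : G -> G -> G)
  (hacd : forall z h, Z z -> H z h ->
     [/\ ocs_set U (a z h), ocs_set U (c z h), ocs_set U (d z h),
         h = (c z h * y * d z h)%g & h = (x^-1 * (a z h)^-1 * z)%g]) :
  let Gamma z h : seq G -> k :=
    let V := conj_set (z * h^-1)%g U in
    cup i
      (res (U `&` V) (Uconj U z `&` V)
         (conj_coh (a z h) (Sh x alpha)))
      (res (conj_set z U `&` V) (Uconj U z `&` V)
         (conj_coh (a z h * x * c z h)%g (Sh y beta))) in
  let rhs z : seq G -> triv_rep G k := fun s =>
    \sum_(h \in H z)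
      cores (Uconj U z `&` conj_set (z * h^-1)%g U) (Uconj U z) (Gamma z h) s in
  let Sh_eq z gamma_z :=
    cocycle U (@X_at G k U z) (i + j) gamma_z /\
    cohomologous (Uconj U z) (M := triv_rep G k) setT (i + j)
      (Sh z gamma_z) (rhs z) in
  exists gamma : G -> seq G -> XU k U,
  [/\ forall z, Z z -> Sh_eq z (gamma z),
      forall z gamma_z, Z z -> Sh_eq z gamma_z ->
        cohomologous U (@X_at G k U z) (i + j) gamma_z (gamma z)
    & forall rho : seq G -> XU k U, cocycle U setT (i + j) rho ->
        (E_product I i j alpha beta rho <->
         cohomologous U setT (i + j) rho
           (fun s => \sum_(z \in Z) gamma z s))].
Proof.
move=> Gamma rhs Sh_eq.
have [sU oU _] := ocs_prop U.
have [R tR RP] := dcoset_transversal U x.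
have cb : continuous_cochain U j beta by have [[]] := hbeta.
have hsigma : cocycle U setT (i + j) (star i alpha R beta).
  split; first by split=> //; exact: (star_continuous halpha RP cb).
  move=> s sU'; rewrite (cobd_star halpha tR RP) //.
  have [_ b0] := hbeta.
  have s1 : tuples U (i + j.+1) s by rewrite addnS.
  by rewrite (eq_star alpha R (m' := fun=> 0) b0 s1) star0 ?scaler0.
have sigma_supp s t : tuples U (i + j) s -> X_fun (star i alpha R beta s) t != 0 ->
    prod_set (dcoset U x U) (dcoset U y U) t.
  move=> sU'; rewrite star_pairing => st.
  have [g gP] : exists g, pairing i alpha beta t g
      (map (fun m => (m, coset_lift U g m)) (pprods s)) != 0.
    apply: contrapT => no; case/eqP: st; rewrite big1 // => g _.
    by apply/eqP; apply: contra_notT no => gP; exists g.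
  have [xg yg] := pairing_supp halpha hbeta (tuples_pprods sU sU') gP.
  by exists g => //; exists (g^-1 * t)%g => //; rewrite mulVKg.
have Sh_gamma z : Z z -> Sh_eq z (fun s => restrict z (star i alpha R beta s)).
  move=> Zz; split; first exact: restrict_cocycle.
  have hHz := hH z Zz.
  have [r [ur rH rsum]] := finite_set_list (double_cosets_finite hHz).
  have sz := Uconj_subgroup U z.
  have hL h : exists L : seq G,
     let V := Uconj U z `&` conj_set (z * h^-1)%g U in
     [/\ transversal V L, {in L, forall g, lrepr V g = g /\ Uconj U z g},
       forall t, covers V L t <-> Uconj U z t
     & forall (A : nmodType) (F : G -> A),
       \sum_(t \in [set rcoset_repr V w | w in Uconj U z]) F t =
       \sum_(g <- L) F g^-1%g].
    apply: sum_rcosets => //.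
    - exact: stab_subgroup.
    - exact: stab_open.
    - exact: Uconj_compact.
  have [L LP] := choice hL.
  pose cl h g s := pairing i alpha beta z (g * (z * h^-1))%g
    (map (fun m => (m, coset_lift U (g * (z * h^-1))%g m)) (pprods s)).
  refine (@eq_cohomologous G k (triv_rep G k) (Uconj U z) setT (i + j)
    (fun s => \sum_(h <- r) \sum_(g <- L h) cl h g s)
    (fun s => \sum_(h <- r) \sum_(g <- L h)
       Gamma z h (transfer (Uconj U z `&` conj_set (z * h^-1)%g U) g^-1%g s))
    _ _ _ _ _).
  - move=> s sUz; have sU' : tuples U (i + j) s by apply: tuples_sub sUz => g [].
    rewrite /Sh /res restrictE asboolT; last exact: dcoset_id.
    rewrite star_pairing.
    rewrite (sum_orbits hHz (F := fun g => pairing i alpha beta z g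
       (map (fun m => (m, coset_lift U g m)) (pprods s))) tR RP ur rH (L := L)) //.
    - by move=> h _; have [] := LP h.
    - by move=> h _; have [] := LP h.
    - by move=> h _ g gL; have [_ /(_ g gL)[]] := LP h.
    - move=> g u Uu; rewrite pairing_mulr //; congr (pairing _ _ _ _ _ _).
      by apply: eq_map => m; rewrite coset_lift_mulr.
    - by move=> g; apply: (pairing_supp halpha hbeta); exact: tuples_pprods.
  - move=> s _; rewrite /rhs rsum; apply: eq_bigr => h _.
    by have [_ _ _ Lsum] := LP h; rewrite /cores Lsum.
  apply: cohomologous_sym; apply: cohomologous_sum => h /rH Hh.
  have [Ua Uc Ud hE hE'] := hacd z h Zz Hh; have [tL LU Lcov _] := LP h.
  exact: (cohomologous_orbit halpha hbeta Ua Uc Ud hE hE' tL LU Lcov).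
exists (fun z s => restrict z (star i alpha R beta s)); split=> //.
- move=> z gamma_z Zz [cg Sg]; have [cz Sz] := Sh_gamma z Zz.
  apply: (shapiro_inj cg cz); apply: cohomologous_trans Sg _.
  exact: cohomologous_sym.
move=> rho hrho; have hb : cocycle U setT j beta by have [_ b0] := hbeta.
rewrite (E_productP I halpha tR RP hb).
have sumE s : tuples U (i + j) s ->
    star i alpha R beta s = \sum_(z \in Z) restrict z (star i alpha R beta s).
  by move=> sU'; rewrite (sum_restrict hZ) // => t; exact: sigma_supp.
by split; apply: eq_cohomologous => // s /sumE.
Qed.
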